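(* Let $(T_k)_{k\ge 0}$ be the Tribonacci sequence and $(L_n)_{n\ge 0}$ the Lucas sequence. The positive integer triples $(k,m,n)$ with $m\le n$ satisfying \[ T_k = L_m L_n \] are precisely \[ (k,m,n)\in\{(1,1,1),\ (2,1,1),\ (4,1,3),\ (5,1,4),\ (8,3,5)\}. \]
   Context: The Tribonacci numbers are defined by $T_0=0$, $T_1=T_2=1$, and $T_k=T_{k-1}+T_{k-2}+T_{k-3}$ for $k\ge 3$. The Lucas numbers are defined by $L_0=2$, $L_1=1$, and $L_n=L_{n-1}+L_{n-2}$ for $n\ge 2$. *)

(* Defs.v *)
From mathcomp Require Import all_boot.

Set Implicit Arguments.
Unset Strict Implicit.
Unset Printing Implicit Defensive.

Fixpoint tribonacci (k : nat) : nat :=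
  match k with
  | 0 => 0
  | 1 => 1
  | 2 => 1
  | ((k''.+1 as k').+1 as k1).+1 => tribonacci k1 + tribonacci k' + tribonacci k''
  end.

Fixpoint lucas (n : nat) : nat :=
  match n with
  | 0 => 2
  | 1 => 1
  | (n''.+1 as n').+1 => lucas n' + lucas n''
  end.

(* Main.v *)
Require Import Defs.
From Stdlib Require Import Classical Reals ZArith Lia Lra Psatz.
From HB Require Import structures.
From mathcomp Require Import all_boot all_order all_algebra.
From mathcomp Require Import perm ssrZ Rstruct.

(* Let alpha be the real root of x^3 = x^2 + x + 1 and phi the golden ratio.  As
   T_k is close to alpha^k / gam and L_n to phi^n, a solution of T_k = L_m L_n makes
   both linear forms
     ln gam - k ln alpha + (m + n) ln phi,  ln (gam L_m) - k ln alpha + n ln phi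
   exponentially small, in m and in n respectively.  Lower bounds for such forms
   come from an interpolation determinant with entries x^i (z1^r z2^s)^l, where
   x = r + s t: by a zero estimate some determinant does not vanish, the Liouville
   inequality in Z[alpha][phi] bounds it from below, and it would be tiny if
   ln z2 - t ln z1 were.  A Dirichlet approximation of k / n reduces three logarithms
   to two.  This gives m + n < e^240; two rounds of Baker-Davenport reduction with
   rigorous enclosures of the logarithms give n <= 185, and the remaining cases are
   computed. *)

Set Implicit Arguments.
Unset Strict Implicit.
Unset Printing Implicit Defensive.
Import Order.TTheory GRing.Theory Num.Theory.

Delimit Scope R_scope with Re.
Delimit Scope Z_scope with BZ.

(** * The order Z[alpha][phi] and the Liouville inequality *)

(** The bound for two logarithms is exponential in the product of the heights of z1 and z2, up to
    logarithmic factors, and says nothing if that product is of order n. With d <= P in the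
    Dirichlet approximation p / d, the product is O(P h + P^2 + n / P), where h is the height of the
    third number. This is far weaker than a bound of Baker type, but sublinear in n, and that
    suffices against forms of size exp (-c n). For ln gam the height is constant, and P about (m +
    n)^(1/3) gives m = O((m + n)^(2/3)) up to logarithms. Then gam L_m has height about m, and P
    about sqrt (n / h) gives a lower bound with exponent about n^(5/6), still below n. Once the
    first reduction has bounded m, the height of gam L_m is bounded as well; the estimate for
    constant height then brings n below e^72, where the second round needs far less precision. *)

Lemma alpha_exists :
  {x : R | (1 <= x <= 2 /\ x * x * x - x * x - x - 1 = 0)%Re}.
Proof.
apply: (IVT (fun x => x * x * x - x * x - x - 1)%Re); try lra.
by move=> x; reg.
Qed.

Definition alpha : R := proj1_sig alpha_exists.
Definition phi : R := ((1 + sqrt 5) / 2)%Re.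

Local Open Scope R_scope.

Lemma alpha_cubic : alpha * alpha * alpha = alpha * alpha + alpha + 1.
Proof. by have [_ h] := proj2_sig alpha_exists; rewrite /alpha; lra. Qed.

Lemma phi_quadratic : phi * phi = phi + 1.
Proof.
have : sqrt 5 * sqrt 5 = 5 by apply: sqrt_sqrt; lra.
by rewrite /phi; nra.
Qed.

Lemma alpha_bounds : 1.839 < alpha < 1.84.
Proof.
have [[h1 h2] _] := proj2_sig alpha_exists; have := alpha_cubic.
by rewrite -/alpha in h1 h2 *; split; nra.
Qed.

Lemma phi_bounds : 1.618 < phi < 1.6181.
Proof.
have : sqrt 5 * sqrt 5 = 5 by apply: sqrt_sqrt; lra.
have := sqrt_pos 5.
by rewrite /phi; split; nra.
Qed.

(* [Q6 a b c d e f] is a + b alpha + c alpha^2 + (d + e alpha + f alpha^2) phi. *)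
Record ord := Q6 {x0 : Z; x1 : Z; x2 : Z; y0 : Z; y1 : Z; y2 : Z}.

Definition ord_tuple (z : ord) := (x0 z, x1 z, x2 z, y0 z, y1 z, y2 z).
Definition tuple_ord (t : Z * Z * Z * Z * Z * Z) :=
  let: (a, b, c, d, e, f) := t in Q6 a b c d e f.
Lemma ord_tupleK : cancel ord_tuple tuple_ord. Proof. by case. Qed.
HB.instance Definition _ := Choice.copy ord (can_type ord_tupleK).

Section OrdRing.
Local Open Scope Z_scope.

Definition ord_add z w := Q6 (x0 z + x0 w) (x1 z + x1 w) (x2 z + x2 w)
  (y0 z + y0 w) (y1 z + y1 w) (y2 z + y2 w).
Definition ord_opp z := Q6 (- x0 z) (- x1 z) (- x2 z) (- y0 z) (- y1 z) (- y2 z).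
Definition ord_zero := Q6 0 0 0 0 0 0.
Definition ord_one := Q6 1 0 0 0 0 0.

Definition mul0 a0 a1 a2 b0 b1 b2 := a0 * b0 + (a1 * b2 + a2 * b1) + a2 * b2.
Definition mul1 a0 a1 a2 b0 b1 b2 :=
  a0 * b1 + a1 * b0 + (a1 * b2 + a2 * b1) + (a2 * b2 + a2 * b2).
Definition mul2 a0 a1 a2 b0 b1 b2 :=
  a0 * b2 + a1 * b1 + a2 * b0 + (a1 * b2 + a2 * b1) + (a2 * b2 + a2 * b2).
Definition ord_mul z w :=
  let m F := F (x0 z) (x1 z) (x2 z) (x0 w) (x1 w) (x2 w)
           + F (y0 z) (y1 z) (y2 z) (y0 w) (y1 w) (y2 w) in
  let n F := F (x0 z) (x1 z) (x2 z) (y0 w) (y1 w) (y2 w)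
           + F (y0 z) (y1 z) (y2 z) (x0 w) (x1 w) (x2 w)
           + F (y0 z) (y1 z) (y2 z) (y0 w) (y1 w) (y2 w) in
  Q6 (m mul0) (m mul1) (m mul2) (n mul0) (n mul1) (n mul2).

Ltac ord_ring := repeat move=> [? ? ? ? ? ?];
  cbv [ord_add ord_mul ord_opp ord_zero ord_one mul0 mul1 mul2 x0 x1 x2 y0 y1 y2];
  congr Q6; ring.

Lemma ord_addA : associative ord_add. Proof. by ord_ring. Qed.
Lemma ord_addC : commutative ord_add. Proof. by ord_ring. Qed.
Lemma ord_add0 : left_id ord_zero ord_add. Proof. by ord_ring. Qed.
Lemma ord_addN : left_inverse ord_zero ord_opp ord_add. Proof. by ord_ring. Qed.
Lemma ord_mulA : associative ord_mul. Proof. by ord_ring. Qed.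
Lemma ord_mulC : commutative ord_mul. Proof. by ord_ring. Qed.
Lemma ord_mul1 : left_id ord_one ord_mul. Proof. by ord_ring. Qed.
Lemma ord_mulDl : left_distributive ord_mul ord_add. Proof. by ord_ring. Qed.
Lemma ord_one_neq0 : is_true (ord_one != ord_zero). Proof. by []. Qed.

End OrdRing.

HB.instance Definition _ :=
  GRing.isZmodule.Build ord ord_addA ord_addC ord_add0 ord_addN.
HB.instance Definition _ := GRing.Zmodule_isComNzRing.Build ord
  ord_mulA ord_mulC ord_mul1 ord_mulDl ord_one_neq0.

Definition val6 (a b c d e f : R) : R :=
  a + b * alpha + c * (alpha * alpha) + (d + e * alpha + f * (alpha * alpha)) * phi.
Definition ev (z : ord) : R :=
  val6 (IZR (x0 z)) (IZR (x1 z)) (IZR (x2 z)) (IZR (y0 z)) (IZR (y1 z)) (IZR (y2 z)).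
Definition abs6 (z : ord) : ord :=
  Q6 (Z.abs (x0 z)) (Z.abs (x1 z)) (Z.abs (x2 z)) (Z.abs (y0 z)) (Z.abs (y1 z)) (Z.abs (y2 z)).
(** This replaces the height: it dominates |ev z| and, up to constants, the other factors of the
    norm, and it can be estimated through sums, products and determinants. *)
Definition nrm (z : ord) : R := ev (abs6 z).

Lemma evD z w : ev (ord_add z w) = ev z + ev w.
Proof. by rewrite /ev /val6 /= !plus_IZR; ring. Qed.
Lemma evN z : ev (ord_opp z) = - ev z.
Proof. by rewrite /ev /val6 /= !opp_IZR; ring. Qed.
Lemma evM z w : ev (ord_mul z w) = ev z * ev w.
Proof.
case: z => a b c d e f; case: w => a' b' c' d' e' f'.
rewrite /ev /val6 /mul0 /mul1 /mul2 /= !(plus_IZR, mult_IZR).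
by ring [alpha_cubic phi_quadratic].
Qed.

Lemma ev_inj1 : ev ord_one = 1.
Proof. by rewrite /ev /val6 /=; ring. Qed.

Lemma alpha_gt0 : 0 < alpha. Proof. by have := alpha_bounds; lra. Qed.
Lemma phi_gt0 : 0 < phi. Proof. by have := phi_bounds; lra. Qed.

Lemma val6_le a b c d e f a' b' c' d' e' f' :
  a <= a' -> b <= b' -> c <= c' -> d <= d' -> e <= e' -> f <= f' ->
  val6 a b c d e f <= val6 a' b' c' d' e' f'.
Proof.
move=> *; have := alpha_gt0; have := phi_gt0 => ph0 al0.
have al2 : 0 < alpha * alpha by apply: Rmult_lt_0_compat.
by repeat apply: Rplus_le_compat => //; apply: Rmult_le_compat_r; try lra;
  repeat apply: Rplus_le_compat => //; apply: Rmult_le_compat_r; lra.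
Qed.

(* Every structure constant of Z[alpha][phi] is nonnegative, which makes
   [nrm] submultiplicative. *)
Lemma nrmM z w : nrm (ord_mul z w) <= nrm z * nrm w.
Proof.
rewrite /nrm -evM; case: z => a b c d e f; case: w => a' b' c' d' e' f'.
by apply: val6_le; cbv [ord_mul abs6 mul0 mul1 mul2 x0 x1 x2 y0 y1 y2];
  apply: IZR_le; repeat (apply: Z.le_trans (Z.abs_triangle _ _) _;
    apply: Z.add_le_mono); rewrite Z.abs_mul; apply: Z.le_refl.
Qed.

Lemma nrmD z w : nrm (ord_add z w) <= nrm z + nrm w.
Proof.
rewrite /nrm -evD; case: z => a b c d e f; case: w => a' b' c' d' e' f'.
by apply: val6_le; cbv [ord_add abs6 x0 x1 x2 y0 y1 y2]; apply: IZR_le; lia.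
Qed.

Lemma nrmN z : nrm (ord_opp z) = nrm z.
Proof. by case: z => *; rewrite /nrm /abs6 /= !Z.abs_opp. Qed.

Lemma ev_le_nrm z : Rabs (ev z) <= nrm z.
Proof.
apply: Rabs_le; rewrite /nrm; split; last first.
  by apply: val6_le; apply: IZR_le; rewrite /=; lia.
have -> : - ev (abs6 z) = ev (ord_opp (abs6 z)) by rewrite evN.
by apply: val6_le; apply: IZR_le; rewrite /=; lia.
Qed.

(** * The norm form and its anisotropy *)

Section NormForm.
Local Open Scope Z_scope.

(* [adj0], [adj1], [adj2] are the coordinates of N(u) / u, where
   u = a + b alpha + c alpha^2 and N(u) is [cubic_norm a b c]. *)
Definition adj0 a b c := (a + c) * (a + b + c + c) - (b + c + c) * (b + c).
Definition adj1 a b c := (b + c + c) * c - b * (a + b + c + c).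
Definition adj2 a b c := b * (b + c) - (a + c) * c.
Definition cubic_norm a b c :=
  a * adj0 a b c + c * adj1 a b c + (b + c) * adj2 a b c.

(** The conjugation phi -> 1 - phi over Z[alpha]. Hence [rel_norm] is the relative norm down to
    Z[alpha], and [norm6] the norm down to Z. *)
Definition conj_phi z :=
  Q6 (x0 z + y0 z) (x1 z + y1 z) (x2 z + y2 z) (- y0 z) (- y1 z) (- y2 z).
Definition rel_norm z := ord_mul z (conj_phi z).
Definition adj z := Q6 (adj0 (x0 z) (x1 z) (x2 z)) (adj1 (x0 z) (x1 z) (x2 z))
  (adj2 (x0 z) (x1 z) (x2 z)) 0 0 0.
Definition norm6 z :=
  let h := rel_norm z in cubic_norm (x0 h) (x1 h) (x2 h).

Lemma rel_norm_y z :
  [/\ y0 (rel_norm z) = 0, y1 (rel_norm z) = 0 & y2 (rel_norm z) = 0].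
Proof.
case: z => a b c d e f.
by cbv [rel_norm ord_mul conj_phi mul0 mul1 mul2 x0 x1 x2 y0 y1 y2]; split; ring.
Qed.

Definition residues := [:: 0; 1; 2].

Lemma mod3_residue a : exists2 r, is_true (r \in residues) & eqm 3 a r.
Proof.
exists (a mod 3); last by rewrite /eqm Z.mod_mod.
have : 0 <= a mod 3 < 3 by apply: Z.mod_pos_bound.
rewrite !inE => h; have [->|[->|->]] : a mod 3 = 0 \/ a mod 3 = 1 \/ a mod 3 = 2 by lia.
all: by rewrite eqxx ?orbT.
Qed.

Ltac eqm_congr := repeat first
  [ assumption | apply: (Zplus_eqm 3) | apply: (Zminus_eqm 3)
  | apply: (Zmult_eqm 3) | apply: (Zopp_eqm 3) | reflexivity ].

(* 3 is inert in both steps of the tower Z, Z[alpha], Z[alpha][phi], so a descent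
   modulo 3 shows that the norm forms are anisotropic. *)
Lemma cubic_norm_mod3 a b c : cubic_norm a b c = 0 ->
  [/\ a mod 3 = 0, b mod 3 = 0 & c mod 3 = 0].
Proof.
have [r r_in ar] := mod3_residue a; have [s s_in bs] := mod3_residue b.
have [t t_in ct] := mod3_residue c.
have : eqm 3 (cubic_norm a b c) (cubic_norm r s t).
  by rewrite /cubic_norm /adj0 /adj1 /adj2; eqm_congr.
rewrite /eqm => + norm0; rewrite norm0 => /esym norm_mod.
have : all (fun r => all (fun s => all (fun t =>
   (Z.modulo (cubic_norm r s t) 3 == 0) ==>
   [&& r == 0, s == 0 & t == 0]) residues) residues) residues by [].
move=> /allP/(_ _ r_in)/allP/(_ _ s_in)/allP/(_ _ t_in); rewrite norm_mod /=.
by case/and3P => /eqP er /eqP es /eqP et; rewrite ar bs ct er es et.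
Qed.

Lemma div3 a : a mod 3 = 0 -> a = 3 * (a / 3).
Proof. by have := Z.div_mod a 3; lia. Qed.

Lemma cubic_norm_eq0 a b c : cubic_norm a b c = 0 -> [/\ a = 0, b = 0 & c = 0].
Proof.
have [n] := ubnP (Z.to_nat (Z.abs a + Z.abs b + Z.abs c)).
elim: n a b c => [//|n IHn] a b c /ssrnat.ltP le_n norm0.
have [/div3 aE /div3 bE /div3 cE] := cubic_norm_mod3 norm0.
move: (a / 3) (b / 3) (c / 3) aE bE cE => a' b' c' aE bE cE; subst.
have [S0|S_neq0] := Z.eq_dec (Z.abs a' + Z.abs b' + Z.abs c') 0.
  by split; lia.
have norm0' : cubic_norm a' b' c' = 0.
  have : cubic_norm (3 * a') (3 * b') (3 * c') = 27 * cubic_norm a' b' c'.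
    by rewrite /cubic_norm /adj0 /adj1 /adj2; ring.
  by lia.
have /(IHn _ _ _)/(_ norm0') [-> -> ->] //: (Z.to_nat (Z.abs a' + Z.abs b' + Z.abs c') < n)%N.
by apply/ssrnat.ltP; lia.
Qed.

Lemma rel_norm_mod3 z : rel_norm z = ord_zero ->
  [/\ [/\ x0 z mod 3 = 0, x1 z mod 3 = 0 & x2 z mod 3 = 0],
      y0 z mod 3 = 0, y1 z mod 3 = 0 & y2 z mod 3 = 0].
Proof.
case: z => a b c d e f.
have [a' a_in aE] := mod3_residue a; have [b' b_in bE] := mod3_residue b.
have [c' c_in cE] := mod3_residue c; have [d' d_in dE] := mod3_residue d.
have [e' e_in eE] := mod3_residue e; have [f' f_in fE] := mod3_residue f.
move=> norm0; pose n z := rel_norm z.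
have [h0 h1 h2] : [/\ x0 (n (Q6 a' b' c' d' e' f')) mod 3 = 0,
   x1 (n (Q6 a' b' c' d' e' f')) mod 3 = 0 & x2 (n (Q6 a' b' c' d' e' f')) mod 3 = 0].
  have E g : g ord_zero = 0 -> eqm 3 (g (n (Q6 a b c d e f))) (g (n (Q6 a' b' c' d' e' f'))) ->
     g (n (Q6 a' b' c' d' e' f')) mod 3 = 0.
    by rewrite {1}/n norm0 => -> /esym.
  split; apply: E => //;
  by cbv [n rel_norm ord_mul conj_phi ord_zero mul0 mul1 mul2 x0 x1 x2 y0 y1 y2]; eqm_congr.
have : all (fun a => all (fun b => all (fun c => all (fun d => all (fun e => all (fun f =>
   [&& x0 (n (Q6 a b c d e f)) mod 3 == 0, x1 (n (Q6 a b c d e f)) mod 3 == 0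
     & x2 (n (Q6 a b c d e f)) mod 3 == 0] ==>
   [&& a == 0, b == 0, c == 0, d == 0, e == 0 & f == 0])
   residues) residues) residues) residues) residues) residues.
  by vm_compute.
move=> /allP/(_ _ a_in)/allP/(_ _ b_in)/allP/(_ _ c_in).
move=> /allP/(_ _ d_in)/allP/(_ _ e_in)/allP/(_ _ f_in).
rewrite h0 h1 h2 /= => /andP[/eqP Ea /and5P[/eqP Eb /eqP Ec /eqP Ed /eqP Ee /eqP Ef]].
by cbv [x0 x1 x2 y0 y1 y2]; rewrite aE bE cE dE eE fE Ea Eb Ec Ed Ee Ef.
Qed.

Lemma rel_norm_eq0 z : rel_norm z = ord_zero -> z = ord_zero.
Proof.
case: z => a b c d e f.
have [n] := ubnP (Z.to_nat (Z.abs a + Z.abs b + Z.abs c + Z.abs d + Z.abs e + Z.abs f)).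
elim: n a b c d e f => [//|n IHn] a b c d e f /ssrnat.ltP le_n norm0.
have [[] /div3 aE /div3 bE /div3 cE /div3 dE /div3 eE /div3 fE] := rel_norm_mod3 norm0.
cbv [x0 x1 x2 y0 y1 y2] in aE, bE, cE, dE, eE, fE.
move: (a / 3) (b / 3) (c / 3) (d / 3) (e / 3) (f / 3) aE bE cE dE eE fE.
move=> a' b' c' d' e' f' aE bE cE dE eE fE; subst.
have [S0|S_neq0] := Z.eq_dec (Z.abs a' + Z.abs b' + Z.abs c' + Z.abs d' + Z.abs e' + Z.abs f') 0.
  by clear -S0; congr Q6; lia.
have norm0' : rel_norm (Q6 a' b' c' d' e' f') = ord_zero.
  have [n0 n1 n2] := And3 (congr1 x0 norm0) (congr1 x1 norm0) (congr1 x2 norm0).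
  move: n0 n1 n2; clear.
  cbv [rel_norm ord_mul conj_phi ord_zero mul0 mul1 mul2 x0 x1 x2 y0 y1 y2] => n0 n1 n2.
  congr Q6; try ring; apply: (Z.mul_reg_l _ _ 9) => //; rewrite Z.mul_0_r.
  - by apply: etrans n0; ring.
  - by apply: etrans n1; ring.
  - by apply: etrans n2; ring.
have /(IHn _ _ _ _ _ _)/(_ norm0') : (Z.to_nat (Z.abs a' + Z.abs b' + Z.abs c' + Z.abs d' + Z.abs e' + Z.abs f') < n)%N.
    apply/ssrnat.ltP; move: S_neq0 le_n; rewrite !Z.abs_mul [Z.abs 3]/=; clear.
  have pos := Z.abs_nonneg; move: (pos a') (pos b') (pos c') (pos d') (pos e') (pos f').
  by move: (Z.abs a') (Z.abs b') (Z.abs c') (Z.abs d') (Z.abs e') (Z.abs f'); lia.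
by case=> *; subst.
Qed.

Lemma norm6_neq0 z : z <> ord_zero -> norm6 z <> 0.
Proof.
move=> z_neq0 /cubic_norm_eq0[h0 h1 h2]; apply/z_neq0/rel_norm_eq0.
have [] := rel_norm_y z; case: (rel_norm z) h0 h1 h2 => a b c d e f /=.
by move=> -> -> -> -> -> ->.
Qed.

End NormForm.

(** The complex embeddings never appear: the product of the two complex conjugates of u =
    [rel_norm z] is N(u) / u, a polynomial in the coordinates of u. *)
Lemma norm6E z : IZR (norm6 z) = ev z * ev (conj_phi z) * ev (adj (rel_norm z)).
Proof.
rewrite -evM /norm6 -/(rel_norm z); have [] := rel_norm_y z.
case: (rel_norm z) => a b c d e f /= -> -> ->.
rewrite /cubic_norm /ev /val6 /=; rewrite /adj0 /adj1 /adj2.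
rewrite !(plus_IZR, mult_IZR, minus_IZR); ring [alpha_cubic].
Qed.

Lemma nrm_ge0 z : 0 <= nrm z.
Proof. by apply: Rle_trans (ev_le_nrm z); apply: Rabs_pos. Qed.

Lemma nrm_conj_phi z : nrm (conj_phi z) <= 2 * nrm z.
Proof.
have := alpha_bounds; have := phi_bounds => ph al; have phi2 := phi_quadratic.
have al2 : 0 < alpha * alpha by nra.
case: z => a b c d e f; rewrite /nrm /ev /val6 /=.
have pos x : 0 <= IZR (Z.abs x) by apply: IZR_le; lia.
apply: Rle_trans (val6_le (a' := IZR (Z.abs a) + IZR (Z.abs d))
  (b' := IZR (Z.abs b) + IZR (Z.abs e)) (c' := IZR (Z.abs c) + IZR (Z.abs f))
  (d' := IZR (Z.abs d)) (e' := IZR (Z.abs e)) (f' := IZR (Z.abs f)) _ _ _ _ _ _) _;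
  try (by rewrite -?plus_IZR; apply: IZR_le; lia).
rewrite /val6; have := pos a; have := pos b; have := pos c.
have := pos d; have := pos e; have := pos f.
move: (IZR (Z.abs a)) (IZR (Z.abs b)) (IZR (Z.abs c)) (IZR (Z.abs d)) (IZR (Z.abs e)) (IZR (Z.abs f)) =>
  p q r p' q' r' *.
have qal : 0 <= q * alpha by apply: Rmult_le_pos; lra.
have ral : 0 <= r * (alpha * alpha) by apply: Rmult_le_pos; lra.
have qal' : 0 <= q' * alpha by apply: Rmult_le_pos; lra.
have ral' : 0 <= r' * (alpha * alpha) by apply: Rmult_le_pos; lra.
nra.
Qed.

(** With s = |a| + |b| + |c|, each coordinate of [adj] is a difference of two products of size at
    most 2 s^2, and 4 (1 + alpha + alpha^2) < 25. *)
Lemma nrm_adj z : nrm (adj z) <= 25 * (nrm z * nrm z).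
Proof.
case: z => a b c d e f.
pose s := (Z.abs a + Z.abs b + Z.abs c)%BZ.
have bnd p q r t m : (Z.abs p <= 2 * s -> Z.abs q <= 2 * s -> Z.abs r <= 2 * s ->
   Z.abs t <= 2 * s -> Z.abs p <= s \/ Z.abs q <= s -> Z.abs r <= s \/ Z.abs t <= s ->
   m = p * q - r * t -> Z.abs m <= 4 * (s * s))%BZ.
  move=> hp hq hr ht hpq hrt ->.
  have h1 : (Z.abs (p * q) <= 2 * (s * s))%BZ by rewrite Z.abs_mul; case: hpq; nia.
  have h2 : (Z.abs (r * t) <= 2 * (s * s))%BZ by rewrite Z.abs_mul; case: hrt; nia.
  by lia.
have := alpha_bounds; have := phi_bounds => ph al.
have s_ge0 : 0 <= IZR s by apply: IZR_le; lia.
have s_le : IZR s <= nrm (Q6 a b c d e f).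
  have pos x : 0 <= IZR (Z.abs x) by apply: IZR_le; lia.
  rewrite /s /nrm /ev /val6 /= !plus_IZR.
  have := pos a; have := pos b; have := pos c; have := pos d; have := pos e; have := pos f.
  move: (IZR (Z.abs a)) (IZR (Z.abs b)) (IZR (Z.abs c)) (IZR (Z.abs d)) (IZR (Z.abs e)) (IZR (Z.abs f)) =>
  p q r p' q' r' *.
  have al2 : 1 <= alpha * alpha by nra.
  have h1 : q <= q * alpha by nra.
  have h2 : r <= r * (alpha * alpha) by nra.
  have h3 : 0 <= q' * alpha by apply: Rmult_le_pos; lra.
  have h4 : 0 <= r' * (alpha * alpha) by apply: Rmult_le_pos; lra.
  have h5 : 0 <= (p' + q' * alpha + r' * (alpha * alpha)) * phi by apply: Rmult_le_pos; lra.
  lra.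
have step : nrm (adj (Q6 a b c d e f)) <= 25 * (IZR s * IZR s).
  apply: Rle_trans (val6_le (a' := IZR (4 * (s * s))) (b' := IZR (4 * (s * s)))
    (c' := IZR (4 * (s * s))) (d' := 0) (e' := 0) (f' := 0) _ _ _ _ _ _) _;
    cbv [abs6 adj x0 x1 x2 y0 y1 y2]; try (by apply: Rle_refl); try (apply: IZR_le).
  - by apply: (bnd (a + c) (a + b + c + c) (b + c + c) (b + c))%BZ; rewrite // /s; lia.
  - by apply: (bnd (b + c + c) c b (a + b + c + c))%BZ; rewrite // /s; lia.
  - by apply: (bnd b (b + c) (a + c) c)%BZ; rewrite // /s; lia.
  rewrite /val6 !mult_IZR; have := Rmult_le_pos _ _ s_ge0 s_ge0.
  move: (IZR s * IZR s) => S S0.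
  have h1 : S * alpha <= S * 1.84 by apply: Rmult_le_compat_l; lra.
  have h2 : S * (alpha * alpha) <= S * 3.3856 by apply: Rmult_le_compat_l; nra.
  lra.
apply: Rle_trans step _; nra.
Qed.

(** A nonzero integer norm is at least 1 in absolute value. In [norm6E] the conjugate costs 2 nrm z
    and the adjoint 25 (2 nrm z ^ 2) ^ 2. *)
Lemma liouville z : ev z <> 0 -> 1 <= Rabs (ev z) * (200 * nrm z ^ 5).
Proof.
move=> ev_neq0.
have z_neq0 : z <> ord_zero by move=> z0; apply: ev_neq0; rewrite z0 /ev /val6 /=; ring.
have : 1 <= Rabs (IZR (norm6 z)).
  by rewrite -abs_IZR; apply: IZR_le; have := norm6_neq0 z_neq0; lia.
rewrite norm6E !Rabs_mult => h; apply: Rle_trans h _.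
rewrite Rmult_assoc; apply: Rmult_le_compat_l; first exact: Rabs_pos.
have c1 := Rle_trans _ _ _ (ev_le_nrm _) (nrm_conj_phi z).
have h1 : nrm (rel_norm z) <= nrm z * (2 * nrm z).
  by apply: Rle_trans (nrmM _ _) _; apply: Rmult_le_compat_l (nrm_ge0 _) (nrm_conj_phi z).
have c2 := Rle_trans _ _ _ (ev_le_nrm _) (nrm_adj (rel_norm z)).
have h2 := Rmult_le_compat _ _ _ _ (nrm_ge0 _) (nrm_ge0 _) h1 h1.
apply: Rle_trans (Rmult_le_compat _ _ _ _ (Rabs_pos _) (Rabs_pos _) c1 c2) _.
have n0 := nrm_ge0 z.
apply: Rle_trans (Rmult_le_compat_l _ _ (25 * ((nrm z * (2 * nrm z)) * (nrm z * (2 * nrm z)))) _ _) _; lra.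
Qed.

Lemma nrm0 : nrm ord_zero = 0.
Proof. by rewrite /nrm /ev /val6 /=; ring. Qed.
Lemma nrm1 : nrm ord_one = 1.
Proof. by rewrite /nrm /ev /val6 /=; ring. Qed.

Local Close Scope R_scope.
Local Open Scope ring_scope.

Fact ev_is_zmod_morphism : zmod_morphism ev.
Proof. by move=> z w; rewrite -[z - w]/(ord_add z (ord_opp w)) evD evN. Qed.
Fact ev_is_monoid_morphism : monoid_morphism ev.
Proof. by split=> [|z w]; [exact: ev_inj1 | exact: evM]. Qed.
HB.instance Definition _ := GRing.isZmodMorphism.Build ord R ev ev_is_zmod_morphism.
HB.instance Definition _ := GRing.isMonoidMorphism.Build ord R ev ev_is_monoid_morphism.

Lemma nrm_mul_le z w b c : nrm z <= b -> nrm w <= c -> nrm (z * w) <= b * c.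
Proof.
move=> hz hw; apply: (le_trans (y := nrm z * nrm w)); first exact/RleP/nrmM.
by apply: ler_pM => //; apply/RleP/nrm_ge0.
Qed.

Lemma nrm_prod_le (I : Type) (r : seq I) (f : I -> ord) (b : I -> R) :
  (forall i, nrm (f i) <= b i) -> nrm (\prod_(i <- r) f i) <= \prod_(i <- r) b i.
Proof.
move=> le_b; apply: (big_ind2 (fun z x => nrm z <= x)) => // [|z1 z2 x y].
  by rewrite [nrm 1]nrm1.
exact: nrm_mul_le.
Qed.

Lemma nrm_exp_le z b n : nrm z <= b -> nrm (z ^+ n) <= b ^+ n.
Proof.
move=> le_b; elim: n => [|n IHn]; first by rewrite !expr0 [nrm 1]nrm1.
by rewrite !exprS; apply: nrm_mul_le.
Qed.

Lemma nrm_nat_le n : nrm n%:R <= n%:R.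
Proof.
elim: n => [|n IHn]; first by rewrite [nrm 0]nrm0.
rewrite !mulrS; apply: (le_trans (y := nrm 1 + nrm n%:R)); first exact/RleP/nrmD.
by rewrite [nrm 1]nrm1 lerD2l.
Qed.

Lemma nrm_det_le N (M : 'M[ord]_N) (b : 'I_N -> R) :
  (forall i j, nrm (M i j) <= b i) -> nrm (\det M) <= N`!%:R * \prod_i b i.
Proof.
move=> le_b; rewrite /determinant.
have : nrm (\sum_(s : 'S_N) (-1) ^+ s * \prod_i M i (s i)) <= \sum_(s : 'S_N) \prod_i b i.
  apply: (big_ind2 (fun z x => nrm z <= x)) => [|z1 x1 z2 x2 h1 h2|s _].
  - by rewrite [nrm 0]nrm0.
  - apply: le_trans (lerD h1 h2); exact/RleP/nrmD.
  have le_prod : nrm (\prod_i M i (s i)) <= \prod_i b i by apply: nrm_prod_le => i.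
  rewrite mulr_sign; case: (s : bool) => //.
  by rewrite -[- _]/(ord_opp _) nrmN.
move=> h; apply: le_trans h _.
by rewrite sumr_const card_Sn mulr_natl.
Qed.

(** * Determinants of power series values *)

(** Counting by layers: for each m < N at most m + 1 indices have weight at most m, because the
    [Some] values are distinct and a [None] weighs N. Summing the complementary counts over m
    recovers both sides, with weights cut off at N. *)
Lemma sum_injective_weight (N Q : nat) (f : 'I_N -> option 'I_Q)
    (w : option 'I_Q -> nat) :
  (forall o, w o = if o is Some n then nat_of_ord n else N) ->
  (forall i j n, f i = Some n -> f j = Some n -> i = j) ->
  (\sum_(i < N) i <= \sum_(i < N) w (f i))%N.
Proof.
move=> wE f_inj.
have eq_sum (g : 'I_N -> nat) :
    (\sum_(i < N) minn (g i) N = \sum_(m < N) #|[pred i | m < g i]|)%N.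
  transitivity (\sum_(i < N) \sum_(m < N | m < g i) 1)%N.
    apply: eq_bigr => i _.
    rewrite sum1_card -[LHS](card_ord (minn (g i) N)).
    have le_N : (minn (g i) N <= N)%N by rewrite geq_minr.
    rewrite -(card_image (f := widen_ord le_N)); last by move=> x y [] /val_inj.
    apply: eq_card => m; apply/imageP/idP => [[x _ ->]|].
      by have := ltn_ord x; rewrite ltn_min => /andP[].
    move=> lt_m0; have lt_m : (m < g i)%N := lt_m0.
    have lt_m' : (m < minn (g i) N)%N by rewrite ltn_min lt_m ltn_ord.
    by exists (Ordinal lt_m') => //; apply: val_inj.
  rewrite (exchange_big_dep xpredT) //=; apply: eq_bigr => m _.
  by rewrite sum1_card.
apply: (@leq_trans (\sum_(i < N) minn (w (f i)) N)); last by apply: leq_sum => i _; rewrite geq_minl.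
have -> : (\sum_(i < N) i = \sum_(i < N) minn i N)%N.
  by apply: eq_bigr => i _; apply/esym/minn_idPl/ltnW.
rewrite !eq_sum; apply: leq_sum => m _.
rewrite -(leq_add2l #|[pred i : 'I_N | i <= m]%N|).
have cardC_le (g : 'I_N -> nat) :
    (#|[pred i | g i <= m]%N| + #|[pred i | m < g i]%N| = N)%N.
  rewrite -[RHS]card_ord -(cardC [pred i | g i <= m]%N); congr (_ + _)%N.
  by apply: eq_card => i; rewrite !inE -ltnNge.
rewrite (cardC_le (fun i => nat_of_ord i)) -[X in (X <= _)%N](cardC_le (fun i => w (f i))) leq_add2r.
pose h (i : 'I_N) : 'I_N := if f i is Some n then insubd i (n : nat) else i.
rewrite -(card_in_image (f := h)).
  apply: subset_leq_card; apply/subsetP => _ /imageP[i + ->].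
  rewrite !inE wE /h; case: (f i) => [n|]; last by rewrite leqNgt ltn_ord.
  by move=> le_nm; rewrite val_insubd (leq_ltn_trans le_nm (ltn_ord m)).
move=> i j; rewrite !inE !wE /h.
case fi: (f i) => [n|]; last by rewrite leqNgt ltn_ord.
case fj: (f j) => [n'|]; last by move=> _; rewrite leqNgt ltn_ord.
move=> le_n le_n' /(congr1 val); rewrite !val_insubd.
rewrite (leq_ltn_trans le_n) // (leq_ltn_trans le_n') // => /val_inj eq_n.
by apply: (f_inj i j n); rewrite // fj eq_n.
Qed.

Lemma det_row_expansion (F : comNzRingType) (N : nat) (I : finType)
    (w : 'I_N -> I -> 'I_N -> F) :
  \det (\matrix_(i, j) \sum_o w i o j) =
  \sum_(f : {ffun 'I_N -> I}) \det (\matrix_(i, j) w i (f i) j).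
Proof.
rewrite /determinant exchange_big /=; apply: eq_bigr => s _.
rewrite -big_distrr /=; congr (_ * _).
under eq_bigr do rewrite mxE.
rewrite bigA_distr_bigA /=; apply: eq_bigr => f _.
by apply: eq_bigr => i _; rewrite mxE.
Qed.

Lemma det_norm_le (F : realFieldType) (N : nat) (M : 'M[F]_N) (b : 'I_N -> F) :
  (forall i j, `|M i j| <= b i) -> `|\det M| <= N`!%:R * \prod_i b i.
Proof.
move=> le_b; rewrite /determinant.
apply: (le_trans (ler_norm_sum _ _ _)).
rewrite -card_Sn -sum1_card natr_sum mulr_suml.
rewrite [leRHS](eq_bigl xpredT); last by move=> s; rewrite inE.
apply: ler_sum => s _; rewrite mul1r normrM normrX normrN1 expr1n mul1r normr_prod.
by apply: ler_prod => i _; rewrite normr_ge0 le_b.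
Qed.

(* A determinant whose rows are values of N power series at N points is small:
   only terms of total degree at least N(N-1)/2 survive, as repeated degrees
   give proportional rows.  The error rows count as terms of degree N. *)
Lemma det_power_rows_small (F : realFieldType) (N Q : nat)
    (a : 'I_N -> 'I_Q -> F) (u : 'I_N -> F) (err : 'I_N -> 'I_N -> F)
    (b : 'I_N -> F) (U q : F) :
  0 < q -> q <= 1 -> (forall j, `|u j| <= U) ->
  (forall i j, `|err i j| <= q ^+ N * b i) ->
  `|\det (\matrix_(i, j) (\sum_n a i n * u j ^+ n + err i j))| <=
  N`!%:R * q ^+ (\sum_(i < N) i) * \prod_i (\sum_n `|a i n| * (U / q) ^+ n + b i).
Proof.
move=> q0 q1 le_U le_err.
pose w (i : 'I_N) (o : option 'I_Q) (j : 'I_N) :=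
  if o is Some n then a i n * u j ^+ n else err i j.
pose wt (i : 'I_N) (o : option 'I_Q) :=
  if o is Some n then `|a i n| * (U / q) ^+ n else b i.
pose e (o : option 'I_Q) : nat := if o is Some n then nat_of_ord n else N.
have big_opt (G : option 'I_Q -> F) : \sum_o G o = \sum_n G (Some n) + G None.
  rewrite (bigD1 None) //= addrC; congr (_ + _).
  rewrite (reindex_omap Some id) /=; last by case.
  by apply: eq_bigl => n; rewrite eqxx.
have U0 (j : 'I_N) : 0 <= U := le_trans (normr_ge0 _) (le_U j).
have wt_ge0 i o : 0 <= wt i o.
  case: o => [n|] /=.
    by rewrite mulr_ge0 ?exprn_ge0 ?divr_ge0 ?(U0 i) // ltW.
  by have := le_trans (normr_ge0 _) (le_err i i); rewrite pmulr_rge0 ?exprn_gt0.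
(* Measuring the coefficients on the larger radius U / q frees a factor q^n from the term of degree
   n: the Schwarz lemma in coefficient form. *)
have le_w i o j : `|w i o j| <= q ^+ e o * wt i o.
  case: o => [n|] /=; last exact: le_err.
  rewrite normrM normrX mulrCA ler_wpM2l // expr_div_n mulrCA divff ?mulr1; last first.
    by rewrite expf_neq0 // gt_eqF.
  by rewrite lerXn2r ?nnegrE ?normr_ge0 ?(U0 i).
have -> : \matrix_(i, j) (\sum_n a i n * u j ^+ n + err i j) =
    \matrix_(i, j) \sum_o w i o j.
  by apply/matrixP => i j; rewrite !mxE big_opt.
rewrite det_row_expansion; apply: (le_trans (ler_norm_sum _ _ _)).
have -> : \prod_i (\sum_n `|a i n| * (U / q) ^+ n + b i) =
    \sum_(f : {ffun 'I_N -> option 'I_Q}) \prod_i wt i (f i).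
  by rewrite -bigA_distr_bigA; apply: eq_bigr => i _; rewrite big_opt.
rewrite mulr_sumr; apply: ler_sum => f _.
have rhs_ge0 : 0 <= N`!%:R * q ^+ (\sum_(i < N) i) * \prod_i wt i (f i).
  by rewrite !mulr_ge0 ?ler0n ?exprn_ge0 ?prodr_ge0 // ltW.
case: (boolP [exists i, exists j, [&& i != j, f i != None & f i == f j]]).
  case/existsP => i /existsP[j /and3P[ne_ij fi /eqP fij]].
  suff -> : \det (\matrix_(i, j) w i (f i) j) = 0 by rewrite normr0.
  case fi_n: (f i) fi => [n|] // _.
  pose c (k : 'I_N) := if f k is Some m then a k m else 1.
  pose M1 := \matrix_(i, j) (if f i is Some m then u j ^+ m else err i j).
  have -> : \matrix_(i, j) w i (f i) j = diag_mx (\row_k c k) *m M1.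
    apply/matrixP => k l; rewrite mul_diag_mx !mxE /w /c.
    by case: (f k) => [m|] //; rewrite mul1r.
  rewrite det_mulmx [\det M1](determinant_alternate ne_ij) ?mulr0 // => k.
  by rewrite !mxE -fij fi_n.
rewrite negb_exists => /forallP f_inj.
have {}f_inj i j n : f i = Some n -> f j = Some n -> i = j.
  move=> fi fj; apply/eqP/negPn/negP => ne_ij.
  have /existsP := f_inj i; apply; exists j.
  by rewrite ne_ij fi fj eqxx.
apply: (le_trans (det_norm_le (b := fun i => q ^+ e (f i) * wt i (f i)) _)).
  by move=> i j; rewrite mxE.
rewrite big_split /= mulrA ler_wpM2r ?prodr_ge0 // ler_wpM2l ?ler0n //.
rewrite prodrXr; apply: ler_wiXn2l; rewrite ?(ltW q0) //.
exact: (@sum_injective_weight _ _ _ e).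
Qed.

(** With f = 1 / (n - t)! this is the term of degree n in the expansion of x^t exp (m l x). *)
Lemma shift_term (F : comNzRingType) (x l m f : F) (t n : nat) : (t <= n)%N ->
  (m * l) ^+ (n - t) * f * x ^+ n = x ^+ t * ((m * (l * x)) ^+ (n - t) * f).
Proof.
move=> le_tn; rewrite -[X in x ^+ X](subnKC le_tn) exprD mulrCA; congr (_ * _).
by rewrite (mulrA m) (exprMn _ (m * l)) mulrAC.
Qed.

(** * Zero estimate *)

(** Row i lists the contributions of the term p_i(x) a_i^x of an exponential polynomial to its
    values at x, x + 1, ..., x + q - 1, with the common factor a_i^x removed. *)
Definition translate_mx (F : fieldType) (q : nat) (p : 'I_q -> {poly F})
    (a : 'I_q -> F) : 'M[{poly F}]_q :=
  \matrix_(i, j) ((a i ^+ j)%:P * (p i \Po ('X + (j%:R)%:P))).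

(** Translation changes neither the degree nor the leading coefficient, so every term of the Leibniz
    formula has degree d, the sum of the degrees of the p_i. The coefficient of degree d is the
    Vandermonde determinant of the a_i times the leading coefficients. *)
Lemma det_translate_mx_neq0 (F : fieldType) (q : nat) (p : 'I_q -> {poly F})
    (a : 'I_q -> F) (K : nat) :
  (forall i, p i != 0) -> (forall i, a i != 0) -> injective a ->
  (forall i, (size (p i) <= K.+1)%N) ->
  \det (translate_mx p a) != 0 /\ (size (\det (translate_mx p a)) <= (q * K).+1)%N.
Proof.
move=> p_neq0 a_neq0 a_inj size_p.
pose T (s : 'S_q) := \prod_i translate_mx p a i (s i).
pose d := (((\sum_i size (p i)).+1 - q).-1)%N.
have size_term i j : size (translate_mx p a i j) = size (p i).
  by rewrite mxE mul_polyC size_scale ?expf_neq0 // size_comp_poly2 ?size_XaddC.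
have lead_term i j : lead_coef (translate_mx p a i j) = a i ^+ j * lead_coef (p i).
  rewrite mxE lead_coefM lead_coefC lead_coef_comp ?size_XaddC //.
  by rewrite -[X in 'X + X%:P]opprK polyCN lead_coefXsubC expr1n mulr1.
have size_T s : size (T s) = (d.+1)%N.
  have T_neq0 : T s != 0.
    by apply/prodf_neq0 => i _; rewrite -size_poly_gt0 size_term size_poly_gt0.
  have := T_neq0; rewrite -size_poly_gt0 /T size_prod; last first.
    by move=> i _; rewrite -size_poly_gt0 size_term size_poly_gt0.
  under eq_bigr do rewrite size_term.
  by rewrite /d card_ord => /prednK.
have coef_T s : (T s)`_d = (\prod_i a i ^+ s i) * \prod_i lead_coef (p i).
  rewrite -[d]/(d.+1.-1) -(size_T s) -lead_coefE /T lead_coef_prod -big_split.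
  by apply: eq_bigr => i _; rewrite lead_term.
have le_d : (d <= q * K)%N.
  rewrite -ltnS -(size_T 1%g) /T size_prod; last first.
    by move=> i _; rewrite -size_poly_gt0 size_term size_poly_gt0.
  rewrite card_ord leq_subLR addnS ltnS -mulnS mulnC.
  have -> : (K.+1 * q = \sum_(i < q) K.+1)%N by rewrite sum_nat_const card_ord mulnC.
  by apply: leq_sum => i _; rewrite size_term.
have coef_det : (\det (translate_mx p a))`_d =
    \det (Vandermonde q (\row_i a i)) * \prod_i lead_coef (p i).
  rewrite -[\det (Vandermonde _ _)]det_tr /determinant coef_sum mulr_suml; apply: eq_bigr => s _.
  rewrite -mulrA -[X in X * _](rmorph_sign polyC) coefCM [X in _ * X]coef_T.
  by congr (_ * (_ * _)); apply: eq_bigr => i _; rewrite !mxE.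
split.
  apply/eqP => det0; move: coef_det; rewrite det0 coef0 => /esym/eqP.
  apply/negP; rewrite mulf_eq0 negb_or; apply/andP; split.
    rewrite det_Vandermonde; apply/prodf_neq0 => i _; apply/prodf_neq0 => j lt_ij.
    by rewrite !mxE subr_eq0; apply: contraTneq lt_ij => /a_inj ->; rewrite ltnn.
  by apply/prodf_neq0 => i _; rewrite lead_coef_eq0.
apply: leq_trans (size_sum _ _ _) _; apply/bigmax_leqP => s _.
by rewrite -[X in X * _](rmorph_sign polyC) mul_polyC size_scale ?signr_eq0 // size_T.
Qed.

(** Write the sum as a combination of P_l(x) Y^l with x = r + s t and Y = y1^r y2^s; a step in r
    translates x by 1 and multiplies Y by y1. The L extra values of r provide all translates needed,
    so at every x with r < R the vector of powers of Y is in the left kernel of [translate_mx] over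
    the nonzero P_l. The R S points x are distinct as R <= t, which is more roots than the degree of
    the determinant, at most L K, allows. *)
Lemma zero_estimate (F : realFieldType) (K L R S t : nat) (y1 y2 : F)
    (c : 'I_K.+1 -> 'I_L -> F) :
  0 < y1 -> y1 != 1 -> 0 < y2 -> (R <= t)%N -> (L * K < R * S)%N ->
  (forall r s, (r < R + L)%N -> (s < S)%N ->
    \sum_k \sum_l c k l * (r + s * t)%:R ^+ k * (y1 ^+ r * y2 ^+ s) ^+ l = 0) ->
  forall k l, c k l = 0.
Proof.
move=> y1_gt0 y1_neq1 y2_gt0 le_Rt lt_RS vanish.
pose P l := \sum_k c k l *: 'X^k.
have sizeP l : (size (P l) <= K.+1)%N.
  apply: leq_trans (size_sum _ _ _) _; apply/bigmax_leqP => k _.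
  by apply: leq_trans (size_scale_leq _ _) _; rewrite size_polyXn ltnS -ltnS ltn_ord.
suff P0 l : P l = 0.
  move=> k l; move/(congr1 (fun p : {poly F} => p`_k)): (P0 l).
  rewrite coef_sum coef0 (bigD1 k) //= coefZ coefXn eqxx mulr1 big1 ?addr0 // => k' ne_k.
  by rewrite coefZ coefXn eq_sym (inj_eq val_inj) (negbTE ne_k) mulr0.
pose J := [set l | P l != 0].
suff J0 : J = set0.
  by apply/eqP/negPn/negP => Pl; have := in_set0 l; rewrite -J0 inE Pl.
apply/eqP/negPn/negP => J_neq0.
pose e (j : 'I_#|J|) : 'I_L := enum_val j.
have eP j : P (e j) != 0 by have := enum_valP j; rewrite inE.
have y1_neq0 : y1 != 0 by rewrite gt_eqF.
have y2_neq0 : y2 != 0 by rewrite gt_eqF.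
have exp_inj := ieexprIn y1_gt0 y1_neq1.
pose D := \det (translate_mx (fun j => P (e j)) (fun j => y1 ^+ e j)).
have [D_neq0 size_D] : D != 0 /\ (size D <= (#|J| * K).+1)%N.
  apply: det_translate_mx_neq0 => // [j|i j /exp_inj/val_inj/enum_val_inj //].
  by rewrite expf_neq0.
pose rs := [seq (x.1 + x.2 * t)%:R : F | x <- [seq (r, s) | r <- iota 0 R, s <- iota 0 S]].
have size_rs : size rs = (R * S)%N by rewrite size_map size_allpairs !size_iota.
have uniq_rs : uniq rs.
  rewrite map_inj_in_uniq; first by apply: allpairs_uniq; rewrite ?iota_uniq //; move=> [x1 x2] [z1 z2] _ _ /= []-> ->.
  move=> [r s] [r' s'] /allpairsP[[a b] /= [ha hb [-> ->]]] /allpairsP[[a' b'] /= [ha' hb' [-> ->]]].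
  move/eqP; rewrite eqr_nat => /eqP eq_x.
  rewrite !mem_iota /= !add0n in ha hb ha' hb'.
  have t_gt0 : (0 < t)%N by apply: leq_trans le_Rt; apply: leq_ltn_trans ha.
  have lt_at := leq_trans ha le_Rt; have lt_at' := leq_trans ha' le_Rt.
  have eq_a : a = a'.
    by have := congr1 (modn^~ t) eq_x; rewrite ![(_ + _ * t)%N]addnC !modnMDl !modn_small.
  by move: eq_x; rewrite eq_a => /addnI/eqP; rewrite eqn_pmul2r // => /eqP ->.
have := max_poly_roots D_neq0 _ uniq_rs; rewrite size_rs => /(_ _) lt_RSD.
have /lt_RSD : all (root D) rs.
  apply/allP => _ /mapP[[r s] /allpairsP[[a b] /= [ha hb [-> ->]]] ->] /=.
  rewrite !mem_iota /= !add0n in ha hb.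
  rewrite /root /D -horner_evalE -det_map_mx; apply/det0P.
  pose Y := y1 ^+ a * y2 ^+ b.
  have Y_neq0 : Y != 0 by rewrite mulf_neq0 ?expf_neq0.
  (* This vector is nonzero because Y is, and its product with column i is the vanishing sum at (a +
     i, b). *)
  exists (\row_j Y ^+ e j).
    have q_gt0 : (0 < #|J|)%N by rewrite card_gt0.
    apply/eqP => /rowP/(_ (Ordinal q_gt0)); rewrite !mxE => /eqP.
    by rewrite expf_eq0 (negbTE Y_neq0) andbF.
  apply/rowP => i; rewrite !mxE.
  have lt_ai : (a + i < R + L)%N.
    by rewrite -addSn leq_add // (leq_trans (ltnW (ltn_ord i))) // -[X in (_ <= X)%N]card_ord max_card.
  rewrite -[RHS](vanish _ _ lt_ai hb) exchange_big /=.
  rewrite (bigID (fun l => l \in J)) /= [X in _ + X]big1 ?addr0; last first.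
    clear l => l; rewrite inE negbK => /eqP Pl0.
    have := congr1 (fun p : {poly F} => p.[(a + i + b * t)%:R]) Pl0.
    rewrite horner0 horner_sum => h; rewrite -mulr_suml.
    under eq_bigr => k do rewrite -[_ ^+ k]hornerXn -hornerZ.
    by rewrite h mul0r.
  rewrite [RHS]big_enum_val /=. apply: eq_bigr => j _.
  rewrite !mxE /= /horner_eval hornerM hornerC horner_comp hornerD hornerX hornerC.
  rewrite -natrD -mulr_suml horner_sum mulrA [LHS]mulrC (_ : a + b * t + i = a + i + b * t)%N; last first.
    by rewrite addnAC.
  congr (_ * _).
    by apply: eq_bigr => k _; rewrite hornerZ hornerXn.
  by rewrite /Y /e exprAC -exprMn exprD mulrAC.
rewrite ltnNge (leq_trans size_D) //; apply: leq_trans lt_RS; rewrite ltnS leq_mul2r.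
by rewrite -[X in (_ <= X)%N]card_ord max_card orbT.
Qed.

(** * Lower bounds for linear forms in two logarithms *)

Section InterpolationDeterminant.
Local Arguments exp _%_ring_scope.
Local Arguments ln _%_ring_scope.

Definition exp_sum (Q : nat) (v : R) : R := \sum_(n < Q) v ^+ n / n`!%:R.

Lemma E1E (v : R) n : E1 v n = exp_sum n.+1 v.
Proof.
rewrite /E1 sum_f_R0E big_mkord; apply: eq_bigr => i _.
by rewrite factE INRE RpowE mulrC.
Qed.

Lemma exp_sum_le Q (v : R) : 0 <= v -> exp_sum Q v <= exp v.
Proof.
move=> v0; case: Q => [|n]; first by rewrite /exp_sum big_ord0; apply/RleP/Rlt_le/exp_pos.
rewrite -E1E; apply/RleP; apply: sum_incr (E1_cvg v) _ => k.
apply/RleP; rewrite factE INRE RpowE mulr_ge0 ?exprn_ge0 //.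
by rewrite RinvE invr_ge0.
Qed.

(** The remainder of the series at v is dominated by the remainder at M, which makes the choice of Q
    uniform. *)
Lemma exp_sum_approx (M d : R) : 0 < d ->
  exists Q, forall v, `|v| <= M -> `|exp v - exp_sum Q v| <= d.
Proof.
move=> /RltP d0; have [N cvN] := E1_cvg M d d0.
exists N.+1 => v le_vM; rewrite -E1E.
have M0 : 0 <= M := le_trans (normr_ge0 v) le_vM.
have := cvN N (Nat.le_refl N); rewrite /Rdist => cv.
have maj := sum_maj1 (fun k x => (/ INR (fact k) * pow x k)%Re)
  (fun k => (/ INR (fact k) * pow M k)%Re) v _ _ N (E1_cvg v) (E1_cvg M).
apply/RleP; rewrite -RabsE; apply: Rle_trans (maj _) _ => [k|].
  rewrite Rabs_mult (Rabs_pos_eq (/ _)); last first.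
    by apply/Rlt_le/Rinv_0_lt_compat/INR_fact_lt_0.
  apply: Rmult_le_compat_l; first by apply/Rlt_le/Rinv_0_lt_compat/INR_fact_lt_0.
  rewrite -RPow_abs; apply: pow_incr; split; first exact: Rabs_pos.
  by apply/RleP; rewrite RabsE.
apply: Rlt_le; apply: Rle_lt_trans cv.
by rewrite Rabs_minus_sym; apply: Rle_abs.
Qed.

Lemma exp_homo (v w : R) : v <= w -> exp v <= exp w.
Proof.
move=> /RleP[lt_vw|->]; last exact: lexx.
exact/RleP/Rlt_le/exp_increasing.
Qed.

Lemma exp_sub1_le (v : R) : `|v| <= 1 / 2%:R -> `|exp v - 1| <= 2%:R * `|v|.
Proof.
rewrite -!RabsE => /RleP; rewrite -RdivE -!INRE => le_v; apply/RleP.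
change (Rabs (exp v - 1) <= INR 2 * Rabs v)%Re; change (Rabs v <= 1 / INR 2)%Re in le_v.
have := exp_ineq1_le v; have := exp_ineq1_le (- v)%Re; rewrite exp_Ropp.
have e0 := exp_pos v; move: (exp v) e0 le_v => e e0; rewrite /= => le_v le1 le2.
have le3 : (e * (1 - v) <= e * / e)%Re by apply: Rmult_le_compat_l; lra.
rewrite Rinv_r in le3; last lra.
move: le_v; rewrite /Rabs; case: Rcase_abs => h1; case: Rcase_abs => h2 h3; nra.
Qed.

Lemma sum_shift (K Q t : nat) (g : nat -> R) : (t <= K)%N ->
  \sum_(n < K + Q) (if (t <= n < t + Q)%N then g (n - t)%N else 0) = \sum_(n < Q) g n.
Proof.
move=> le_tK.
rewrite -(big_mkord xpredT (fun n => if (t <= n < t + Q)%N then g (n - t)%N else 0)).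
rewrite (big_cat_nat (n := t)) //=; last by rewrite (leq_trans le_tK) // leq_addr.
rewrite [X in (X + _)%R]big1_seq ?add0r; last first.
  by move=> i; rewrite mem_index_iota /= => lt_it; rewrite leqNgt lt_it.
rewrite (big_cat_nat (n := (t + Q)%N)) /= ?leq_addr ?leq_add2r //.
rewrite [X in (_ + X)%R]big1_seq ?addr0; last first.
  by move=> i; rewrite mem_index_iota /= => /andP[le_i _]; rewrite [(i < _)%N]ltnNge le_i andbF.
rewrite [(t + Q)%N]addnC -{1}[t]add0n big_addn addnK big_mkord.
by apply: eq_bigr => i _; rewrite leq_addl addnK ltn_add2r ltn_ord.
Qed.

(** Up to a relative error q^(K L), row i consists of the values at the x_j of one power series,
    x^(i / L) exp ((i mod L) l x), so [det_power_rows_small] applies. One half of the error pays for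
    truncating the series, the other for eps; the factor 2 in the product adds the series and the
    error row. *)
Lemma interp_det_small (K L : nat) (x eps : 'I_(K * L) -> R) (l q X : R) :
  0 < q -> q <= 1 -> (forall j, `|x j| <= X) ->
  (forall j, 4%:R * (L%:R * `|eps j|) <= q ^+ (K * L)) ->
  `|\det (\matrix_(i, j) (x j ^+ (i %/ L) * exp (l * x j + eps j) ^+ (i %% L)))| <=
  (K * L)`!%:R * q ^+ (\sum_(i < K * L) i) *
  \prod_(i < K * L) (2%:R * (X / q) ^+ (i %/ L) * exp ((i %% L)%:R * (`|l| * (X / q)))).
Proof.
move=> q0 q1 le_X le_eps.
case: (posnP (K * L)) => [KL0|KL_gt0].
  move: x eps le_X le_eps; rewrite KL0 => x eps _ _.
  by rewrite det_mx00 !big_ord0 normr1 !mulr1.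
have j0 : 'I_(K * L) := Ordinal KL_gt0.
have L_gt0 : (0 < L)%N by move: KL_gt0; rewrite muln_gt0 => /andP[].
have X0 : 0 <= X := le_trans (normr_ge0 _) (le_X j0).
have lX0 : 0 <= `|l| * X by rewrite mulr_ge0.
have d0 : 0 < q ^+ (K * L) / 2%:R by rewrite divr_gt0 ?exprn_gt0 ?ltr0n.
have [Q approx] := exp_sum_approx (L%:R * (`|l| * X)) d0.
pose tau (i : 'I_(K * L)) := (i %/ L)%N.
pose m (i : 'I_(K * L)) := (i %% L)%N.
have le_tau i : (tau i <= K)%N by rewrite /tau ltnW // ltn_divLR.
have le_m i : (m i)%:R <= L%:R :> R by rewrite ler_nat ltnW // ltn_pmod.
pose a i (n : 'I_(K + Q)) : R :=
  if (tau i <= n < tau i + Q)%N then ((m i)%:R * l) ^+ (n - tau i) / (n - tau i)`!%:R else 0.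
pose err i j : R := x j ^+ tau i *
  (exp (l * x j + eps j) ^+ m i - exp_sum Q ((m i)%:R * (l * x j))).
pose b i : R := X ^+ tau i * exp ((m i)%:R * (`|l| * X)).
have -> : \matrix_(i, j) (x j ^+ (i %/ L) * exp (l * x j + eps j) ^+ (i %% L)) =
    \matrix_(i, j) (\sum_n a i n * x j ^+ n + err i j).
  apply/matrixP => i j; rewrite !mxE -/(tau i) -/(m i).
  have -> : \sum_n a i n * x j ^+ n = x j ^+ tau i * exp_sum Q ((m i)%:R * (l * x j)).
    pose g n : R := x j ^+ tau i * (((m i)%:R * (l * x j)) ^+ n / n`!%:R).
    rewrite /exp_sum mulr_sumr -(sum_shift Q g (le_tau i)); apply: eq_bigr => n _.
    rewrite /a; case: ifP => [/andP[le_n _]|_]; last by rewrite mul0r.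
    exact: shift_term.
  by rewrite /err mulrBr [RHS]addrC subrK.
have le_err i j : `|err i j| <= q ^+ (K * L) * b i.
  rewrite /err /b normrM mulrCA normrX.
  apply: ler_pM; rewrite ?exprn_ge0 ?normr_ge0 //; first by apply: lerXn2r; rewrite ?nnegrE.
  have exp_m v n : exp v ^+ n = exp (n%:R * v) by rewrite expRX mulr_natl.
  have le_mlx : `|(m i)%:R * (l * x j)| <= (m i)%:R * (`|l| * X).
    by rewrite !normrM normr_nat !ler_wpM2l.
  have le_app := approx _ (le_trans le_mlx (ler_wpM2r lX0 (le_m i))).
  have E_ge1 : 1 <= exp ((m i)%:R * (`|l| * X)).
    by have := exp_homo (mulr_ge0 (ler0n R (m i)) lX0); rewrite expR0.
  have le_E : exp ((m i)%:R * (l * x j)) <= exp ((m i)%:R * (`|l| * X)).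
    by apply: exp_homo; apply: le_trans le_mlx; rewrite ler_norm.
  have le_me : `|(m i)%:R * eps j| <= q ^+ (K * L) / 4%:R.
    rewrite normrM normr_nat ler_pdivlMr ?ltr0n // mulrC.
    by apply: le_trans (le_eps j); rewrite ler_wpM2l // ler_wpM2r.
  have q_le1 : q ^+ (K * L) <= 1 by rewrite exprn_ile1 // ltW.
  have small : `|(m i)%:R * eps j| <= 1 / 2%:R.
    apply: le_trans le_me _; rewrite ler_pdivrMr ?ltr0n //; apply: le_trans q_le1 _.
    by rewrite mul1r (natrM _ 2 2) mulKf ?pnatr_eq0 // ler1n.
  rewrite exp_m mulrDr -expRD.
  rewrite (_ : _ - _ = exp ((m i)%:R * (l * x j)) * (exp ((m i)%:R * eps j) - 1) +
    (exp ((m i)%:R * (l * x j)) - exp_sum Q ((m i)%:R * (l * x j)))); last first.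
    by rewrite mulrBr mulr1 addrA subrK.
  apply: le_trans (ler_normD _ _) _.
  have qN0 : 0 <= q ^+ (K * L) / 2%:R by apply: ltW.
  rewrite [leRHS](_ : _ = exp ((m i)%:R * (`|l| * X)) * (q ^+ (K * L) / 2%:R) +
    q ^+ (K * L) / 2%:R * exp ((m i)%:R * (`|l| * X))); last first.
    by rewrite [in X in _ + X]mulrC -mulrDr -splitr mulrC.
  apply: lerD; last by apply: le_trans le_app _; rewrite ler_peMr.
  have exp_ge0 v : 0 <= exp v by apply/RleP/Rlt_le/exp_pos.
  rewrite normrM (ger0_norm (exp_ge0 _)) ler_pM //.
  apply: le_trans (exp_sub1_le small) _.
  rewrite mulrC -ler_pdivlMr ?ltr0n //; apply: le_trans le_me _.
  by rewrite (natrM _ 2 2) invfM mulrA.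
apply: le_trans (det_power_rows_small a q0 q1 le_X le_err) _.
rewrite ler_wpM2l ?mulr_ge0 ?exprn_ge0 // ?(ltW q0) //.
apply: ler_prod => i _; rewrite -/(tau i) -/(m i).
have Xq0 : 0 <= X / q by rewrite divr_ge0 // ltW.
have lXq0 : 0 <= (m i)%:R * (`|l| * (X / q)) by apply: mulr_ge0 => //; apply: mulr_ge0.
have sum_a : \sum_n `|a i n| * (X / q) ^+ n =
    (X / q) ^+ tau i * exp_sum Q ((m i)%:R * (`|l| * (X / q))).
  pose g n : R := (X / q) ^+ tau i * (((m i)%:R * (`|l| * (X / q))) ^+ n / n`!%:R).
  rewrite /exp_sum mulr_sumr -(sum_shift Q g (le_tau i)); apply: eq_bigr => n _.
  rewrite /a; case: ifP => [/andP[le_n _]|_]; last by rewrite normr0 mul0r.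
  rewrite normrM normfV normr_nat normrX normrM normr_nat.
  exact: shift_term.
rewrite sum_a; have b_ge0 : 0 <= b i.
  by rewrite mulr_ge0 ?exprn_ge0 //; apply/RleP/Rlt_le/exp_pos.
apply/andP; split.
  by rewrite addr_ge0 // mulr_ge0 ?exprn_ge0 // sumr_ge0 // => n _; rewrite divr_ge0 ?exprn_ge0.
rewrite [leRHS](_ : _ = (X / q) ^+ tau i * exp ((m i)%:R * (`|l| * (X / q))) +
   (X / q) ^+ tau i * exp ((m i)%:R * (`|l| * (X / q)))); last first.
  by rewrite -mulrA [RHS]addrC -[RHS]mulr2n mulr_natl.
have le_Xq : X <= X / q by rewrite ler_pdivlMr // ler_piMr.
apply: lerD; first by rewrite ler_wpM2l ?exprn_ge0 // exp_sum_le.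
apply: ler_pM; rewrite ?exprn_ge0 //; first by apply/RleP/Rlt_le/exp_pos.
  by apply: lerXn2r; rewrite ?nnegrE.
apply: exp_homo; rewrite ler_wpM2l //.
exact: ler_wpM2l.
Qed.

Lemma big_divmod (T : Type) (idx : T) (op : Monoid.law idx) (K L : nat)
    (F : nat -> nat -> T) :
  \big[op/idx]_(i < K * L) F (i %/ L)%N (i %% L)%N =
  \big[op/idx]_(k < K) \big[op/idx]_(l < L) F k l.
Proof.
case: (posnP L) => [->|L_gt0].
  rewrite muln0 big_ord0 big1 // => k _; by rewrite big_ord0.
rewrite -(big_mkord xpredT (fun i => F (i %/ L)%N (i %% L)%N)).
elim: K => [|K IHK]; first by rewrite mul0n big_geq // big_ord0.
rewrite big_ord_recr /= -IHK mulSn addnC (big_cat_nat (n := (K * L)%N)) ?leq_addr //=.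
congr (op _ _); rewrite -{1}[(K * L)%N]add0n [(K * L + L)%N]addnC big_addn addnK big_mkord.
by apply: eq_bigr => l _; rewrite addnC divnMDl // modnMDl divn_small // modn_small // addn0.
Qed.

Lemma exists_full_minor (F : fieldType) (m n : nat) (M : 'M[F]_(m, n)) :
  (forall v : 'rV_m, v *m M = 0 -> v = 0) ->
  exists f : 'I_m -> 'I_n, \det (colsub f M) != 0.
Proof.
move=> M_inj; have M_free : row_free M by apply: inj_row_free.
have MT_full : row_full M^T by rewrite /row_full mxrank_tr.
exists (fullrankfun MT_full).
have := fullrowsub_unit MT_full; rewrite unitmxE unitfE -det_tr.
by rewrite (_ : _^T = colsub (fullrankfun MT_full) M) //; apply/matrixP => i j; rewrite !mxE.
Qed.

Section TwoLogs.
Variables (z1 z2 : ord) (t L K P S : nat).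
Hypotheses (a1_gt0 : 0 < ev z1) (a1_neq1 : ev z1 != 1) (a2_gt0 : 0 < ev z2).
Hypotheses (le_Pt : (P <= t)%N) (lt_PS : (L * K < P * S)%N).
Let N := (K.+1 * L)%N.
Let r_ (p : 'I_((P + L) * S)) := (p %/ S)%N.
Let s_ (p : 'I_((P + L) * S)) := (p %% S)%N.
Let x_ p := (r_ p + s_ p * t)%N.
(** Row i encodes the exponents (i / L, i mod L), and p encodes the point (p / S, p mod S). The ring
    is left free because the same matrix is read in [ord] for the Liouville inequality and in R for
    the analytic estimate. *)
Definition interp_mx (A : comNzRingType) (b1 b2 : A) (f : 'I_N -> 'I_((P + L) * S)) : 'M[A]_N :=
  \matrix_(i, j) ((x_ (f j))%:R ^+ (i %/ L) * (b1 ^+ r_ (f j) * b2 ^+ s_ (f j)) ^+ (i %% L)).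

Lemma exists_interp_det_neq0 :
  exists f, \det (interp_mx (ev z1) (ev z2) f) != 0.
Proof.
pose M : 'M[R]_(N, (P + L) * S) := \matrix_(i, p)
  ((x_ p)%:R ^+ (i %/ L) * (ev z1 ^+ r_ p * ev z2 ^+ s_ p) ^+ (i %% L)).
have [|f detf] := @exists_full_minor _ _ _ M; last first.
  by exists f; rewrite (_ : interp_mx _ _ _ = colsub f M) //; apply/matrixP => i j; rewrite !mxE.
move=> v vM.
pose v' n : R := if insub n is Some i then v 0 (i : 'I_N) else 0.
pose c (k : 'I_K.+1) (l : 'I_L) := v' (k * L + l)%N.
have c0 : forall k l, c k l = 0.
  apply: (zero_estimate a1_gt0 a1_neq1 a2_gt0 le_Pt lt_PS) => r s lt_r lt_s.
  have lt_p : (r * S + s < (P + L) * S)%N.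
    apply: (@leq_trans (r.+1 * S)); first by rewrite mulSnr ltn_add2l.
    by rewrite leq_mul2r lt_r orbT.
  have := congr1 (fun u : 'rV_((P + L) * S) => u 0 (Ordinal lt_p)) vM.
  have S_gt0 : (0 < S)%N by apply: leq_ltn_trans lt_s.
  have rE : r_ (Ordinal lt_p) = r by rewrite /r_ /= divnMDl // divn_small // addn0.
  have sE : s_ (Ordinal lt_p) = s by rewrite /s_ /= modnMDl modn_small.
  rewrite !mxE => sum0; rewrite -[RHS]sum0.
  pose G k l : R := v' (k * L + l)%N * (r + s * t)%:R ^+ k * (ev z1 ^+ r * ev z2 ^+ s) ^+ l.
  rewrite -[LHS]/(\sum_(k < K.+1) \sum_(l < L) G k l) -big_divmod.
  apply: eq_bigr => i _; rewrite mxE /G -divn_eq /v' valK /x_ rE sE.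
  by rewrite mulrA.
apply/rowP => i; rewrite mxE.
have lt_iN : (i < K.+1 * L)%N := ltn_ord i.
have L_gt0 : (0 < L)%N by case: (posnP L) lt_iN => [->|//]; rewrite muln0.
have lt_k : (i %/ L < K.+1)%N by rewrite ltn_divLR.
have lt_l : (i %% L < L)%N by rewrite ltn_pmod.
by have := c0 (Ordinal lt_k) (Ordinal lt_l); rewrite /c /= -divn_eq /v' valK.
Qed.

Lemma nrm_interp_det_le f (w1 w2 X : R) : nrm z1 <= exp w1 -> nrm z2 <= exp w2 ->
  0 <= w1 -> 0 <= w2 -> ((P + L) + S * t)%:R <= X ->
  nrm (\det (interp_mx z1 z2 f)) <=
  N`!%:R * \prod_(i < N) (X ^+ (i %/ L) * exp ((P + L)%:R * w1 + S%:R * w2) ^+ (i %% L)).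
Proof.
move=> h1 h2 w1_ge0 w2_ge0 le_X; apply: nrm_det_le => i j; rewrite mxE.
have S_gt0 : (0 < S)%N.
  move: (ltn_ord (f j)); move: (nat_of_ord (f j)) => n.
  by case: (posnP S) => [->|//]; rewrite muln0.
have lt_r : (r_ (f j) <= P + L)%N by rewrite /r_ ltnW // ltn_divLR.
have lt_s : (s_ (f j) <= S)%N by rewrite /s_ ltnW // ltn_pmod.
apply: nrm_mul_le; apply: nrm_exp_le.
  apply: le_trans (nrm_nat_le _) _; apply: le_trans le_X.
  by rewrite ler_nat /x_ leq_add // leq_mul2r lt_s orbT.
apply: le_trans (nrm_mul_le (nrm_exp_le (r_ (f j)) h1) (nrm_exp_le (s_ (f j)) h2)) _.
have -> : exp w1 ^+ r_ (f j) * exp w2 ^+ s_ (f j) =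
    exp ((r_ (f j))%:R * w1 + (s_ (f j))%:R * w2).
  by rewrite -expRD !mulr_natl -(expRX w1) -(expRX w2).
by apply: exp_homo; apply: lerD; apply: ler_wpM2r => //; rewrite ler_nat.
Qed.

End TwoLogs.

Lemma prod_exp (I : Type) (r : seq I) (F : I -> R) :
  \prod_(i <- r) exp (F i) = exp (\sum_(i <- r) F i).
Proof. by apply: (big_ind2 (fun x y => x = exp y)) => [|x y u v -> ->|//]; rewrite ?expR0 ?expRD. Qed.

Lemma sum_ordR n : 2%:R * (\sum_(i < n) i%:R) = n%:R * (n%:R - 1) :> R.
Proof.
elim: n => [|n IHn]; first by rewrite big_ord0 mulr0 mul0r.
rewrite big_ord_recr /= -[n.+1]addn1 natrD; move: IHn.
move: (\sum_(i < n) _) (n%:R) => s x; rewrite -!(RplusE, RmultE, RoppE) -!INRE /= -R1E; lra.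
Qed.

Lemma sum_ord_divR K L :
  2%:R * (\sum_(i < K * L) (i %/ L)%:R) = L%:R * (K%:R * (K%:R - 1)) :> R.
Proof.
rewrite (big_divmod _ K L (fun k l => k%:R)) -sum_ordR mulrCA; congr (_ * _).
by rewrite mulr_sumr; apply: eq_bigr => k _; rewrite sumr_const card_ord mulr_natl.
Qed.

Lemma sum_ord_modR K L :
  2%:R * (\sum_(i < K * L) (i %% L)%:R) = K%:R * (L%:R * (L%:R - 1)) :> R.
Proof.
rewrite (big_divmod _ K L (fun k l => l%:R)) -sum_ordR mulrCA; congr (_ * _).
by rewrite sumr_const card_ord mulr_natl.
Qed.

Lemma prod_divmod_exp K L (c a b : R) (F : 'I_(K * L) -> R) :
  (forall i, 0 <= F i <= exp (c + (i %/ L)%:R * a + (i %% L)%:R * b)) ->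
  \prod_i F i <= exp ((K * L)%:R * (c + (K%:R - 1) / 2%:R * a + (L%:R - 1) / 2%:R * b)).
Proof.
move=> le_F; apply: (le_trans (y := \prod_(i < K * L) exp (c + (i %/ L)%:R * a + (i %% L)%:R * b))).
  exact: ler_prod.
rewrite prod_exp; apply: exp_homo.
rewrite !big_split /= sumr_const card_ord -!mulr_suml.
have E2 (x y : R) : 2%:R * x = y -> x = y / 2%:R.
  by move=> <-; rewrite mulrAC divff ?mul1r // pnatr_eq0.
rewrite (E2 _ _ (sum_ord_divR K L)) (E2 _ _ (sum_ord_modR K L)).
rewrite -[c *+ _]mulr_natl natrM -[leLHS]/(_ + _ + _) le_eqVlt; apply/orP; left; apply/eqP.
move: (K%:R) (L%:R) => k l; rewrite -!(RplusE, RmultE, RoppE, RinvE) -!INRE /= -R1E; field.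
Qed.

(** N! <= N^N, and 40000 = 200^2 is what makes N <= (1 + N / 200)^2 <= exp (N / 100). *)
Lemma fact_le_exp N : (40000 <= N)%N -> N`!%:R <= exp (N%:R * (N%:R / 100%:R)) :> R.
Proof.
move=> le_N.
have N_le : N%:R <= exp (N%:R / 100%:R).
  apply/RleP; rewrite -!INRE -RdivE.
  have N40 : (40000 <= INR N)%Re.
    have -> : (40000 = INR 40000)%Re by rewrite INR_IZR_INZ; congr IZR; vm_compute.
    by apply: le_INR; apply/ssrnat.leP.
  have -> : (INR N / INR 100 = INR N / 200 + INR N / 200)%Re.
    by rewrite [INR 100]INR_IZR_INZ -[Z.of_nat 100]/(100%BZ); field.
  rewrite exp_plus; have := exp_ineq1_le (INR N / 200)%Re.
  by move: (exp _) => e le_e; nra.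
have le_fact : (N`! <= N ^ N)%N.
  rewrite -ffactnn; move: {2 4}N => n; elim: n => [|n IHn]; first by rewrite ffactn0 expn0.
  by rewrite ffactnSr expnSr leq_mul // leq_subr.
apply: (le_trans (y := N%:R ^+ N)); first by rewrite -natrX ler_nat.
rewrite mulr_natl -expRX; apply: lerXn2r => //; rewrite nnegrE //.
exact/RleP/Rlt_le/exp_pos.
Qed.

Lemma interp_det_le (z1 z2 : ord) (t L K P S : nat) (lx V : R)
    (f : 'I_(K.+1 * L) -> 'I_((P + L) * S)) :
  0 < ev z1 -> 0 < ev z2 -> (40000 <= K.+1 * L)%N ->
  ((P + L) + S * t)%:R <= exp lx ->
  `|ln (ev z1)| * ((P + L) + S * t)%:R <= V ->
  4%:R * (L%:R * (S%:R * `|ln (ev z2) - t%:R * ln (ev z1)|)) <=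
    exp (- (2%:R * (K.+1 * L)%:R)) ->
  `|\det (interp_mx t (ev z1) (ev z2) f)| <=
  exp ((K.+1 * L)%:R * ((K.+1 * L)%:R / 100%:R) - (K.+1 * L)%:R * ((K.+1 * L)%:R - 1) +
    (K.+1 * L)%:R * (1 + (K.+1%:R - 1) / 2%:R * (lx + 2%:R)
                       + (L%:R - 1) / 2%:R * (V * exp 2%:R))).
Proof.
move=> a1_gt0 a2_gt0 le_N le_X le_V le_lam.
pose X : R := ((P + L) + S * t)%:R.
(* This ratio turns q^(N (N - 1) / 2) into exp (- N (N - 1)); the radius grows by exp 2, which costs
   the terms lx + 2 and V * exp 2. *)
pose q : R := exp (- 2%:R).
have q0 : 0 < q by exact/RltP/exp_pos.
have q1 : q <= 1.
  have le20 : - 2%:R <= 0 :> R by rewrite oppr_le0.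
  by have := exp_homo le20; rewrite expR0.
have Vq : q^-1 = exp 2%:R.
  by rewrite /q -RinvE -exp_Ropp RoppE opprK.
pose r_ (j : 'I_(K.+1 * L)) := (f j %/ S)%N; pose s_ (j : 'I_(K.+1 * L)) := (f j %% S)%N.
pose x j : R := (r_ j + s_ j * t)%:R.
pose lam := ln (ev z2) - t%:R * ln (ev z1).
pose eps j : R := (s_ j)%:R * lam.
have S_gt0 (j : 'I_(K.+1 * L)) : (0 < S)%N.
  move: (ltn_ord (f j)); move: (nat_of_ord (f j)) => n.
  by case: (posnP S) => [->|//]; rewrite muln0.
have lt_s j : (s_ j <= S)%N by rewrite /s_ ltnW // ltn_pmod // (S_gt0 j).
have lt_r j : (r_ j <= P + L)%N by rewrite /r_ ltnW // ltn_divLR // (S_gt0 j).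
have le_x j : `|x j| <= X.
  by rewrite normr_nat ler_nat leq_add // leq_mul2r lt_s orbT.
have le_eps j : 4%:R * (L%:R * `|eps j|) <= q ^+ (K.+1 * L).
  rewrite /q expRX mulNrn -[_ *+ (K.+1 * L)]mulr_natr; apply: le_trans le_lam.
  rewrite normrM normr_nat; apply: ler_wpM2l => //; apply: ler_wpM2l => //.
  by apply: ler_wpM2r => //; rewrite ler_nat.
have := interp_det_small (ln (ev z1)) q0 q1 le_x le_eps.
have -> : \matrix_(i, j) (x j ^+ (i %/ L) * exp (ln (ev z1) * x j + eps j) ^+ (i %% L)) =
    interp_mx t (ev z1) (ev z2) f.
  apply/matrixP => i j; rewrite !mxE; congr (_ * _ ^+ _).
  have pow_ln (a : R) n : 0 < a -> a ^+ n = exp (n%:R * ln a).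
    by move=> /RltP a0; rewrite mulr_natl -expRX exp_ln.
  rewrite !pow_ln // expRD; congr exp.
  rewrite /eps /lam /x -/(r_ j) -/(s_ j) natrD natrM.
  rewrite -!(RplusE, RmultE, RoppE); ring.
move/le_trans; apply.
have -> : q ^+ (\sum_(i < K.+1 * L) i) = exp (- ((K.+1 * L)%:R * ((K.+1 * L)%:R - 1))).
  by rewrite /q expRX mulNrn -[_ *+ (\sum_(i < _) _)%N]mulr_natr natr_sum sum_ordR.
rewrite -[X in _ <= X]expRD -[X in _ <= X * _]expRD; apply: ler_pM; last 2 first.
- by apply: ler_pM (fact_le_exp le_N) (lexx _) => //; exact/RleP/Rlt_le/exp_pos.
- apply: prod_divmod_exp => i.
  have exp_ge0 (v : R) : 0 <= exp v by exact/RleP/Rlt_le/exp_pos.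
  have X_ge0 : 0 <= X by rewrite /X.
  have Xq_ge0 : 0 <= X / q by rewrite divr_ge0 // ltW.
  apply/andP; split.
    by apply: mulr_ge0 => //; apply: mulr_ge0 => //; rewrite exprn_ge0.
  rewrite -(expRD (1 + (i %/ L)%:R * (lx + 2%:R))) -(expRD 1 ((i %/ L)%:R * (lx + 2%:R))); apply: ler_pM => //.
  + by apply: mulr_ge0 => //; rewrite exprn_ge0.
  + apply: ler_pM => //; first by rewrite exprn_ge0.
      have := exp_ineq1_le 1 => /RleP; rewrite -R1E /=; apply: le_trans.
      by apply/RleP; rewrite -INRE /=; lra.
    have -> : exp ((i %/ L)%:R * (lx + 2%:R)) = exp (lx + 2%:R) ^+ (i %/ L).
      by rewrite (expRX (lx + 2%:R)) [in LHS]mulr_natl.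
    apply: lerXn2r; rewrite ?nnegrE //.
    by rewrite Vq -(expRD lx); apply: ler_wpM2r.
  + apply: exp_homo; apply: ler_wpM2l => //.
    by rewrite (mulrA _ X) Vq; apply: ler_wpM2r.
- by apply: mulr_ge0 => //; exact/RleP/Rlt_le/exp_pos.
- by apply: prodr_ge0 => i _; rewrite !mulr_ge0 ?exprn_ge0 ?divr_ge0 // ?(ltW q0) //; exact/RleP/Rlt_le/exp_pos.
Qed.

End InterpolationDeterminant.

(* Numerical balance and the bound for two logarithms *)
Local Close Scope ring_scope.
Local Open Scope R_scope.

Lemma INR_add m n : INR (m + n)%N = INR m + INR n. Proof. exact: plus_INR. Qed.
Lemma INR_mul m n : INR (m * n)%N = INR m * INR n. Proof. exact: mult_INR. Qed.
Lemma INR_leq m n : INR m <= INR n <-> is_true (m <= n)%N.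
Proof. by split=> [/INR_le/ssrnat.leP|/ssrnat.leP/le_INR]. Qed.
Lemma INR_ltn m n : INR m < INR n <-> is_true (m < n)%N.
Proof. by split=> [/INR_lt/ssrnat.ltP|/ssrnat.ltP/lt_INR]. Qed.

Lemma exp1_le : exp 1 <= 2.7305.
Proof.
have e0 : exp (1 / 128) <= 1.007875.
  have := exp_ineq1_le (- (1 / 128)); rewrite exp_Ropp.
  have := exp_pos (1 / 128); move: (exp _) => e e_gt0 h.
  have : e * (1 + - (1 / 128)) <= e * / e by apply: Rmult_le_compat_l; lra.
  by rewrite Rinv_r; lra.
have sq x y c : x = y + y -> exp y <= c -> exp x <= c * c.
  move=> -> le_c; rewrite exp_plus; have := exp_pos y => ey.
  by apply: Rmult_le_compat; lra.
have e1 : exp (1 / 64) <= 1.015813.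
  by apply: Rle_trans (sq _ (1 / 128) _ _ e0) _; lra.
have e2 : exp (1 / 32) <= 1.031877.
  by apply: Rle_trans (sq _ (1 / 64) _ _ e1) _; lra.
have e3 : exp (1 / 16) <= 1.06478.
  by apply: Rle_trans (sq _ (1 / 32) _ _ e2) _; lra.
have e4 : exp (1 / 8) <= 1.13377.
  by apply: Rle_trans (sq _ (1 / 16) _ _ e3) _; lra.
have e5 : exp (1 / 4) <= 1.28545.
  by apply: Rle_trans (sq _ (1 / 8) _ _ e4) _; lra.
have e6 : exp (1 / 2) <= 1.6524.
  by apply: Rle_trans (sq _ (1 / 4) _ _ e5) _; lra.
by apply: Rle_trans (sq _ (1 / 2) _ _ e6) _; lra.
Qed.

Lemma exp2_le : exp 2 <= 7.46.
Proof.
have -> : 2 = 1 + 1 by ring.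
have := exp1_le; have := exp_pos 1; rewrite exp_plus; nra.
Qed.

Lemma exp_incr x y : x <= y -> exp x <= exp y.
Proof. by move=> /RleP/exp_homo/RleP. Qed.

Lemma exp_le_inv x y : exp x <= exp y -> x <= y.
Proof. by case=> [/exp_lt_inv|/exp_inv ->]; lra. Qed.

Lemma exp1_ge : 2.7 <= exp 1.
Proof.
have e0 : 1 + 1 / 128 <= exp (1 / 128) by exact: exp_ineq1_le.
have sq x y c d : x = y + y -> 0 <= c -> c <= exp y -> d <= c * c -> d <= exp x.
  by move=> -> c0 hc hd; apply: Rle_trans hd _; rewrite exp_plus; apply: Rmult_le_compat.
have e1 : 1.01568 <= exp (1 / 64) by apply: (sq _ (1 / 128) (1 + 1 / 128)); lra.
have e2 : 1.03160 <= exp (1 / 32) by apply: (sq _ (1 / 64) 1.01568); lra.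
have e3 : 1.06419 <= exp (1 / 16) by apply: (sq _ (1 / 32) 1.03160); lra.
have e4 : 1.13250 <= exp (1 / 8) by apply: (sq _ (1 / 16) 1.06419); lra.
have e5 : 1.28255 <= exp (1 / 4) by apply: (sq _ (1 / 8) 1.13250); lra.
have e6 : 1.64493 <= exp (1 / 2) by apply: (sq _ (1 / 4) 1.28255); lra.
by apply: (sq _ (1 / 2) 1.64493); lra.
Qed.

Lemma exp_nat_ge n : 2.7 ^ n <= exp (INR n).
Proof.
rewrite -[INR n]Rmult_1_r -[X in _ <= X](_ : exp 1 ^ n = _).
  by apply: pow_incr; have := exp1_ge; lra.
by rewrite RpowE expRX -GRing.mulr_natl -INRE.
Qed.

(* The exponents of the upper bound for the determinant and of the Liouville
   lower bound do not fit together. *)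
Lemma exponent_balance (k L W lx e2 N : R) :
  N = k * L -> k = 13 * (W + 1) -> 100 <= L -> 1 <= W -> 0 <= lx -> 7 * lx + 3 <= L ->
  0 <= e2 <= 7.46 -> 40000 <= N ->
  (N * (N / 100) - N * (N - 1) + N * (1 + (k - 1) / 2 * (lx + 2) + (L - 1) / 2 * ((W + 1) * e2)))
  + 6 + 5 * (N * (N / 100) + N * (0 + (k - 1) / 2 * lx + (L - 1) / 2 * W)) < 0.
Proof.
move=> NE kE L100 W1 lx0 lxL e2b N40.
(* The factorials, the powers of x and the exponentials contribute 6 / 100, 3 / 7 and 6.23 / 13
   times N^2, together less than N^2. The second share comes from L >= 7 lx + 3, the third from k =
   13 (W + 1). *)
have h1 : (k - 1) / 2 * (lx + 2) + 5 * ((k - 1) / 2 * lx) <= 3 / 7 * N.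
  have -> : (k - 1) / 2 * (lx + 2) + 5 * ((k - 1) / 2 * lx) = (k - 1) * (3 * lx + 1) by field.
  apply: Rle_trans (_ : k * (3 / 7 * L) <= _); last by rewrite NE; lra.
  by apply: Rmult_le_compat; lra.
have h2 : (L - 1) / 2 * ((W + 1) * e2) + 5 * ((L - 1) / 2 * W) <= 6.23 / 13 * N.
  have -> : 6.23 / 13 * N = L / 2 * ((W + 1) * 12.46) by rewrite NE kE; lra.
  have -> : (L - 1) / 2 * ((W + 1) * e2) + 5 * ((L - 1) / 2 * W) =
    (L - 1) / 2 * ((W + 1) * e2 + 5 * W) by field.
  by apply: Rmult_le_compat; nra.
have : (N * (N / 100) - N * (N - 1) + N * (1 + (k - 1) / 2 * (lx + 2) + (L - 1) / 2 * ((W + 1) * e2)))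
  + 6 + 5 * (N * (N / 100) + N * (0 + (k - 1) / 2 * lx + (L - 1) / 2 * W)) =
  6 + N * (6 * N / 100 - N + 2 + ((k - 1) / 2 * (lx + 2) + 5 * ((k - 1) / 2 * lx)) +
    ((L - 1) / 2 * ((W + 1) * e2) + 5 * ((L - 1) / 2 * W))) by field.
move=> ->; move: h1 h2.
move: (_ + 5 * ((k - 1) / 2 * lx)) (_ + 5 * ((L - 1) / 2 * W)) => a b ha hb.
have : N * (6 * N / 100 - N + 2 + a + b) <= N * (- 100) by apply: Rmult_le_compat_l; lra.
by lra.
Qed.

Lemma INR40000 : INR 40000 = 40000.
Proof. by rewrite INR_IZR_INZ; congr IZR; vm_compute. Qed.

Section MainBound.
Variables (z1 z2 : ord) (w1 w2 t L : nat) (lx : R).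
Hypotheses (a1_gt0 : 0 < ev z1) (a1_neq1 : ev z1 <> 1) (a2_gt0 : 0 < ev z2).
Hypotheses (nrm1 : nrm z1 <= exp (INR w1)) (nrm2 : nrm z2 <= exp (INR w2)).
Hypotheses (ln1 : Rabs (ln (ev z1)) <= INR w1) (ln2 : Rabs (ln (ev z2)) <= INR w2).
Hypotheses (w1_ge1 : (1 <= w1)%N) (w2_ge1 : (1 <= w2)%N) (L_ge : (100 <= L)%N).
Hypotheses (lx_ge0 : 0 <= lx) (lx_le : 7 * lx + 3 <= INR L).
Hypotheses (X_le : INR (28 * L * w2 + L + 28 * L * w1 * t) <= exp lx).
Hypothesis (t_ge : (28 * L * w2 <= t)%N).

(** Taking P = c L w2 and Sr = c L w1 balances P w1 and Sr w2. The product P Sr = c^2 L^2 w1 w2 must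
    exceed N, which is about 13 (2 c L w1 w2) L, the 13 being that of [exponent_balance]. So c has
    to be above 26, and 28 leaves room for lower order terms. *)
Let P := (28 * L * w2)%N.
Let Sr := (28 * L * w1)%N.
Let W := ((P + L) * w1 + Sr * w2)%N.
Let K := (13 * W + 12)%N.
Let N := (K.+1 * L)%N.
Let lam := ln (ev z2) - INR t * ln (ev z1).

Lemma INR_P : INR P = 28 * INR L * INR w2.
Proof. by rewrite !INR_mul /=; lra. Qed.
Lemma INR_S : INR Sr = 28 * INR L * INR w1.
Proof. by rewrite !INR_mul /=; lra. Qed.
Lemma INR_W : INR W = 56 * INR L * INR w1 * INR w2 + INR L * INR w1.
Proof. by rewrite /W /P /Sr !(INR_add, INR_mul) /=; ring. Qed.
Lemma INR_K1 : INR K.+1 = 13 * (INR W + 1).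
Proof. by rewrite S_INR /K INR_add (INR_mul 13 W) /=; ring. Qed.

Lemma real_facts : [/\ 100 <= INR L, 1 <= INR w1, 1 <= INR w2 &
  1 <= INR L * INR w1 * INR w2].
Proof.
have h1 := INR_leq 1 w1; have h2 := INR_leq 1 w2; have h3 := INR_leq 100 L.
have [w1r w2r Lr] : [/\ 1 <= INR w1, 1 <= INR w2 & 100 <= INR L].
  split; [by apply/h1 | by apply/h2 |].
  have -> : 100 = INR 100 by rewrite INR_IZR_INZ.
  by apply/h3.
have h : 1 <= INR L * INR w1 by nra.
by split=> //; nra.
Qed.

Lemma N_bounds : 728 * (INR L * INR L * INR w1 * INR w2) <= INR N <=
  754 * (INR L * INR L * INR w1 * INR w2).
Proof.
have [L100 w1r w2r _] := real_facts.
rewrite /N (INR_mul K.+1 L) INR_K1 INR_W.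
have h : 1 <= INR L * INR w1 by nra.
have h1 : 13 * (INR L * INR w1 + 1) <= 26 * (INR L * INR w1 * INR w2) by nra.
have h2 : INR L * (13 * (INR L * INR w1 + 1)) <= INR L * (26 * (INR L * INR w1 * INR w2)).
  by apply: Rmult_le_compat_l; lra.
have h3 : 0 <= INR L * (13 * (INR L * INR w1 + 1)) by apply: Rmult_le_pos; lra.
by split; lra.
Qed.

Lemma lt_PS : (L * K < P * Sr)%N.
Proof.
have [L100 w1r w2r h1] := real_facts; have [_ hN] := N_bounds.
apply/INR_ltn; rewrite (INR_mul P Sr) INR_P INR_S.
apply: Rle_lt_trans (_ : INR N < _).
  by apply/INR_leq; rewrite /N mulnC leq_mul2r leqnSn orbT.
apply: Rle_lt_trans hN _.
have : 0 < INR L * (INR L * INR w1 * INR w2) by apply: Rmult_lt_0_compat; lra.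
by lra.
Qed.

Lemma N_ge : (40000 <= N)%N.
Proof.
have [L100 w1r w2r h1] := real_facts; have [hN _] := N_bounds.
apply/INR_leq; apply: Rle_trans hN.
rewrite INR40000.
nra.
Qed.

(** 1520 = 2 * 754 + 12: with u = L^2 w1 w2, the analytic estimate asks for 4 L Sr |lam| <= exp (- 2
    N), where N <= 754 u, and exp (12 u) absorbs 4 L Sr. *)
Lemma small_lam_contradiction :
  Rabs lam <= exp (- (1520 * (INR L * INR L * INR w1 * INR w2))) -> False.
Proof.
move=> le_lam; have [L100 w1r w2r u1] := real_facts; have [hN1 hN2] := N_bounds.
set u := INR L * INR L * INR w1 * INR w2 in le_lam hN1 hN2.
have u_ge : 10000 <= u.
  have h1 : 10000 <= INR L * INR L by nra.
  have h2 : 10000 <= INR L * INR L * INR w1 by nra.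
  by rewrite /u; nra.
have LLw1 : 0 <= INR L * INR L * INR w1 by repeat apply: Rmult_le_pos; lra.
have Lw1_le : INR L * INR L * INR w1 <= u by rewrite /u; nra.
have S_ge0 : 0 <= INR Sr by exact: pos_INR.
have exp12 : 112 * u <= exp (12 * u).
  have -> : 12 * u = 6 * u + 6 * u by ring.
  rewrite exp_plus; have := exp_ineq1_le (6 * u); move: (exp _) => e; nra.
have small : 4 * (INR L * (INR Sr * Rabs lam)) <= exp (- (2 * INR N)).
  have -> : 4 * (INR L * (INR Sr * Rabs lam)) = 112 * (INR L * INR L * INR w1) * Rabs lam.
    by rewrite INR_S; ring.
  apply: Rle_trans (_ : exp (12 * u) * exp (- (1520 * u)) <= _).
    by apply: Rmult_le_compat => //; [nra | exact: Rabs_pos | lra].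
  by rewrite -exp_plus; apply: exp_incr; lra.
have S_lam : INR Sr * Rabs lam <= 1.
  have : exp (- (2 * INR N)) <= 1 by rewrite -exp_0; apply: exp_incr; have := pos_INR N; lra.
  have : 0 <= INR Sr * Rabs lam by apply: Rmult_le_pos => //; exact: Rabs_pos.
  nra.
(* Although t is large, t ln z1 = ln z2 - lam is bounded by w2 + |lam|, so the exponents stay of
   size W. *)
have le_V : Rabs (ln (ev z1)) * INR ((P + L) + Sr * t)%N <= INR W + 1.
  rewrite /W (INR_add (P + L)) (INR_add ((P + L) * w1)) (INR_mul (P + L)) (INR_mul Sr) (INR_mul Sr w2) (INR_add P L).
  have tl : INR t * Rabs (ln (ev z1)) <= INR w2 + Rabs lam.
    rewrite -{1}(Rabs_pos_eq (INR t)) ?Rabs_mult; last exact: pos_INR.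
    rewrite -Rabs_mult; have -> : INR t * ln (ev z1) = ln (ev z2) - lam by rewrite /lam; ring.
    by apply: Rle_trans (Rabs_triang _ _) _; rewrite Rabs_Ropp; lra.
  have h1 : INR Sr * (INR t * Rabs (ln (ev z1))) <= INR Sr * (INR w2 + Rabs lam).
    exact: Rmult_le_compat_l.
  have h2 : (INR P + INR L) * Rabs (ln (ev z1)) <= (INR P + INR L) * INR w1.
    by apply: Rmult_le_compat_l => //; have := pos_INR P; lra.
  by lra.
have a1_neq1' : is_true (ev z1 != GRing.one R) by apply/eqP.
have [f det_neq0] := exists_interp_det_neq0 (introT RltP a1_gt0) a1_neq1'
  (introT RltP a2_gt0) t_ge lt_PS.
pose D := (\det (interp_mx t z1 z2 f))%R.
have evD : ev D = (\det (interp_mx t (ev z1) (ev z2) f))%R.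
  rewrite /D -det_map_mx; congr (\det _)%R; apply/matrixP => i j.
  by rewrite !mxE rmorphM !rmorphXn rmorph_nat rmorphM !rmorphXn.
have ev_neq0 : ev D <> 0 by rewrite evD; apply/eqP.
have := liouville ev_neq0.
have i2 : INR 2 = 2 by [].
have i4 : INR 4 = 4 by rewrite INR_IZR_INZ.
have i100 : INR 100 = 100 by rewrite INR_IZR_INZ.
have le_X : INR ((P + L) + Sr * t) <= exp lx by exact: X_le.
have det_le : Rabs (ev D) <= exp (INR N * (INR N / 100) - INR N * (INR N - 1) +
    INR N * (1 + (INR K.+1 - 1) / 2 * (lx + 2) + (INR L - 1) / 2 * ((INR W + 1) * exp 2))).
  have := interp_det_le f (introT RltP a1_gt0) (introT RltP a2_gt0) N_ge.
  move=> /(_ t lx (INR W + 1)); rewrite -!INRE i2 i4 i100 -evD => det_le.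
  by apply/RleP; apply: det_le; apply/RleP.
have nrm_le : nrm D <= exp (INR N * (INR N / 100)) *
    exp (INR N * (0 + (INR K.+1 - 1) / 2 * lx + (INR L - 1) / 2 * INR W)).
  have w1r0 : 0 <= INR w1 by exact: pos_INR.
  have w2r0 : 0 <= INR w2 by exact: pos_INR.
  have := nrm_interp_det_le f (introT RleP nrm1) (introT RleP nrm2)
    (introT RleP w1r0) (introT RleP w2r0).
  move=> /(_ t (exp lx)); rewrite -!INRE => nrm_le.
  apply/RleP; apply: le_trans (nrm_le (introT RleP le_X)) _.
  apply: ler_pM; rewrite ?ler0n //.
  - by rewrite INRE ler0n.
  - apply: prodr_ge0 => i _; apply: mulr_ge0; apply: exprn_ge0; exact/RleP/Rlt_le/exp_pos.
  - by have := fact_le_exp N_ge; rewrite -!INRE i100.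
  have := prod_divmod_exp (c := 0) (a := lx) (b := INR W)
    (F := fun i : 'I_(K.+1 * L) => (exp lx ^+ (i %/ L) *
       exp (INR (P + L) * INR w1 + INR Sr * INR w2) ^+ (i %% L))%R).
  rewrite -!INRE i2; apply => i; apply/andP; split.
    by apply: mulr_ge0; apply: exprn_ge0; exact/RleP/Rlt_le/exp_pos.
  have -> : INR (P + L) * INR w1 + INR Sr * INR w2 = INR W.
    by rewrite /W (INR_add ((P + L) * w1)) (INR_mul (P + L)) (INR_mul Sr).
  rewrite (expRX lx) (expRX (INR W)) expRD !INRE GRing.add0r.
  by rewrite !GRing.mulr_natl.
have balance := exponent_balance (k := INR K.+1) (L := INR L) (W := INR W) (lx := lx)
  (e2 := exp 2) (N := INR N) (INR_mul K.+1 L) INR_K1 L100.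
set A1 := (X in Rabs _ <= exp X) in det_le.
have := liouville ev_neq0; set A2 := (INR N * (0 + _ + _)) in nrm_le.
rewrite -exp_plus in nrm_le => lio.
have nrm5 : nrm D ^ 5 <= exp (5 * (INR N * (INR N / 100) + A2)).
  have := pow_incr _ _ 5 (conj (nrm_ge0 D) nrm_le).
  move/Rle_trans; apply; apply: Req_le; rewrite RpowE.
  by rewrite expRX -[in LHS]GRing.mulr_natl -INRE [INR 5]INR_IZR_INZ.
(* The summand 6 in [exponent_balance] pays for the factor 200 in [liouville], and its factor 5 is
   the exponent there. *)
have e200 : 200 <= exp 6.
  apply: Rle_trans (_ : 2.7 ^ 6 <= _); first by rewrite /=; lra.
  by apply: Rle_trans (exp_nat_ge 6) _; apply: exp_incr; rewrite INR_IZR_INZ /=; lra.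
have : 1 <= exp (A1 + 6 + 5 * (INR N * (INR N / 100) + A2)).
  rewrite (exp_plus (A1 + 6)) (exp_plus A1 6); apply: Rle_trans lio _; rewrite Rmult_assoc.
  apply: Rmult_le_compat => //; first exact: Rabs_pos.
    by apply: Rmult_le_pos; [lra | apply/pow_le/nrm_ge0].
  by apply: Rmult_le_compat => //; [lra | exact/pow_le/nrm_ge0].
rewrite -{1}exp_0 => /exp_le_inv le0 _; apply: (Rlt_irrefl 0); apply: Rle_lt_trans le0 _.
apply: balance => //; last by rewrite -[40000]INR40000; apply/INR_leq/N_ge.
- by rewrite INR_W; nra.
- by split; [exact/Rlt_le/exp_pos | exact: exp2_le].
Qed.

Lemma two_logs_bound :
  exp (- (1520 * (INR L * INR L * INR w1 * INR w2))) <
  Rabs (ln (ev z2) - INR t * ln (ev z1)).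
Proof. by apply: Rnot_le_lt => /small_lam_contradiction. Qed.

End MainBound.

(** * Linear forms in ln alpha, ln phi and a third logarithm *)

(** Pigeonhole on the residues of i k modulo n, for i <= P, in P boxes. The two inequalities express
    |d k - n p| < n / P without subtraction. *)
Lemma dirichlet (k n P : nat) : (0 < n)%N -> (0 < P)%N ->
  exists d p, [/\ (0 < d <= P)%N, (P * (d * k) < n + P * (n * p))%N
    & (P * (n * p) < n + P * (d * k))%N].
Proof.
move=> n0 P0.
have box_lt (i : 'I_P.+1) : (P * ((i * k) %% n) %/ n < P)%N.
  by rewrite ltn_divLR // ltn_pmul2l // ltn_pmod.
pose box i := Ordinal (box_lt i).
have [i [j [lt_ij eq_box]]] : exists i j : 'I_P.+1, (i < j)%N /\ box i = box j.
  have : ~~ injectiveb box.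
    apply/negP => /injectiveP /leq_card; rewrite !card_ord.
    by rewrite ltnn.
  case/injectivePn => i [j ne_ij eq_box].
  case: (ltngtP i j) => [lt_ij|lt_ji|/val_inj eq_ij]; [by exists i, j | by exists j, i |].
  by rewrite eq_ij eqxx in ne_ij.
move/(congr1 val): eq_box => /= eq_box.
have Ei := divn_eq (i * k) n; have Ej := divn_eq (j * k) n.
have Fi := divn_eq (P * ((i * k) %% n)) n; have Fj := divn_eq (P * ((j * k) %% n)) n.
have gi : (P * ((i * k) %% n) %% n < n)%N by rewrite ltn_pmod.
have gj : (P * ((j * k) %% n) %% n < n)%N by rewrite ltn_pmod.
have le_q : (i * k %/ n <= j * k %/ n)%N by rewrite leq_div2r // leq_mul2r ltnW ?orbT.
exists (j - i)%N, (j * k %/ n - i * k %/ n)%N.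
rewrite subn_gt0 lt_ij (leq_trans (leq_subr _ _)) ?leq_ord //.
rewrite eq_box in Fi; move: Fi Fj gi gj Ei Ej le_q {eq_box}.
move: (P * _ %/ n)%N (P * _ %% n)%N (P * _ %% n)%N ((i * k) %/ n)%N ((j * k) %/ n)%N.
move: ((i * k) %% n)%N ((j * k) %% n)%N => ri rj b si sj qi qj Fi Fj gi gj Ei Ej le_q.
have eqP : (P * (j * k) + P * (n * qi) + P * ri = P * (i * k) + P * (n * qj) + P * rj)%N.
  rewrite Ei Ej [(n * qi)%N]mulnC [(n * qj)%N]mulnC !mulnDr.
  move: (P * (qj * n))%N (P * rj)%N (P * (qi * n))%N (P * ri)%N => a1 a2 a3 a4.
  by rewrite -!plusE; lia.
have ED : (P * ((j - i) * k) + P * (i * k) = P * (j * k))%N.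
  by rewrite -mulnDr -mulnDl subnK // ltnW.
have EQ : (P * (n * (qj - qi)) + P * (n * qi) = P * (n * qj))%N.
  by rewrite -mulnDr -mulnDr subnK.
move: ED EQ eqP; move: (P * ((j - i) * k))%N (P * (n * (qj - qi)))%N.
move: (P * (i * k))%N (P * (j * k))%N (P * (n * qi))%N (P * (n * qj))%N (b * n)%N Fi Fj gi gj.
move=> a1 a2 a3 a4 a5 Fi Fj /ssrnat.ltP gi /ssrnat.ltP gj a6 a7.
rewrite Fi Fj -!plusE => h1 h2 h3.
split=> //; apply/ssrnat.ltP; lia.
Qed.

Definition z_alpha := Q6 0 1 0 0 0 0.
Definition z_phi := Q6 0 0 0 1 0 0.
Definition z_phi_inv := Q6 (-1) 0 0 1 0 0.

Lemma ev_alpha : ev z_alpha = alpha. Proof. by rewrite /ev /val6 /=; ring. Qed.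
Lemma ev_phi : ev z_phi = phi. Proof. by rewrite /ev /val6 /=; ring. Qed.
Lemma ev_phi_inv : ev z_phi_inv = / phi.
Proof.
have ph := phi_bounds; have phq := phi_quadratic.
apply: (Rmult_eq_reg_r phi); last lra.
by rewrite Rinv_l /ev /val6 /=; lra.
Qed.

Definition lalpha := ln alpha.
Definition lphi := ln phi.

Lemma exp_lalpha : exp lalpha = alpha. Proof. exact: exp_ln alpha_gt0. Qed.
Lemma exp_lphi : exp lphi = phi. Proof. exact: exp_ln phi_gt0. Qed.

Lemma lalpha_bounds : 0.5 < lalpha < 1.
Proof.
have := alpha_bounds; rewrite -exp_lalpha => -[h1 h2]; split; apply: exp_lt_inv.
  have e1 : exp (1 / 2) * exp (1 / 2) <= 3.
    rewrite -exp_plus (_ : 1 / 2 + 1 / 2 = 1); last lra.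
    exact: exp_le_3.
  have := exp_pos (1 / 2); rewrite (_ : 0.5 = 1 / 2); last lra.
  by move: (exp (1 / 2)) e1 => e; nra.
by have := exp1_ge; lra.
Qed.

Lemma lphi_bounds : 0.4 < lphi < 0.5.
Proof.
have := phi_bounds; rewrite -exp_lphi => -[h1 h2]; split; apply: exp_lt_inv.
  have := exp_ineq1_le (- (1 / 5)); rewrite exp_Ropp => h.
  have e0 := exp_pos (1 / 5).
  have : exp (1 / 5) * (1 + - (1 / 5)) <= exp (1 / 5) * / exp (1 / 5) by apply: Rmult_le_compat_l; lra.
  rewrite Rinv_r; last lra.
  rewrite (_ : 0.4 = 1 / 5 + 1 / 5) ?exp_plus; last lra.
  by move: (exp (1 / 5)) e0 => e e0 h3; apply: Rle_lt_trans h1; nra.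
have e1 : 2.63 <= exp 0.5 * exp 0.5.
  rewrite -exp_plus (_ : 0.5 + 0.5 = 1); last lra.
  by have := exp1_ge; lra.
have := exp_pos 0.5; move: (exp 0.5) e1 => e; nra.
Qed.

Lemma ev_pow z n : ev (z ^+ n)%R = ev z ^ n.
Proof. by rewrite rmorphXn RpowE. Qed.

Lemma ev_mul z w : ev (z * w)%R = ev z * ev w.
Proof. exact: evM. Qed.

Lemma nrm_pow_le z c n : nrm z <= exp c -> nrm (z ^+ n)%R <= exp (INR n * c).
Proof.
move=> /RleP h; apply: Rle_trans (elimT RleP (nrm_exp_le n h)) _.
by rewrite expRX -GRing.mulr_natl -INRE; apply: Rle_refl.
Qed.

Lemma nrm_mul_exp_le z w c d : nrm z <= exp c -> nrm w <= exp d ->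
  nrm (z * w)%R <= exp (c + d).
Proof.
move=> h1 h2; rewrite exp_plus; apply: Rle_trans (nrmM _ _) _.
by apply: Rmult_le_compat => //; apply: nrm_ge0.
Qed.

Lemma nrm_alpha : nrm z_alpha <= exp 1.
Proof. by rewrite /nrm ev_alpha; have := alpha_bounds; have := exp1_ge; lra. Qed.
Lemma nrm_phi : nrm z_phi <= exp 1.
Proof. by rewrite /nrm ev_phi; have := phi_bounds; have := exp1_ge; lra. Qed.
Lemma nrm_phi_inv : nrm z_phi_inv <= exp 1.
Proof.
have := phi_bounds; have := exp1_ge.
by rewrite /nrm /ev /val6 /=; lra.
Qed.

Lemma ln_pow (x : R) n : 0 < x -> ln (x ^ n) = INR n * ln x.
Proof.
move=> x0; elim: n => [|n IHn]; first by rewrite /= ln_1; ring.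
by rewrite -[(x ^ n.+1)]/(x * x ^ n) ln_mult ?IHn ?S_INR; [ring | | exact: pow_lt].
Qed.

Lemma ev_eq0 z : ev z = 0 -> z = ord_zero.
Proof.
move=> ev0; apply: NNPP => /norm6_neq0 n0; apply/n0/eq_IZR.
by rewrite norm6E ev0; ring.
Qed.

Lemma mul_alpha_y w : [/\ y0 (z_alpha * w)%R = y2 w,
  y1 (z_alpha * w)%R = (y0 w + y2 w)%BZ & y2 (z_alpha * w)%R = (y1 w + y2 w)%BZ].
Proof.
case: w => a b c d e f; rewrite -[GRing.mul _ _]/(ord_mul z_alpha (Q6 a b c d e f)).
by cbv [ord_mul z_alpha mul0 mul1 mul2 x0 x1 x2 y0 y1 y2]; split; ring.
Qed.

Lemma mul_phi_xy w :
  x0 (z_phi * w)%R = y0 w /\ y0 (z_phi * w)%R = (x0 w + y0 w)%BZ.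
Proof.
case: w => a b c d e f; rewrite -[GRing.mul _ _]/(ord_mul z_phi (Q6 a b c d e f)).
by cbv [ord_mul z_phi mul0 mul1 mul2 x0 x1 x2 y0 y1 y2]; split; ring.
Qed.

(* In the basis of [ord], alpha^p has no [phi]-component while phi^d has one. *)
Lemma alpha_pow_neq_phi_pow p d : (0 < d)%N -> alpha ^ p <> phi ^ d.
Proof.
move=> d0; rewrite -ev_alpha -ev_phi -!ev_pow => eq_ev.
have yp : y0 (z_alpha ^+ p)%R = 0%BZ /\ y1 (z_alpha ^+ p)%R = 0%BZ /\ y2 (z_alpha ^+ p)%R = 0%BZ.
  elim: p {eq_ev} => [//|p]; rewrite GRing.exprS.
  by have [-> -> ->] := mul_alpha_y (z_alpha ^+ p)%R; lia.
have [x_ge y_ge] : (0 <= x0 (z_phi ^+ d)%R)%BZ /\ (1 <= y0 (z_phi ^+ d)%R)%BZ.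
  case: d d0 {eq_ev} => [//|d] _; elim: d => [|d IHd]; first by rewrite GRing.expr1.
  by rewrite GRing.exprS; have [-> ->] := mul_phi_xy (z_phi ^+ d.+1)%R; lia.
have : ev (ord_add (z_alpha ^+ p)%R (ord_opp (z_phi ^+ d)%R)) = 0.
  by rewrite evD evN eq_ev; ring.
move/ev_eq0; move: yp y_ge; case: (z_alpha ^+ p)%R => a b c a' b' c' /= [-> _].
by case: (z_phi ^+ d)%R => e f g e' f' g' /= y_ge; rewrite /ord_add /= => -[] *; lia.
Qed.

Lemma INR_sub m n : is_true (n <= m)%N -> INR (m - n)%N = INR m - INR n.
Proof. by move=> le_nm; apply: minus_INR; apply/ssrnat.leP. Qed.

(* Dirichlet approximation p / d of k / n turns the form in ln G, ln alpha, ln phi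
   into a form ln z2 - t ln z1 with z1 = alpha^p / phi^d. *)
Lemma three_logs_bound (G : ord) (h k n P L : nat) (lx : R) :
  0 < ev G -> nrm G <= exp (INR h) -> Rabs (ln (ev G)) <= INR h ->
  (0 < n)%N -> (n <= 2 * k)%N -> (k <= 2 * n)%N -> (2 <= P)%N -> (100 <= L)%N ->
  0 <= lx -> 7 * lx + 3 <= INR L ->
  100 * INR L * (INR k + 2 * INR P) <= exp lx ->
  28 * INR L * (3 * INR P * INR h + 9 * (INR P * INR P) + 3 * (INR n / INR P)) <= INR k ->
  exp (- (1520 * (INR L * INR L *
    (3 * INR P * INR h + 9 * (INR P * INR P) + 3 * (INR n / INR P))))) <
  Rabs (ln (ev G) - INR k * lalpha + INR n * lphi).
Proof.
move=> g_gt0 nrmG lnG n_gt0 le_n2k le_k2n P_ge2 L_ge lx_ge0 lx_le le_X M_le.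
have P_gt0 : (0 < P)%N by apply: leq_trans P_ge2.
have [d [p [/andP[d_gt0 d_leP] dk_lt np_lt]]] := dirichlet k n_gt0 P_gt0.
have d1 : 1 <= INR d by apply/(INR_leq 1).
have P2 : 2 <= INR P by apply/(INR_leq 2).
have dP : INR d <= INR P by apply/INR_leq.
have n1 : 1 <= INR n by apply/(INR_leq 1).
have n2k : INR n <= 2 * INR k by move/INR_leq: le_n2k; rewrite INR_mul.
have k2n : INR k <= 2 * INR n by move/INR_leq: le_k2n; rewrite INR_mul.
have L100 : 100 <= INR L.
  by have := proj2 (INR_leq 100 L) L_ge; rewrite [INR 100]INR_IZR_INZ.
have p0 := pos_INR p.
move/INR_ltn: dk_lt; move/INR_ltn: np_lt; rewrite !(INR_add, INR_mul) => np_lt dk_lt.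
have p_gt0 : (0 < p)%N.
  rewrite lt0n; apply/eqP => p_eq0; move: dk_lt; rewrite p_eq0 /=.
  have : INR P * (1 * INR k) <= INR P * (INR d * INR k).
    by apply: Rmult_le_compat_l; [lra | apply: Rmult_le_compat_r; lra].
  have : 2 * INR k <= INR P * INR k by apply: Rmult_le_compat_r; lra.
  by lra.
have p1 : 1 <= INR p by apply/(INR_leq 1).
have d_le2p : INR d <= 2 * INR p.
  have h1 : INR d * INR P < 2 + 2 * (INR P * INR p).
    apply: (Rmult_lt_reg_r (INR n)); first lra.
    have : INR P * INR d * INR n <= INR P * INR d * (2 * INR k).
      by apply: Rmult_le_compat_l; nra.
    by lra.
  have h2 : INR d < 2 * INR p + 1 by nra.
  have : (d < 2 * p + 1)%N by apply/INR_ltn; rewrite INR_add INR_mul.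
  by rewrite addn1 ltnS => /INR_leq; rewrite INR_mul.
have p_le2d : INR p <= 2 * INR d.
  have h1 : INR p * INR P < 1 + 2 * (INR P * INR d).
    apply: (Rmult_lt_reg_r (INR n)); first lra.
    have : INR P * INR d * INR k <= INR P * INR d * (2 * INR n).
      by apply: Rmult_le_compat_l; nra.
    by lra.
  have h2 : INR p < 2 * INR d + 1 by nra.
  have : (p < 2 * d + 1)%N by apply/INR_ltn; rewrite INR_add INR_mul.
  by rewrite addn1 ltnS => /INR_leq; rewrite INR_mul.
(* This is k / p rounded up, so k = t p - v with 0 <= v < p. The remainders v and n - t d go into
   z2, which leaves ln z2 with coefficient 1. *)
pose t := ((k + p.-1) %/ p)%N.
have le_ktp : (k <= t * p)%N.
  have := ltn_ceil (k + p.-1) p_gt0; rewrite -/t mulSn -{2}(prednK p_gt0) addSn ltnS.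
  by rewrite addnC leq_add2l.
have lt_tpk : (t * p < k + p)%N.
  apply: leq_ltn_trans (leq_trunc_div _ _) _.
  by rewrite ltn_add2l ltn_predL.
pose v := (t * p - k)%N.
have vE : INR v = INR t * INR p - INR k by rewrite /v INR_sub // INR_mul.
have v_lt : INR v < INR p by move/INR_ltn: lt_tpk; rewrite INR_add INR_mul vE; lra.
have v0 := pos_INR v.
pose W := ((n - t * d) + (t * d - n))%N.
have WE : INR W = Rabs (INR n - INR t * INR d).
  rewrite /W INR_add; case: (leqP (t * d) n) => [le_td|/ltnW le_nt].
    move/INR_leq: (le_td); rewrite (eqP (le_td : (t * d - n == 0)%N)) INR_sub // INR_mul => h1.
    by rewrite Rabs_pos_eq /=; lra.
  move/INR_leq: (le_nt); rewrite (eqP (le_nt : (n - t * d == 0)%N)) INR_sub // INR_mul => h1.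
  by rewrite Rabs_minus_sym Rabs_pos_eq /=; lra.
pose z1 := (z_alpha ^+ p * z_phi_inv ^+ d)%R.
pose zw := if (t * d <= n)%N then (z_phi ^+ (n - t * d))%R else (z_phi_inv ^+ (t * d - n))%R.
pose z2 := (G * z_alpha ^+ v * zw)%R.
have al0 := alpha_gt0; have ph0 := phi_gt0.
have iph0 : 0 < / phi by apply: Rinv_0_lt_compat.
have ev_z1 : ev z1 = alpha ^ p * / phi ^ d.
  by rewrite /z1 ev_mul !ev_pow ev_alpha ev_phi_inv -Rinv_pow_depr //; lra.
have ev_z1' : ev z1 = alpha ^ p * (/ phi) ^ d.
  by rewrite /z1 ev_mul !ev_pow ev_alpha ev_phi_inv.
have pa := pow_lt _ p al0; have pf := pow_lt _ d iph0; have pv := pow_lt _ v al0.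
have ln_z1 : ln (ev z1) = INR p * lalpha - INR d * lphi.
  by rewrite ev_z1' ln_mult // !ln_pow // ln_Rinv //; rewrite /lalpha /lphi; ring.
have [ev_zw ln_zw] : 0 < ev zw /\ ln (ev zw) = (INR n - INR t * INR d) * lphi.
  rewrite /zw; case: (leqP (t * d) n) => [le_td|/ltnW le_nt]; rewrite ev_pow ?ev_phi ?ev_phi_inv.
    by split; [exact: pow_lt | rewrite ln_pow // INR_sub // INR_mul].
  split; [exact: pow_lt | rewrite ln_pow // INR_sub // INR_mul ln_Rinv //].
  by rewrite /lphi; ring.
have ev_z2 : ev z2 = ev G * alpha ^ v * ev zw by rewrite /z2 !ev_mul ev_pow ev_alpha.
have gv0 : 0 < ev G * alpha ^ v by apply: Rmult_lt_0_compat.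
have ln_z2 : ln (ev z2) = ln (ev G) + INR v * lalpha + (INR n - INR t * INR d) * lphi.
  by rewrite ev_z2 !ln_mult // ln_pow // ln_zw.
have la := lalpha_bounds; have lf := lphi_bounds.
have nrm_z1 : nrm z1 <= exp (INR (p + d)).
  rewrite INR_add -[INR p]Rmult_1_r -[INR d]Rmult_1_r; apply: nrm_mul_exp_le.
    exact: nrm_pow_le nrm_alpha.
  exact: nrm_pow_le nrm_phi_inv.
have nrm_zw : nrm zw <= exp (INR W * 1).
  rewrite /zw /W; case: (leqP (t * d) n) => [le_td|/ltnW le_nt].
    by rewrite (eqP (le_td : (t * d - n == 0)%N)) addn0; apply: nrm_pow_le nrm_phi.
  by rewrite (eqP (le_nt : (n - t * d == 0)%N)) add0n; apply: nrm_pow_le nrm_phi_inv.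
have hpW : INR (h + p + W) = INR h + INR p + INR W by rewrite (INR_add (h + p)) (INR_add h p).
have nrm_z2 : nrm z2 <= exp (INR (h + p + W)).
  rewrite hpW -[INR W]Rmult_1_r; apply: nrm_mul_exp_le => //.
  apply: Rle_trans (_ : exp (INR h + INR v * 1) <= _); last by apply: exp_incr; lra.
  by apply: nrm_mul_exp_le => //; apply: nrm_pow_le nrm_alpha.
have abs_mul c l : 0 <= c -> 0 < l < 1 -> Rabs (c * l) <= c.
  by move=> c0 l1; rewrite Rabs_pos_eq; nra.
have abs_ln1 : Rabs (ln (ev z1)) <= INR (p + d).
  rewrite ln_z1 INR_add; apply: Rle_trans (Rabs_triang _ _) _; rewrite Rabs_Ropp.
  by apply: Rplus_le_compat; apply: abs_mul; lra.
have abs_ln2 : Rabs (ln (ev z2)) <= INR (h + p + W).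
  rewrite ln_z2 hpW; apply: Rle_trans (Rabs_triang _ _) _; apply: Rplus_le_compat.
    apply: Rle_trans (Rabs_triang _ _) _; apply: Rplus_le_compat => //.
    by apply: Rle_trans (abs_mul _ _ v0 _) _; lra.
  rewrite Rabs_mult -WE -{2}[INR W]Rmult_1_r; apply: Rmult_le_compat_l; first exact: pos_INR.
  by rewrite Rabs_pos_eq; lra.
have lamE : ln (ev z2) - INR t * ln (ev z1) = ln (ev G) - INR k * lalpha + INR n * lphi.
  by rewrite ln_z2 ln_z1 vE; ring.
(* Here the quality of p / d enters: n - t d differs from (n p - k d) / p by less than d, which
   keeps the height of z2 far below n. *)
have W_le : INR W * INR p <= INR n / INR P + INR p * INR d.
  have h1 : Rabs (INR n * INR p - INR k * INR d) <= INR n / INR P.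
    apply: Rabs_le; split; apply: (Rmult_le_reg_r (INR P)); try lra.
      by rewrite Ropp_mult_distr_l_reverse /Rdiv Rmult_assoc Rinv_l; lra.
    by rewrite /Rdiv Rmult_assoc Rinv_l; lra.
  rewrite WE -{1}(Rabs_pos_eq (INR p)) // -Rabs_mult.
  have -> : (INR n - INR t * INR d) * INR p = (INR n * INR p - INR k * INR d) + - (INR v * INR d).
    by rewrite vE; ring.
  apply: Rle_trans (Rabs_triang _ _) _; apply: Rplus_le_compat => //.
  rewrite Rabs_Ropp Rabs_pos_eq; last by apply: Rmult_le_pos; lra.
  by apply: Rmult_le_compat_r; lra.
have W0 := pos_INR W; have h0 := pos_INR h.
have nP0 : 0 < INR n / INR P by apply: Rdiv_lt_0_compat; lra.
set M := (3 * INR P * INR h + _ + _) in M_le *.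
have w12 : INR (p + d) * INR (h + p + W) <= M.
  rewrite hpW INR_add /M.
  have h1 : (INR p + INR d) * INR h <= 3 * INR P * INR h by apply: Rmult_le_compat_r; lra.
  have h2 : (INR p + INR d) * (INR p + INR d) <= 9 * (INR P * INR P).
    have -> : 9 * (INR P * INR P) = (3 * INR P) * (3 * INR P) by ring.
    by apply: Rmult_le_compat; lra.
  have h3 : (INR p + INR d) * INR W <= 3 * (INR n / INR P) + (INR p + INR d) * INR d.
    apply: (Rmult_le_reg_r (INR p)); first lra.
    have : (INR p + INR d) * (INR W * INR p) <=
        (INR p + INR d) * (INR n / INR P) + (INR p + INR d) * (INR p * INR d).
      by rewrite -Rmult_plus_distr_l; apply: Rmult_le_compat_l; lra.
    have : (INR p + INR d) * (INR n / INR P) <= 3 * INR p * (INR n / INR P).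
      by apply: Rmult_le_compat_r; lra.
    by lra.
  by lra.
have w1_ge1 : (1 <= p + d)%N by rewrite (leq_trans p_gt0) // leq_addr.
have w2_ge1 : (1 <= h + p + W)%N by rewrite (leq_trans p_gt0) // -addnA addnCA leq_addr.
have t0 := pos_INR t.
have ktp : INR k <= INR t * INR p by move/INR_leq: le_ktp; rewrite INR_mul.
have tpk : INR t * INR p < INR k + INR p by move/INR_ltn: lt_tpk; rewrite INR_add INR_mul.
have i28 : INR 28 = 28 by rewrite INR_IZR_INZ.
have t_ge_r : 28 * INR L * INR (h + p + W) <= INR t.
  apply: (Rmult_le_reg_r (INR p)); first lra.
  apply: Rle_trans ktp; apply: Rle_trans M_le.
  have -> : 28 * INR L * INR (h + p + W) * INR p = 28 * INR L * (INR p * INR (h + p + W)) by ring.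
  apply: Rmult_le_compat_l; first lra.
  apply: Rle_trans w12; apply: Rmult_le_compat_r; first exact: pos_INR.
  by rewrite INR_add; lra.
have t_ge : (28 * L * (h + p + W) <= t)%N by apply/INR_leq; rewrite !INR_mul i28.
have X_le : INR (28 * L * (h + p + W) + L + 28 * L * (p + d) * t) <= exp lx.
  apply: Rle_trans le_X; rewrite INR_add (INR_add _ L) !INR_mul i28 (INR_add p d).
  have t_le : INR t <= INR k + INR p by nra.
  have dt : INR d * INR t <= 2 * (INR k + INR p).
    apply: Rle_trans (_ : 2 * INR p * INR t <= _); last by lra.
    exact: Rmult_le_compat_r.
  have : INR L * ((INR p + INR d) * INR t) <= INR L * (3 * (INR k + 2 * INR P)).
    by apply: Rmult_le_compat_l; lra.
  have : INR k + INR p + INR L <= 2 * INR L * (INR k + 2 * INR P) by nra.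
  have : 0 <= INR L * (INR k + 2 * INR P) by apply: Rmult_le_pos; lra.
  by lra.
have z1_neq1 : ev z1 <> 1.
  move=> e1; apply: (alpha_pow_neq_phi_pow (p := p) d_gt0).
  have : ev z1 * phi ^ d = phi ^ d by rewrite e1; ring.
  by rewrite ev_z1 Rmult_assoc Rinv_l ?Rmult_1_r //; apply/pow_nonzero; lra.
have z1_gt0 : 0 < ev z1 by rewrite ev_z1'; apply: Rmult_lt_0_compat.
have z2_gt0 : 0 < ev z2 by rewrite ev_z2; apply: Rmult_lt_0_compat.
rewrite -lamE; apply: Rle_lt_trans (two_logs_bound z1_gt0 z1_neq1 z2_gt0 nrm_z1 nrm_z2
  abs_ln1 abs_ln2 w1_ge1 w2_ge1 L_ge lx_ge0 lx_le X_le t_ge).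
apply: exp_incr; apply: Ropp_le_contravar; apply: Rmult_le_compat_l; first lra.
rewrite [X in X <= _]Rmult_assoc; apply: Rmult_le_compat_l => //.
by apply: Rmult_le_pos; lra.
Qed.

(** * Asymptotics of Tribonacci and Lucas numbers *)

(* Binet's formula reads T_k = (alpha^k + o(1)) / gam. *)
Definition gam := - (alpha * alpha) + 4 * alpha - 1.
Definition z_gam := Q6 (-1) 4 (-1) 0 0 0.

Lemma ev_gam : ev z_gam = gam.
Proof. by rewrite /ev /val6 /gam /=; ring. Qed.

Lemma gam_bounds : 2.97 < gam < 2.98.
Proof. by have := alpha_bounds; rewrite /gam => -[h1 h2]; split; nra. Qed.

Lemma trib_rec k : tribonacci k.+3 =
  (tribonacci k.+2 + tribonacci k.+1 + tribonacci k)%N.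
Proof. by []. Qed.

Lemma lucas_rec n : lucas n.+2 = (lucas n.+1 + lucas n)%N.
Proof. by []. Qed.

Lemma trib_binet k : Rabs (INR (tribonacci k) * gam - alpha ^ k) <= 2.
Proof.
pose e k := INR (tribonacci k) * gam - alpha ^ k.
have al := alpha_bounds; have al3 := alpha_cubic.
have e_rec j : e j.+3 = e j.+2 + e j.+1 + e j.
  rewrite /e trib_rec !INR_add.
  have -> : alpha ^ j.+3 = alpha ^ j.+2 + alpha ^ j.+1 + alpha ^ j.
    by rewrite -!tech_pow_Rmult; ring [al3].
  by ring.
(* The coefficients are alpha times those of (X^3 - X^2 - X - 1) / (X - alpha): the choice of gam
   removes the dominant root from e. *)
have e2 j : alpha * e j.+2 + alpha * (alpha - 1) * e j.+1 + e j = 0.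
  elim: j => [|j IHj]; first by rewrite /e /gam /=; ring [al3].
  have -> : alpha * e j.+3 + alpha * (alpha - 1) * e j.+2 + e j.+1 =
    alpha * (alpha * e j.+2 + alpha * (alpha - 1) * e j.+1 + e j).
    by rewrite e_rec; ring [al3].
  by rewrite IHj; ring.
(* A positive definite quadratic form contracted by the recurrence bounds the
   contribution of the two complex roots without introducing them. *)
pose Q j := alpha * (e j.+1 * e j.+1) + alpha * (alpha - 1) * (e j.+1 * e j) + e j * e j.
have Q_step j : alpha * Q j.+1 = Q j.
  have -> : alpha * Q j.+1 = (alpha * e j.+2) * (alpha * e j.+2 + alpha * (alpha - 1) * e j.+1)
     + alpha * (e j.+1 * e j.+1) by rewrite /Q; ring.
  have -> : alpha * e j.+2 = - (alpha * (alpha - 1) * e j.+1) - e j by have := e2 j; lra.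
  by rewrite /Q; ring.
have Q_ge0 j : 0.6 * (e j * e j) <= Q j.
  rewrite /Q; move: (e j.+1) (e j) => x y.
  have : 0 <= alpha * ((x + (alpha - 1) / 2 * y) * (x + (alpha - 1) / 2 * y)).
    by apply: Rmult_le_pos; [lra | exact: Rle_0_sqr].
  have h1 : (alpha - 1) / 2 * ((alpha - 1) / 2) <= 0.42 * 0.42 by apply: Rmult_le_compat; lra.
  have : 0 <= (0.4 - alpha * ((alpha - 1) / 2 * ((alpha - 1) / 2))) * (y * y).
    by apply: Rmult_le_pos; nra.
  by lra.
have Q_le j : Q j <= Q 0%N.
  elim: j => [|j IHj]; first exact: Rle_refl.
  apply: Rle_trans IHj; rewrite -(Q_step j).
  have : 0 <= Q j.+1 by apply: Rle_trans (Q_ge0 _); nra.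
  by nra.
have Q0 : Q 0%N <= 2.4.
  by rewrite /Q /e /gam /=; nra.
have := Q_ge0 k; have := Q_le k; rewrite -/(e k) => h1 h2.
by apply: Rabs_le; split; nra.
Qed.

Definition psi := 1 - phi.

Lemma lucas_binet n : INR (lucas n) = phi ^ n + psi ^ n.
Proof.
have ph2 := phi_quadratic; rewrite /psi.
have [] : INR (lucas n) = phi ^ n + (1 - phi) ^ n /\
  INR (lucas n.+1) = phi ^ n.+1 + (1 - phi) ^ n.+1; last by [].
elim: n => [|n [IH1 IH2]]; first by split; rewrite /=; ring.
split=> //; rewrite lucas_rec INR_add IH1 IH2 -!tech_pow_Rmult; ring [ph2].
Qed.

Lemma phi_psi : phi * psi = -1.
Proof. by rewrite /psi; have := phi_quadratic; lra. Qed.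

Lemma psi_pow n : Rabs (psi ^ n) = / phi ^ n.
Proof.
have ph := phi_gt0.
have -> : psi = - / phi.
  by apply: (Rmult_eq_reg_l phi); rewrite ?phi_psi; [field|]; lra.
rewrite -RPow_abs Rabs_Ropp Rabs_pos_eq; last exact/Rlt_le/Rinv_0_lt_compat.
by rewrite pow_inv.
Qed.

Lemma phi_pow_exp n : phi ^ n = exp (INR n * lphi).
Proof. by rewrite -{1}exp_lphi RpowE expRX -GRing.mulr_natl -INRE. Qed.

Lemma lucas_ge1 n : 1 <= INR (lucas n).
Proof.
apply/(INR_leq 1).
have [] : (0 < lucas n)%N /\ (0 < lucas n.+1)%N; last by [].
by elim: n => [//|n [h1 h2]]; split=> //; rewrite lucas_rec addn_gt0 h2.
Qed.

Lemma lucas_le n : INR (lucas n) <= 2 * phi ^ n.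
Proof.
rewrite lucas_binet; have := psi_pow n; have := Rle_abs (psi ^ n).
have : 1 <= phi ^ n by apply: pow_R1_Rle; have := phi_bounds; lra.
move=> h1 h2 h3; have : / phi ^ n <= / 1 by apply: Rinv_le_contravar; lra.
by rewrite Rinv_1; lra.
Qed.

Lemma ln_le (x y : R) : 0 < x -> x <= y -> ln x <= ln y.
Proof. by move=> x0 [/(ln_increasing _ _ x0)|->]; lra. Qed.

Lemma ln_near1 x d : Rabs (x - 1) <= d -> d <= 1 / 2 -> Rabs (ln x) <= 2 * d.
Proof.
move=> hd d2.
have hx : 1 - d <= x <= 1 + d by move: hd; rewrite /Rabs; case: Rcase_abs; lra.
apply: Rabs_le; split; last first.
  have : ln x <= ln (exp d).
    by apply: ln_le; [lra | have := exp_ineq1_le d; lra].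
  by rewrite ln_exp; lra.
have : ln (exp (- (2 * d))) <= ln x.
  apply: ln_le; first exact: exp_pos.
  rewrite exp_Ropp; have e0 := exp_pos (2 * d); have e1 := exp_ineq1_le (2 * d).
  apply: Rle_trans (_ : / (1 + 2 * d) <= _); first by apply: Rinv_le_contravar; lra.
  apply: Rle_trans (_ : 1 - d <= _); last lra.
  apply: (Rmult_le_reg_r (1 + 2 * d)); first lra.
  by rewrite Rinv_l; nra.
by rewrite ln_exp.
Qed.

Lemma ln_quotient (g : R) k n : 0 < g ->
  ln (alpha ^ k / (g * phi ^ n)) = - (ln g - INR k * lalpha + INR n * lphi).
Proof.
move=> g0; have a0 := pow_lt _ k alpha_gt0; have f0 := pow_lt _ n phi_gt0.
have gf : 0 < g * phi ^ n by apply: Rmult_lt_0_compat.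
rewrite /Rdiv ln_mult ?ln_Rinv ?ln_mult ?ln_pow //;
  try exact: alpha_gt0; try exact: phi_gt0; try exact: Rinv_0_lt_compat.
by rewrite /lalpha /lphi; ring.
Qed.

(** The quotient alpha^k / (gam L_m phi^n) is 1 + O(phi^(-n)): replacing L_n by phi^n costs
    phi^(-2n), and [trib_binet] costs 2 / (gam L_m phi^n). From n >= 3 on, this is close enough to 1
    for [ln_near1]. *)
Lemma linear_form_lucas k m n : (1 <= m)%N -> (3 <= n)%N ->
  tribonacci k = (lucas m * lucas n)%N ->
  Rabs (ln (gam * INR (lucas m)) - INR k * lalpha + INR n * lphi) <=
  3 * exp (- (INR n * lphi)).
Proof.
move=> m1 n3 eqT; have g_b := gam_bounds; have Lm := lucas_ge1 m.
have g0 : 0 < gam * INR (lucas m) by apply: Rmult_lt_0_compat; lra.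
have f0 := pow_lt _ n phi_gt0; have gf := Rmult_lt_0_compat _ _ g0 f0.
rewrite -Rabs_Ropp -ln_quotient // exp_Ropp -phi_pow_exp.
have f3 : 4 <= phi ^ n.
  apply: Rle_trans (_ : phi ^ 3 <= _); first by have := phi_bounds; rewrite /=; nra.
  by apply: Rle_pow; [have := phi_bounds; lra | apply/ssrnat.leP].
have if0 : 0 < / phi ^ n by apply: Rinv_0_lt_compat.
have if_le : / phi ^ n <= / 4 by apply: Rinv_le_contravar; lra.
apply: Rle_trans (ln_near1 (d := 1.25 * / phi ^ n) _ _) _; [ | lra | ]; last first.
  by lra.
have := trib_binet k; rewrite eqT INR_mul (lucas_binet n) => hT.
set q := alpha ^ k / _.
have -> : q - 1 = psi ^ n / phi ^ n -
   (gam * INR (lucas m) * (phi ^ n + psi ^ n) - alpha ^ k) / (gam * INR (lucas m) * phi ^ n).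
  by rewrite /q; field; lra.
apply: Rle_trans (Rabs_triang _ _) _; rewrite Rabs_Ropp !Rabs_mult psi_pow.
rewrite (Rabs_pos_eq (/ phi ^ n)); last lra.
rewrite (Rabs_pos_eq (/ (gam * INR (lucas m) * phi ^ n))); last exact/Rlt_le/Rinv_0_lt_compat.
have -> : / (gam * INR (lucas m) * phi ^ n) = / (gam * INR (lucas m)) * / phi ^ n.
  by field; lra.
have gl : / (gam * INR (lucas m)) <= / 2.97.
  by apply: Rinv_le_contravar; [lra | nra].
have gl0 : 0 < / (gam * INR (lucas m)) by apply: Rinv_0_lt_compat.
have := Rabs_pos (gam * INR (lucas m) * (phi ^ n + psi ^ n) - alpha ^ k).
have -> : gam * INR (lucas m) * (phi ^ n + psi ^ n) - alpha ^ k =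
  INR (lucas m) * (phi ^ n + psi ^ n) * gam - alpha ^ k by ring.
move: hT gl gl0; move: (Rabs (_ - alpha ^ k)) (/ (gam * INR (lucas m))) => x y hx hy y0 x0.
have : x * (y * / phi ^ n) <= 2 * (/ 2.97 * / phi ^ n).
  apply: Rmult_le_compat => //; first exact/Rlt_le/Rmult_lt_0_compat.
  by apply: Rmult_le_compat_r; lra.
have : / phi ^ n * / phi ^ n <= / 4 * / phi ^ n by apply: Rmult_le_compat_r; lra.
by lra.
Qed.

(** Now both Lucas numbers are replaced by powers of phi, and the dominant error is that of L_m, of
    relative size phi^(-2m). Since m <= n, the error phi^(-m-n) from [trib_binet] is no larger in
    order. *)
Lemma linear_form_product k m n : (2 <= m)%N -> (m <= n)%N ->
  tribonacci k = (lucas m * lucas n)%N ->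
  Rabs (ln gam - INR k * lalpha + INR (m + n) * lphi) <=
  6 * exp (- (2 * INR m * lphi)).
Proof.
move=> m2 le_mn eqT; have g_b := gam_bounds; have ph := phi_bounds.
have g0 : 0 < gam by lra.
have fN0 := pow_lt _ (m + n) phi_gt0; have gf := Rmult_lt_0_compat _ _ g0 fN0.
rewrite -Rabs_Ropp -ln_quotient //.
have fm0 := pow_lt _ m phi_gt0; have fn0 := pow_lt _ n phi_gt0.
have fm2 : 2.6 <= phi ^ m.
  apply: Rle_trans (_ : phi ^ 2 <= _); first by rewrite /=; nra.
  by apply: Rle_pow; [lra | apply/ssrnat.leP].
have fmn : phi ^ m <= phi ^ n by apply: Rle_pow; [lra | apply/ssrnat.leP].
pose x := / phi ^ m; pose y := / phi ^ n.
have x0 : 0 < x by apply: Rinv_0_lt_compat.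
have y0 : 0 < y by apply: Rinv_0_lt_compat.
have yx : y <= x by apply: Rinv_le_contravar.
have x_le : x <= / 2.6 by apply: Rinv_le_contravar; lra.
have -> : exp (- (2 * INR m * lphi)) = x * x.
  rewrite (_ : - (2 * INR m * lphi) = - (INR m * lphi) + - (INR m * lphi)); last by ring.
  by rewrite exp_plus exp_Ropp -phi_pow_exp.
have x2 : x * x <= / 2.6 * / 2.6 by apply: Rmult_le_compat; lra.
apply: Rle_trans (ln_near1 (d := 3 * (x * x)) _ _) _; [ | lra | lra].
have := trib_binet k; rewrite eqT INR_mul !lucas_binet => hT.
set q := alpha ^ k / _.
have fN : phi ^ (m + n) = phi ^ m * phi ^ n by rewrite pow_add.
have -> : q - 1 = psi ^ m / phi ^ m + psi ^ n / phi ^ n + psi ^ m / phi ^ m * (psi ^ n / phi ^ n) -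
   ((phi ^ m + psi ^ m) * (phi ^ n + psi ^ n) * gam - alpha ^ k) * (/ gam * (x * y)).
  by rewrite /q /x /y fN; field; lra.
have abs_pp j : Rabs (psi ^ j / phi ^ j) = / phi ^ j * / phi ^ j.
  rewrite Rabs_mult psi_pow Rabs_pos_eq //.
  by apply/Rlt_le/Rinv_0_lt_compat/pow_lt/phi_gt0.
apply: Rle_trans (Rabs_triang _ _) _; rewrite Rabs_Ropp.
apply: Rle_trans (_ : x * x + y * y + x * x * (y * y) + 2 * (/ 2.97 * (x * y)) <= _).
  apply: Rplus_le_compat.
    apply: Rle_trans (Rabs_triang _ _) _; rewrite (Rabs_mult (psi ^ m / _)) !abs_pp -/x -/y.
    apply: Rplus_le_compat_r; apply: Rle_trans (Rabs_triang _ _) _; rewrite !abs_pp -/x -/y.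
    exact: Rle_refl.
  have ig0 : 0 < / gam by apply: Rinv_0_lt_compat.
  have ig : / gam <= / 2.97 by apply: Rinv_le_contravar; lra.
  have xy0 : 0 < x * y by apply: Rmult_lt_0_compat.
  rewrite Rabs_mult (Rabs_pos_eq (/ gam * (x * y))); last exact/Rlt_le/Rmult_lt_0_compat.
  apply: Rmult_le_compat => //; [exact: Rabs_pos | exact/Rlt_le/Rmult_lt_0_compat |].
  by apply: Rmult_le_compat_r; lra.
have h1 : y * y <= x * x by apply: Rmult_le_compat; lra.
have h2 : x * y <= x * x by apply: Rmult_le_compat_l; lra.
have h3 : x * x * (y * y) <= x * x * (/ 2.6 * / 2.6).
  by apply: Rmult_le_compat_l; [nra | lra].
have xx0 : 0 <= x * x by nra.
by move: h1 h2 h3 xx0; move: (x * x) (y * y) (x * y) => a b c *; lra.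
Qed.

(** * Certified logarithms and Baker-Davenport reduction *)

Fixpoint atanh_sum (n : nat) (y : R) : R :=
  if n is n'.+1 then atanh_sum n' y + y ^ (2 * n' + 1) / INR (2 * n' + 1) else 0.
Fixpoint geom_sum (n : nat) (y : R) : R :=
  if n is n'.+1 then geom_sum n' y + y ^ (2 * n') else 0.

Lemma geom_sumE n y : (1 - y * y) * geom_sum n y = 1 - y ^ (2 * n).
Proof.
elim: n => [|n IHn]; first by rewrite muln0 /=; ring.
have -> : y ^ (2 * n.+1) = y * y * y ^ (2 * n) by rewrite mulnS pow_add /=; ring.
by rewrite /= Rmult_plus_distr_l IHn; ring.
Qed.

Lemma atanh_sum0 n : atanh_sum n 0%Re = 0.
Proof.
elim: n => [//|n IHn].
rewrite -[atanh_sum n.+1 _]/(atanh_sum n 0%Re + 0 ^ (2 * n + 1) / INR (2 * n + 1)) IHn.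
by rewrite addn1 -tech_pow_Rmult /Rdiv; ring.
Qed.

Lemma atanh_sum_deriv n y : derivable_pt_lim (atanh_sum n) y (geom_sum n y).
Proof.
elim: n => [|n IHn]; first exact: derivable_pt_lim_const.
apply: (derivable_pt_lim_plus (atanh_sum n) (fun x => x ^ (2 * n + 1) / INR (2 * n + 1))) => //.
have n0 : INR (2 * n + 1) <> 0 by apply: not_0_INR; rewrite addn1.
have -> : y ^ (2 * n) = / INR (2 * n + 1) * (INR (2 * n + 1) * y ^ (2 * n)) by field.
have := derivable_pt_lim_scal (fun x => x ^ (2 * n + 1)) (/ INR (2 * n + 1)) y.
move=> /(_ (INR (2 * n + 1) * y ^ (2 * n))) h.
have := h (_ : derivable_pt_lim (fun x => x ^ (2 * n + 1)) y _); move: h => _ h.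
have {}h : derivable_pt_lim (mult_real_fct (/ INR (2 * n + 1)) (fun x => x ^ (2 * n + 1))) y
   (/ INR (2 * n + 1) * (INR (2 * n + 1) * y ^ (2 * n))).
  by apply: h; have := derivable_pt_lim_pow y (2 * n + 1); rewrite {3}addn1.
move=> eps eps0; have [d hd] := h eps eps0; exists d => x x0 xd.
by have := hd x x0 xd; rewrite /mult_real_fct /Rdiv ![_ * / INR _]Rmult_comm.
Qed.

(** By [geom_sumE] the difference has derivative 2 y^(2n) / (1 - y^2), and 2 / (1 - 1 / 4) < 3; the
    mean value theorem concludes. *)
Lemma ln_atanh_bounds n y : 0 <= y <= 1 / 2 ->
  2 * atanh_sum n y <= ln ((1 + y) / (1 - y)) <=
  2 * atanh_sum n y + 3 * y ^ (2 * n + 1).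
Proof.
move=> [y0 y2].
have y_cases : 0 < y \/ y = 0 by lra.
case: y_cases => [y_gt0|->]; last first.
  by rewrite atanh_sum0 addn1 /= (_ : (1 + 0) / (1 - 0) = 1) ?ln_1; [lra | field].
pose f x := ln (1 + x) - ln (1 - x) - 2 * atanh_sum n x.
pose f' x := 2 * x ^ (2 * n) / (1 - x * x).
have df c : 0 <= c <= y -> derivable_pt_lim f c (f' c).
  move=> [c0 cy].
  have -> : f' c = / (1 + c) * (0 + 1) - / (1 - c) * (0 - 1) - 2 * geom_sum n c.
    rewrite /f'; have := geom_sumE n c; move=> h.
    apply: (Rmult_eq_reg_r (1 - c * c)); last by nra.
    have -> : 2 * c ^ (2 * n) / (1 - c * c) * (1 - c * c) = 2 * c ^ (2 * n) by field; nra.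
    have -> : (/ (1 + c) * (0 + 1) - / (1 - c) * (0 - 1) - 2 * geom_sum n c) * (1 - c * c) =
      2 - 2 * ((1 - c * c) * geom_sum n c) by field; lra.
    by rewrite h; ring.
  apply: derivable_pt_lim_minus; first apply: derivable_pt_lim_minus.
  - apply: (derivable_pt_lim_comp (fun x => 1 + x) ln).
      by apply: derivable_pt_lim_plus; [exact: derivable_pt_lim_const | exact: derivable_pt_lim_id].
    by apply: derivable_pt_lim_ln; lra.
  - apply: (derivable_pt_lim_comp (fun x => 1 - x) ln).
      by apply: derivable_pt_lim_minus; [exact: derivable_pt_lim_const | exact: derivable_pt_lim_id].
    by apply: derivable_pt_lim_ln; lra.
  - by apply: derivable_pt_lim_scal; exact: atanh_sum_deriv.
have [c [fc [c0 cy]]] := MVT_cor2 f f' 0 y y_gt0 df.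
have f0 : f 0 = 0.
  by rewrite /f Rplus_0_r Rminus_0_r ln_1 atanh_sum0; ring.
have fy : f y = ln ((1 + y) / (1 - y)) - 2 * atanh_sum n y.
  rewrite /f /Rdiv ln_mult ?ln_Rinv //; try lra; last by apply: Rinv_0_lt_compat; lra.
rewrite f0 Rminus_0_r Rminus_0_r in fc.
have cn := pow_lt _ (2 * n) c0.
have cy2 : c ^ (2 * n) <= y ^ (2 * n) by apply: pow_incr; lra.
have f'_bounds : 0 <= f' c <= 3 * y ^ (2 * n).
  rewrite /f'; have d0 : 3 / 4 <= 1 - c * c by nra.
  have i1 : 0 < / (1 - c * c) by apply: Rinv_0_lt_compat; lra.
  have i2 : / (1 - c * c) <= / (3 / 4) by apply: Rinv_le_contravar; lra.
  split; first by apply: Rmult_le_pos; lra.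
  by rewrite /Rdiv; nra.
have : 0 <= f' c * y <= 3 * y ^ (2 * n) * y by split; nra.
rewrite -fc fy addn1 /= => h; lra.
Qed.

Lemma div_le (a b : Z) : (0 < b)%BZ -> IZR (a / b)%BZ <= IZR a / IZR b.
Proof.
move=> b0; have b0r : 0 < IZR b by apply: IZR_lt.
apply: (Rmult_le_reg_r (IZR b)) => //; rewrite /Rdiv Rmult_assoc Rinv_l; last lra.
rewrite Rmult_1_r -mult_IZR; apply: IZR_le.
by have := Z.mul_div_le a b b0; lia.
Qed.

Lemma div_ge (a b : Z) : (0 < b)%BZ -> IZR a / IZR b <= IZR (a / b)%BZ + 1.
Proof.
move=> b0; have b0r : 0 < IZR b by apply: IZR_lt.
apply: (Rmult_le_reg_r (IZR b)) => //; rewrite /Rdiv Rmult_assoc Rinv_l; last lra.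
rewrite Rmult_1_r -plus_IZR -mult_IZR; apply: IZR_le.
by have := Z.mul_succ_div_gt a b b0; lia.
Qed.

Section FixedPoint.
Variable s : Z.
Hypothesis s_ge5 : (5 <= s)%BZ.
Let B := (2 ^ s)%BZ.
Let s_ge0 : (0 <= s)%BZ. Proof. by lia. Qed.

(** The series of artanh in fixed point at scale 2^s: p carries the current odd power of y and i its
    exponent. The last power is returned to bound the tail. *)
Fixpoint series (n : nat) (i p y2 : Z) : Z * Z :=
  if n is n'.+1 then
    let: (sum, rest) := series n' (i + 2)%BZ (Z.shiftr (p * y2) s) y2 in (p / i + sum, rest)%BZ
  else (0%BZ, p).

(** Only X is fed to the series; since ln is 1-Lipschitz on [1, +oo), adding X' - X makes the upper
    end valid up to X'. Each term may be 5 units too small, 4 from its power and 1 from the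
    division, and 2 (rest + 4) covers the tail. *)
Definition ln_br (n : nat) (X X' : Z) : Z * Z :=
  let y := ((X - B) * B / (X + B))%BZ in
  let: (sum, rest) := series n 1 y (Z.shiftr (y * y) s) in
  (2 * sum, 2 * (sum + 5 * Z.of_nat n + 2 * (rest + 4)) + (X' - X))%BZ.

Lemma B_gt0 : 0 < IZR B.
Proof. by apply: IZR_lt; apply: Z.pow_pos_nonneg. Qed.

Lemma B_ge32 : 32 <= IZR B.
Proof. by apply: (IZR_le (2 ^ 5)); apply: Z.pow_le_mono_r. Qed.

Lemma shiftr_le (a : Z) : IZR (Z.shiftr a s) <= IZR a / IZR B.
Proof. by rewrite Z.shiftr_div_pow2 //; apply: div_le; apply: Z.pow_pos_nonneg. Qed.
Lemma shiftr_ge (a : Z) : IZR a / IZR B <= IZR (Z.shiftr a s + 1)%BZ.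
Proof.
by rewrite Z.shiftr_div_pow2 // plus_IZR; apply: div_ge; apply: Z.pow_pos_nonneg.
Qed.

(** The part of [atanh_sum] still to be summed when [series] has reached exponent 2 m + 1; it
    recurses from the front, as [series] does. *)
Fixpoint tail_sum (n : nat) (m : nat) (y : R) : R :=
  if n is n'.+1 then y ^ (2 * m + 1) / INR (2 * m + 1) + tail_sum n' m.+1 y else 0.

Lemma tail_sumE n m y : atanh_sum m y + tail_sum n m y = atanh_sum (m + n) y.
Proof.
elim: n m => [|n IHn] m; first by rewrite addn0 /=; ring.
by rewrite addnS -addSn -IHn /=; ring.
Qed.

Lemma mul_shift_le p y2 Y Y2 : (0 <= p)%BZ -> (0 <= y2)%BZ -> IZR p <= IZR B * Y ->
  IZR y2 <= IZR B * Y2 -> IZR (Z.shiftr (p * y2) s) <= IZR B * (Y * Y2).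
Proof.
move=> p0 y0 hp hy; apply: Rle_trans (shiftr_le _) _; have B0 := B_gt0.
apply: (Rmult_le_reg_r (IZR B)) => //; rewrite /Rdiv Rmult_assoc Rinv_l; last lra.
rewrite Rmult_1_r mult_IZR.
have -> : IZR B * (Y * Y2) * IZR B = IZR B * Y * (IZR B * Y2) by ring.
by apply: Rmult_le_compat => //; apply: IZR_le.
Qed.

Lemma mul_shift_ge p y2 Y Y2 : 0 <= Y -> 0 <= Y2 -> IZR B * Y <= IZR p ->
  IZR B * Y2 <= IZR y2 -> IZR B * (Y * Y2) <= IZR (Z.shiftr (p * y2) s + 1)%BZ.
Proof.
move=> Y0 Y20 hp hy; apply: Rle_trans (shiftr_ge _); have B0 := B_gt0.
apply: (Rmult_le_reg_r (IZR B)) => //.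
have -> : IZR (p * y2)%BZ / IZR B * IZR B = IZR (p * y2)%BZ by field; lra.
rewrite mult_IZR.
have -> : IZR B * (Y * Y2) * IZR B = IZR B * Y * (IZR B * Y2) by ring.
by apply: Rmult_le_compat => //; apply: Rmult_le_pos; lra.
Qed.

Lemma odd_IZR m : INR (2 * m + 1) = IZR (2 * Z.of_nat m + 1)%BZ.
Proof. by rewrite INR_IZR_INZ; congr IZR; rewrite -plusE -multE; lia. Qed.

Lemma pow_odd_next y m : y ^ (2 * m.+1 + 1) = y ^ (2 * m + 1) * (y * y).
Proof. by rewrite mulnS -addnA addnC pow_add /=; ring. Qed.

Lemma series_le n m p y2 y : 0 <= y -> (0 <= p)%BZ -> (0 <= y2)%BZ ->
  IZR p <= IZR B * y ^ (2 * m + 1) -> IZR y2 <= IZR B * (y * y) ->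
  IZR (series n (2 * Z.of_nat m + 1) p y2).1 <= IZR B * tail_sum n m y.
Proof.
move=> y_ge0; elim: n m p => [|n IHn] m p p0 y20 hp hy; first by rewrite /=; lra.
rewrite [series _ _ _ _]/= [tail_sum _ _ _]/= Rmult_plus_distr_l.
have -> : (2 * Z.of_nat m + 1 + 2 = 2 * Z.of_nat m.+1 + 1)%BZ by lia.
have := IHn m.+1 (Z.shiftr (p * y2) s); case: (series _ _ _ _) => sum rest le_sum.
rewrite [X in IZR X]/= plus_IZR; apply: Rplus_le_compat.
  have i0 : (0 < 2 * Z.of_nat m + 1)%BZ by lia.
  apply: Rle_trans (div_le _ i0) _; rewrite odd_IZR /Rdiv -Rmult_assoc.
  by apply: Rmult_le_compat_r => //; apply/Rlt_le/Rinv_0_lt_compat/IZR_lt.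
apply: le_sum => //; first by apply/Z.shiftr_nonneg; nia.
by rewrite pow_odd_next; apply: mul_shift_le.
Qed.

(* The truncation errors of the powers stay below 4 units, as
   1 + 3 / 2 + 4 / 4 + 12 / 32 < 4. *)
Lemma shift_error p y2 Y Y2 : 0 <= Y <= 1 / 2 -> 0 <= Y2 <= 1 / 4 ->
  IZR p <= IZR B * Y <= IZR p + 4 -> IZR y2 <= IZR B * Y2 <= IZR y2 + 3 ->
  IZR B * (Y * Y2) <= IZR (Z.shiftr (p * y2) s) + 4.
Proof.
move=> hY hY2 hp hy; have B32 := B_ge32.
have := shiftr_ge (p * y2); rewrite plus_IZR mult_IZR => h.
suff : IZR B * (Y * Y2) <= IZR p * IZR y2 / IZR B + 3 by lra.
apply: (Rmult_le_reg_r (IZR B)); first lra.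
have -> : (IZR p * IZR y2 / IZR B + 3) * IZR B = IZR p * IZR y2 + 3 * IZR B by field; lra.
have -> : IZR B * (Y * Y2) * IZR B = (IZR B * Y) * (IZR B * Y2) by ring.
move: (IZR p) (IZR y2) (IZR B) hp hy B32 => P Q b hp hy B32.
have : b * Y * (b * Y2 - Q) <= b * (1 / 2) * 3.
  by apply: Rmult_le_compat; [apply: Rmult_le_pos; lra | lra | apply: Rmult_le_compat_l; lra | lra].
have : (b * Y - P) * (b * Y2) <= 4 * (b * (1 / 4)).
  by apply: Rmult_le_compat; [lra | apply: Rmult_le_pos; lra | lra | apply: Rmult_le_compat_l; lra].
have : (b * Y - P) * (b * Y2 - Q) <= 4 * 3 by apply: Rmult_le_compat; lra.
have : 0 <= (b * Y - P) * (b * Y2 - Q) by apply: Rmult_le_pos; lra.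
lra.
Qed.

Lemma series_ge n m p y2 y : 0 <= y <= 1 / 2 -> (0 <= p)%BZ -> (0 <= y2)%BZ ->
  IZR p <= IZR B * y ^ (2 * m + 1) <= IZR p + 4 ->
  IZR y2 <= IZR B * (y * y) <= IZR y2 + 3 ->
  let: (sum, rest) := series n (2 * Z.of_nat m + 1) p y2 in
  IZR B * (tail_sum n m y + 1.5 * y ^ (2 * (m + n) + 1)) <=
  IZR (sum + 5 * Z.of_nat n + 2 * (rest + 4))%BZ.
Proof.
move=> y_b; elim: n m p => [|n IHn] m p p0 y20 hp hy.
  rewrite addn0 [tail_sum _ _ _]/=; change (IZR B * (0 + 1.5 * y ^ (2 * m + 1)) <=
    IZR (0 + 5 * Z.of_nat 0 + 2 * (p + 4))%BZ); rewrite !(plus_IZR, mult_IZR).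
  by rewrite [IZR (Z.of_nat 0)]/=; have := IZR_le _ _ p0; lra.
rewrite [series _ _ _ _]/= [tail_sum _ _ _]/=.
have -> : (2 * Z.of_nat m + 1 + 2 = 2 * Z.of_nat m.+1 + 1)%BZ by lia.
have p0' : (0 <= Z.shiftr (p * y2) s)%BZ by apply/Z.shiftr_nonneg; nia.
have ym0 : 0 <= y ^ (2 * m + 1) by apply: pow_le; lra.
have ym : y ^ (2 * m + 1) <= 1 / 2.
  rewrite addn1 -tech_pow_Rmult; have : y ^ (2 * m) <= 1 ^ (2 * m) by apply: pow_incr; lra.
  by rewrite pow1; have := pow_le y (2 * m) (proj1 y_b); nra.
have yy : 0 <= y * y <= 1 / 4 by nra.
have hp' : IZR (Z.shiftr (p * y2) s) <= IZR B * y ^ (2 * m.+1 + 1) <=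
    IZR (Z.shiftr (p * y2) s) + 4.
  rewrite pow_odd_next; split; last by apply: shift_error; lra.
  by apply: mul_shift_le => //; lra.
have := IHn m.+1 _ p0' y20 hp' hy; case: (series _ _ _ _) => sum rest.
rewrite [(m + n.+1)%N]addnS -[(m + n).+1]addSn => le_sum.
have i0 : (0 < 2 * Z.of_nat m + 1)%BZ by lia.
have i1 : 1 <= IZR (2 * Z.of_nat m + 1)%BZ by apply: IZR_le; lia.
have term : IZR B * (y ^ (2 * m + 1) / INR (2 * m + 1)) <=
    IZR (p / (2 * Z.of_nat m + 1))%BZ + 5.
  rewrite odd_IZR; have := div_ge p i0; set i := IZR (_ + 1)%BZ in i1 *.
  have ii : 0 < / i <= 1.
    by split; [apply: Rinv_0_lt_compat; lra | rewrite -Rinv_1; apply: Rinv_le_contravar; lra].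
  have : IZR B * y ^ (2 * m + 1) * / i <= (IZR p + 4) * / i by apply: Rmult_le_compat_r; lra.
  by rewrite /Rdiv; lra.
rewrite -[IZR (_ + 2 * (rest + 4))]/(IZR (p / (2 * Z.of_nat m + 1) + sum + 5 * Z.of_nat n.+1 + 2 * (rest + 4))%BZ).
move: le_sum; rewrite Nat2Z.inj_succ !(plus_IZR, mult_IZR, succ_IZR); lra.
Qed.

Lemma atanh_arg x : 1 <= x <= 3 -> exists y, [/\ 0 <= y <= 1 / 2,
  x = (1 + y) / (1 - y) & y = (x - 1) / (x + 1)].
Proof.
move=> [x1 x3]; exists ((x - 1) / (x + 1)); split=> //; last by field; lra.
have e : (x - 1) / (x + 1) * (x + 1) = x - 1 by field; lra.
by split; apply: (Rmult_le_reg_r (x + 1)); rewrite ?e; lra.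
Qed.

Lemma ln_br_le n X X' x : 1 <= x <= 3 -> (B <= X)%BZ -> IZR B * x = IZR X ->
  IZR (ln_br n X X').1 <= IZR B * ln x <= IZR (ln_br n X X').2 - (IZR X' - IZR X).
Proof.
move=> x_b BX hX; have [y [y_b xE yE]] := atanh_arg x_b; have B32 := B_ge32.
have [] := ln_atanh_bounds n y_b; rewrite -xE => lo hi.
have B0 : (0 < B)%BZ by apply: lt_IZR; lra.
rewrite /ln_br; set Y := ((X - B) * B / (X + B))%BZ.
have Y0 : (0 <= Y)%BZ by apply: Z.div_pos; nia.
have qE : IZR ((X - B) * B)%BZ / IZR (X + B)%BZ = IZR B * y.
  by rewrite mult_IZR minus_IZR plus_IZR -hX yE; field; nra.
have XB : (0 < X + B)%BZ by lia.
have hY : IZR Y <= IZR B * y <= IZR Y + 1.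
  by rewrite -qE; split; [apply: div_le | apply: div_ge].
have Y20 : (0 <= Z.shiftr (Y * Y) s)%BZ by apply/Z.shiftr_nonneg; nia.
have Y0r := IZR_le _ _ Y0.
have hY2 : IZR (Z.shiftr (Y * Y) s) <= IZR B * (y * y) <= IZR (Z.shiftr (Y * Y) s) + 3.
  split; first by apply: mul_shift_le => //; lra.
  have := shiftr_ge (Y * Y); rewrite plus_IZR mult_IZR => h.
  suff : IZR B * (y * y) <= IZR Y * IZR Y / IZR B + 2 by lra.
  apply: (Rmult_le_reg_r (IZR B)); first lra.
  have -> : (IZR Y * IZR Y / IZR B + 2) * IZR B = IZR Y * IZR Y + 2 * IZR B by field; lra.
  have -> : IZR B * (y * y) * IZR B = (IZR B * y) * (IZR B * y) by ring.
  have : IZR B * y <= IZR B * (1 / 2) by apply: Rmult_le_compat_l; lra.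
  by move: (IZR B * y) hY => b *; nra.
have s1 := @series_le n 0 Y _ y (proj1 y_b) Y0 Y20.
have s2 := @series_ge n 0 Y _ y y_b Y0 Y20.
rewrite /= !Rmult_1_r -[tail_sum n 0 y]Rplus_0_l in s1 s2.
rewrite -[0 + _]/(atanh_sum 0 y + _) tail_sumE add0n in s1 s2.
have hY4 : IZR Y <= IZR B * y <= IZR Y + 4 by lra.
have {}s1 := s1 (proj1 hY) (proj1 hY2); have {}s2 := s2 hY4 hY2.
case: (series n 1 Y _) s1 s2 => sum rest /= s1 s2.
have {}s2 : IZR B * (atanh_sum n y + 1.5 * y ^ (2 * n + 1)) <=
  IZR (sum + 5 * Z.of_nat n + 2 * (rest + 4))%BZ := s2.
change (IZR (2 * sum)%BZ <= IZR B * ln x <=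
  IZR (2 * (sum + 5 * Z.of_nat n + 2 * (rest + 4)) + (X' - X))%BZ - (IZR X' - IZR X)).
have h1 : IZR B * (2 * atanh_sum n y) <= IZR B * ln x by apply: Rmult_le_compat_l; lra.
have h2 : IZR B * ln x <= IZR B * (2 * atanh_sum n y + 3 * y ^ (2 * n + 1)).
  by apply: Rmult_le_compat_l; lra.
split; first by rewrite mult_IZR; lra.
by rewrite plus_IZR minus_IZR mult_IZR; lra.
Qed.

Lemma ln_br_bracket n X X' x : 1 <= x <= 3 -> (B <= X)%BZ -> IZR X <= IZR B * x <= IZR X' ->
  IZR (ln_br n X X').1 <= IZR B * ln x <= IZR (ln_br n X X').2.
Proof.
move=> x_b BX hX; have B32 := B_ge32; have BXr := IZR_le _ _ BX.
pose z := IZR X / IZR B; have zE : IZR B * z = IZR X by rewrite /z; field; lra.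
have z1 : 1 <= z by apply: (Rmult_le_reg_l (IZR B)); lra.
have zx : z <= x by apply: (Rmult_le_reg_l (IZR B)); lra.
have z_b : 1 <= z <= 3 by lra.
have [lo hi] := ln_br_le n X' z_b BX zE.
have ln_zx : ln z <= ln x by apply: ln_le; lra.
have ln_xz : ln x <= ln z + (x - z).
  have -> : x = z * (x / z) by field; lra.
  have q0 : 0 < x / z by apply: Rdiv_lt_0_compat; lra.
  rewrite ln_mult; [|lra|exact: q0]; have := exp_ineq1_le (ln (x / z)); rewrite exp_ln //.
  have -> : z * (x / z) = x by field; lra.
  suff : x / z - 1 <= x - z by lra.
  have -> : x / z - 1 = (x - z) * / z by field; lra.
  have : / z <= 1 by rewrite -Rinv_1; apply: Rinv_le_contravar; lra.
  by nra.
split; first by apply: Rle_trans lo _; apply: Rmult_le_compat_l; lra.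
have : IZR B * ln x <= IZR B * (ln z + (x - z)) by apply: Rmult_le_compat_l; lra.
by lra.
Qed.

End FixedPoint.

(** * Enclosures of alpha, phi and gam by integer tests *)

Lemma alpha_ge x : 0 <= x -> x * x * x <= x * x + x + 1 -> x <= alpha.
Proof.
move=> x0 hx; apply: Rnot_lt_le => lt_ax; have al := alpha_bounds; have al3 := alpha_cubic.
have : 0 < (x - alpha) * (x * x + (alpha - 1) * x + (alpha * alpha - alpha - 1)).
  by apply: Rmult_lt_0_compat; nra.
have -> : (x - alpha) * (x * x + (alpha - 1) * x + (alpha * alpha - alpha - 1)) =
  x * x * x - x * x - x - 1 by ring [al3].
by lra.
Qed.

Lemma alpha_le x : 0 <= x -> x * x + x + 1 <= x * x * x -> alpha <= x.
Proof.
move=> x0 hx; apply: Rnot_lt_le => lt_ax; have al := alpha_bounds; have al3 := alpha_cubic.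
have : 0 < (alpha - x) * (x * x + (alpha - 1) * x + (alpha * alpha - alpha - 1)).
  by apply: Rmult_lt_0_compat; nra.
have -> : (alpha - x) * (x * x + (alpha - 1) * x + (alpha * alpha - alpha - 1)) =
  - (x * x * x - x * x - x - 1) by ring [al3].
by lra.
Qed.

Lemma phi_ge x : 0 <= x -> x * x <= x + 1 -> x <= phi.
Proof. by have := phi_bounds; have := phi_quadratic; nra. Qed.
Lemma phi_le x : 0 <= x -> x + 1 <= x * x -> phi <= x.
Proof. by have := phi_bounds; have := phi_quadratic; nra. Qed.

Definition cubic_below (B A : Z) := (A * A * A <=? A * A * B + A * B * B + B * B * B)%BZ.
Definition cubic_above (B A : Z) := (A * A * B + A * B * B + B * B * B <=? A * A * A)%BZ.
Definition quadr_below (B A : Z) := (A * A <=? A * B + B * B)%BZ.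
Definition quadr_above (B A : Z) := (A * B + B * B <=? A * A)%BZ.

Section Scaled.
Variables (B A : Z).
Hypothesis (B_gt0 : 0 < IZR B) (A_ge0 : (0 <= A)%BZ).

Let x := IZR A / IZR B.
Let AE : IZR A = IZR B * x. Proof. by rewrite /x; field; lra. Qed.
Let x_ge0 : 0 <= x.
Proof. by apply: Rmult_le_pos; [exact: IZR_le | exact/Rlt_le/Rinv_0_lt_compat]. Qed.
Let B3 : 0 < IZR B * IZR B * IZR B. Proof. by repeat apply: Rmult_lt_0_compat. Qed.
Let B2 : 0 < IZR B * IZR B. Proof. by repeat apply: Rmult_lt_0_compat. Qed.

Lemma cubic_below_le : is_true (cubic_below B A) -> IZR A <= IZR B * alpha.
Proof.
move/Z.leb_le/IZR_le; rewrite !(plus_IZR, mult_IZR) AE => h.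
apply: Rmult_le_compat_l (Rlt_le _ _ B_gt0) _; apply: alpha_ge => //.
by apply: (Rmult_le_reg_l (IZR B * IZR B * IZR B)) => //; lra.
Qed.

Lemma cubic_above_ge : is_true (cubic_above B A) -> IZR B * alpha <= IZR A.
Proof.
move/Z.leb_le/IZR_le; rewrite !(plus_IZR, mult_IZR) AE => h.
apply: Rmult_le_compat_l (Rlt_le _ _ B_gt0) _; apply: alpha_le => //.
by apply: (Rmult_le_reg_l (IZR B * IZR B * IZR B)) => //; lra.
Qed.

Lemma quadr_below_le : is_true (quadr_below B A) -> IZR A <= IZR B * phi.
Proof.
move/Z.leb_le/IZR_le; rewrite !(plus_IZR, mult_IZR) AE => h.
apply: Rmult_le_compat_l (Rlt_le _ _ B_gt0) _; apply: phi_ge => //.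
by apply: (Rmult_le_reg_l (IZR B * IZR B)) => //; lra.
Qed.

Lemma quadr_above_ge : is_true (quadr_above B A) -> IZR B * phi <= IZR A.
Proof.
move/Z.leb_le/IZR_le; rewrite !(plus_IZR, mult_IZR) AE => h.
apply: Rmult_le_compat_l (Rlt_le _ _ B_gt0) _; apply: phi_le => //.
by apply: (Rmult_le_reg_l (IZR B * IZR B)) => //; lra.
Qed.
End Scaled.

Definition bracket (B lo hi : Z) (x : R) := IZR lo <= IZR B * x <= IZR hi.

Definition gam_lo (B A : Z) := (4 * A - B - ((A + 1) * (A + 1) / B + 1))%BZ.
Definition gam_hi (B A : Z) := (4 * (A + 1) - B - A * A / B)%BZ.

Lemma gam_bracket B A : 0 < IZR B -> (0 <= A)%BZ -> bracket B A (A + 1) alpha ->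
  bracket B (gam_lo B A) (gam_hi B A) gam.
Proof.
move=> B0 A0 [h1 h2]; have B0' : (0 < B)%BZ by apply: lt_IZR.
have A0r : 0 <= IZR A by apply: IZR_le.
have al := alpha_gt0.
rewrite /bracket /gam_lo /gam_hi /gam !(minus_IZR, plus_IZR, mult_IZR).
have d1 := div_ge ((A + 1) * (A + 1)) B0'; have d2 := div_le (A * A) B0'.
rewrite mult_IZR in d1; rewrite mult_IZR in d2.
have e1 : IZR B * (alpha * alpha) <= IZR (A + 1)%BZ * IZR (A + 1)%BZ / IZR B.
  apply: (Rmult_le_reg_r (IZR B)) => //.
  have -> : IZR (A + 1)%BZ * IZR (A + 1)%BZ / IZR B * IZR B = IZR (A + 1)%BZ * IZR (A + 1)%BZ by field; lra.
  have -> : IZR B * (alpha * alpha) * IZR B = (IZR B * alpha) * (IZR B * alpha) by ring.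
  by apply: Rmult_le_compat => //; apply: Rmult_le_pos; lra.
have e2 : IZR A * IZR A / IZR B <= IZR B * (alpha * alpha).
  apply: (Rmult_le_reg_r (IZR B)) => //.
  have -> : IZR A * IZR A / IZR B * IZR B = IZR A * IZR A by field; lra.
  have -> : IZR B * (alpha * alpha) * IZR B = (IZR B * alpha) * (IZR B * alpha) by ring.
  by apply: Rmult_le_compat.
by rewrite plus_IZR in h2; lra.
Qed.

(** At the common scale, eta bounds |q a - p f| and z is the candidate for the floor of q c / f. The
    last two tests keep q c at distance at least E + K0 eta from z f and (z + 1) f, hence from every
    multiple of f. *)
Definition reduction_ok (alo ahi flo fhi clo chi p q K0 E : Z) : bool :=
  let eta := Z.max (q * ahi - p * flo) (p * fhi - q * alo) in
  let z := (q * clo / fhi)%BZ in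
  [&& (0 <=? z)%BZ, (0 <? q)%BZ, (0 <=? p)%BZ, (z * fhi + E + K0 * eta <=? q * clo)%BZ &
      (q * chi + E + K0 * eta <=? (z + 1) * flo)%BZ].

(* Baker-Davenport: if q c stays away from the multiples of f while
   q a is close to p f, then k a - n f - c cannot be small for k <= K0. *)
Lemma reduction_sound B alo ahi flo fhi clo chi p q K0 E (a f c : R) (k n : Z) :
  0 < IZR B -> 0 < f -> bracket B alo ahi a -> bracket B flo fhi f -> bracket B clo chi c ->
  is_true (reduction_ok alo ahi flo fhi clo chi p q K0 E) -> (0 <= k <= K0)%BZ ->
  IZR E <= IZR B * IZR q * Rabs (IZR k * a - IZR n * f - c).
Proof.
move=> B0 f0 [a1 a2] [f1 f2] [c1 c2] /and5P[/Z.leb_le z0 /Z.ltb_lt q0 /Z.leb_le p0].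
move=> /Z.leb_le/IZR_le lo /Z.leb_le/IZR_le hi [k0 kK].
set eta := Z.max _ _ in lo hi; set z := (q * clo / fhi)%BZ in z0 lo hi.
have q0r : 0 < IZR q by apply: IZR_lt.
have p0r : 0 <= IZR p by apply: IZR_le.
have z0r : 0 <= IZR z by apply: IZR_le.
have k0r : 0 <= IZR k by apply: IZR_le.
have kKr : IZR k <= IZR K0 by apply: IZR_le.
pose D := IZR B * (IZR q * a - IZR p * f).
have hD : Rabs D <= IZR eta.
  have h1 : IZR q * IZR ahi - IZR p * IZR flo <= IZR eta.
    by rewrite -!mult_IZR -minus_IZR; apply: IZR_le; apply: Z.le_max_l.
  have h2 : IZR p * IZR fhi - IZR q * IZR alo <= IZR eta.
    by rewrite -!mult_IZR -minus_IZR; apply: IZR_le; apply: Z.le_max_r.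
  have m1 := Rmult_le_compat_l _ _ _ (Rlt_le _ _ q0r) a1.
  have m2 := Rmult_le_compat_l _ _ _ (Rlt_le _ _ q0r) a2.
  have m3 := Rmult_le_compat_l _ _ _ p0r f1.
  have m4 := Rmult_le_compat_l _ _ _ p0r f2.
  by rewrite /D; apply: Rabs_le; split; lra.
have eta0 : 0 <= IZR eta by apply: Rle_trans hD; exact: Rabs_pos.
have hkD : Rabs (IZR k * D) <= IZR K0 * IZR eta.
  rewrite Rabs_mult (Rabs_pos_eq (IZR k)) //.
  by apply: Rmult_le_compat => //; exact: Rabs_pos.
have mc1 := Rmult_le_compat_l _ _ _ (Rlt_le _ _ q0r) c1.
have mc2 := Rmult_le_compat_l _ _ _ (Rlt_le _ _ q0r) c2.
rewrite !(plus_IZR, mult_IZR) in lo; rewrite !(plus_IZR, mult_IZR) in hi.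
(* The decomposition used is q (k a - n f - c) = (k p - q n) f - q c + k (q a - p f), where the last
   term is at most K0 eta. *)
have key : IZR E + IZR K0 * IZR eta <=
    Rabs (IZR B * (IZR (k * p - q * n)%BZ * f - IZR q * c)).
  have [le_wz|ge_wz] : (k * p - q * n <= z)%BZ \/ (z + 1 <= k * p - q * n)%BZ by lia.
    have wz := IZR_le _ _ le_wz.
    have h1 : IZR (k * p - q * n) * (IZR B * f) <= IZR z * (IZR B * f).
      by apply: Rmult_le_compat_r => //; apply: Rmult_le_pos; lra.
    have h2 : IZR z * (IZR B * f) <= IZR z * IZR fhi by apply: Rmult_le_compat_l.
    by rewrite -Rabs_Ropp; apply: Rle_trans (Rle_abs _); lra.
  have wz := IZR_le _ _ ge_wz; rewrite plus_IZR in wz.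
  have h1 : (IZR z + 1) * (IZR B * f) <= IZR (k * p - q * n) * (IZR B * f).
    by apply: Rmult_le_compat_r => //; apply: Rmult_le_pos; lra.
  have h2 : (IZR z + 1) * IZR flo <= (IZR z + 1) * (IZR B * f) by apply: Rmult_le_compat_l; lra.
  by apply: Rle_trans (Rle_abs _); lra.
have -> : IZR B * IZR q * Rabs (IZR k * a - IZR n * f - c) =
  Rabs (IZR B * (IZR (k * p - q * n)%BZ * f - IZR q * c) - - (IZR k * D)).
  rewrite -{1}(Rabs_pos_eq (IZR B * IZR q)); last by apply: Rmult_le_pos; lra.
  by rewrite -Rabs_mult /D minus_IZR !mult_IZR; congr Rabs; ring.
apply: Rle_trans (Rabs_triang_inv _ _); rewrite Rabs_Ropp; lra.
Qed.

Fixpoint lucasZ (n : nat) : Z * Z :=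
  if n is n'.+1 then let: (x, y) := lucasZ n' in (y, (x + y)%BZ) else (2, 1)%BZ.

Lemma lucasZE n : INR (lucas n) = IZR (fst (lucasZ n)).
Proof.
have [] : INR (lucas n) = IZR (fst (lucasZ n)) /\ INR (lucas n.+1) = IZR (snd (lucasZ n)); last by [].
elim: n => [|n [IH1 IH2]]; first by split.
rewrite lucas_rec INR_add IH1 IH2 [lucasZ n.+1]/=; case: (lucasZ n) => x y /=.
by rewrite plus_IZR; split=> //; ring.
Qed.

Lemma phi_pow_ge n : IZR (fst (lucasZ n)) - 1 <= phi ^ n.
Proof.
rewrite -lucasZE lucas_binet; have := psi_pow n; have := Rle_abs (psi ^ n).
have : 1 <= phi ^ n by apply: pow_R1_Rle; have := phi_bounds; lra.
move=> h1 h2 h3; have : / phi ^ n <= / 1 by apply: Rinv_le_contravar; lra.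
by rewrite Rinv_1; lra.
Qed.

(* [alpha_lit] and [phi_lit] are alpha and phi scaled by 2^740; the fractions
   p_i / q_i are convergents of ln alpha / ln phi, and K_i are a priori bounds for k. *)
Definition alpha_lit := 10637663172181883657291655710922742081535578179451186518070796729384241625653793347401363865706971457796126888423158179418569657267532590379004389895587622231817559374725590664841658611122181660278734521148802108852999026252%BZ.
Definition phi_lit := 9358029967142989831891102771692538405922775091595579742494362268655200260299018717874472259024800475920618269751090945023393198771551728474074715112357053285847766115818312275031606661980329909661722578230051708044538072271%BZ.
Definition p0 := 56950039296510105421880884078114793781544999690746679275097462093994535163561536154240318361689522271422009%BZ.
Definition q0 := 44972149451844503960265951749558698622568968316158562425641004326641721213702151062474610327291092659283199%BZ.
Definition K0 := 2513591020597117427270673922657593917049570264605120251913019099036382988163320701441767361252437135876522%BZ.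
Definition p1 := 3053262545257039393434066430568945%BZ.
Definition q1 := 2411091918411251662400920206547266%BZ.
Definition p2 := 452544523220541439982411039079661113%BZ.
Definition q2 := 357364106913532334879636629737733870%BZ.
Definition K1 := 101047872605522083891140766643716%BZ.

Definition approx_ok (B A F : Z) : bool :=
  [&& (B <=? A)%BZ, (B <=? F)%BZ, (B <=? gam_lo B A)%BZ, cubic_below B A,
      cubic_above B (A + 1)%BZ, quadr_below B F & quadr_above B (F + 1)%BZ].

(** Only an enclosure [A, A + 1] matters, so this serves for ln phi as well. *)
Definition lalpha_br (s : Z) n A := ln_br s n A (A + 1)%BZ.
Definition lgam_br (s : Z) n A :=
  ln_br s n (gam_lo (2 ^ s)%BZ A) (gam_hi (2 ^ s)%BZ A).

Section Brackets.
Variables (s A F : Z) (n : nat).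
Hypothesis s_ge5 : (5 <= s)%BZ.
Let B := (2 ^ s)%BZ.
Hypothesis ok : is_true (approx_ok B A F).
Let B0 : 0 < IZR B. Proof. exact: B_gt0 s_ge5. Qed.

Lemma scale_ge0 x : (B <= x)%BZ -> (0 <= x)%BZ.
Proof. by have : (0 < B)%BZ by [apply: lt_IZR]; lia. Qed.

Lemma alpha_bracket : bracket B A (A + 1)%BZ alpha.
Proof.
move: ok => /and5P[/Z.leb_le h1 _ _ h4 /andP[h5 _]].
have A0 := scale_ge0 h1.
by split; [apply: cubic_below_le | apply: cubic_above_ge => //; lia].
Qed.

Lemma phi_bracket : bracket B F (F + 1)%BZ phi.
Proof.
move: ok => /and5P[_ /Z.leb_le h2 _ _ /and3P[_ h6 h7]].
have F0 := scale_ge0 h2.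
by split; [apply: quadr_below_le | apply: quadr_above_ge => //; lia].
Qed.

Lemma lalpha_bracket : bracket B (lalpha_br s n A).1 (lalpha_br s n A).2 lalpha.
Proof.
have [h1 h2] := alpha_bracket; have al := alpha_bounds.
move: (ok) => /and5P[/Z.leb_le BA _ _ _ _].
by apply: ln_br_bracket => //; lra.
Qed.

Lemma lphi_bracket : bracket B (lalpha_br s n F).1 (lalpha_br s n F).2 lphi.
Proof.
have [h1 h2] := phi_bracket; have ph := phi_bounds.
move: (ok) => /and5P[_ /Z.leb_le BF _ _ _].
by apply: ln_br_bracket => //; lra.
Qed.

Lemma lgam_bracket : bracket B (lgam_br s n A).1 (lgam_br s n A).2 (ln gam).
Proof.
move: (ok) => /and5P[/Z.leb_le BA _ /Z.leb_le BG _ _].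
have [h1 h2] := gam_bracket B0 (scale_ge0 BA) alpha_bracket; have gb := gam_bounds.
by apply: ln_br_bracket => //; lra.
Qed.

End Brackets.

Definition reduction1_ok (s : Z) n A F p q K E : bool :=
  let: (alo, ahi) := lalpha_br s n A in let: (flo, fhi) := lalpha_br s n F in
  let: (glo, ghi) := lgam_br s n A in
  approx_ok (2 ^ s)%BZ A F && reduction_ok alo ahi flo fhi glo ghi p q K E.

(** The reduction bounds the form below by E / (2^s q), which beats 6 phi^(-2m) as soon as m > M.
    Bounding phi^j below by L_j - 1 makes this comparison an integer test. *)
Lemma reduction1_bound s n A F p q K E M k N m : (5 <= s)%BZ ->
  is_true (reduction1_ok s n A F p q K E) ->
  is_true (6 * (2 ^ s * q) <? E * (fst (lucasZ (2 * M.+1)) - 1))%BZ ->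
  (Z.of_nat k <= K)%BZ ->
  Rabs (ln gam - INR k * lalpha + INR N * lphi) <= 6 * exp (- (2 * INR m * lphi)) ->
  (m <= M)%N.
Proof.
move=> s0 ok /Z.ltb_lt lt_E kK le_lin; rewrite leqNgt; apply/negP => lt_Mm.
move: ok; rewrite /reduction1_ok.
case ea: (lalpha_br s n A) => [alo ahi]; case ef: (lalpha_br s n F) => [flo fhi].
case eg: (lgam_br s n A) => [glo ghi] /andP[ok red].
have ba := lalpha_bracket n s0 ok; have bf := lphi_bracket n s0 ok.
have bg := lgam_bracket n s0 ok; rewrite ea ef eg /= in ba bf bg.
have B0 := B_gt0 s0; have lf := lphi_bounds; have lf0 : 0 < lphi by lra.
have q0 : 0 < IZR q by move: (red) => /and5P[_ /Z.ltb_lt ? _ _ _]; apply: IZR_lt.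
have := reduction_sound (k := Z.of_nat k) (Z.of_nat N) B0 lf0 ba bf bg red (conj (Zle_0_nat k) kK).
rewrite -!INR_IZR_INZ -[Rabs (_ - ln gam)]Rabs_Ropp.
have -> : - (INR k * lalpha - INR N * lphi - ln gam) = ln gam - INR k * lalpha + INR N * lphi by ring.
have Bq0 := Rmult_lt_0_compat _ _ B0 q0.
have e_eq : exp (- (2 * INR m * lphi)) = / phi ^ (2 * m).
  by rewrite exp_Ropp phi_pow_exp INR_mul.
rewrite e_eq in le_lin => hE.
have ph := phi_bounds.
have f2 : phi ^ (2 * M.+1) <= phi ^ (2 * m).
  by apply: Rle_pow; [lra | apply/ssrnat.leP; rewrite leq_mul2l].
have fl := phi_pow_ge (2 * M.+1); have fp := pow_lt _ (2 * m) phi_gt0.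
have hE2 : IZR E * phi ^ (2 * m) <= 6 * (IZR (2 ^ s)%BZ * IZR q).
  apply: Rle_trans (_ : IZR (2 ^ s)%BZ * IZR q * (6 * / phi ^ (2 * m)) * phi ^ (2 * m) <= _).
    apply: Rmult_le_compat_r; first lra.
    by apply: Rle_trans hE _; apply: Rmult_le_compat_l; lra.
  by apply: Req_le; field; lra.
have := IZR_lt _ _ lt_E; rewrite !mult_IZR minus_IZR => lt_Er.
have E0 : 0 <= IZR E \/ IZR E < 0 by lra.
have lM : 1 <= IZR (fst (lucasZ (2 * M.+1))) by rewrite -lucasZE; exact: lucas_ge1.
case: E0 => E0; last by nra.
have : IZR E * (IZR (fst (lucasZ (2 * M.+1))) - 1) <= IZR E * phi ^ (2 * m).
  by apply: Rmult_le_compat_l; lra.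
by lra.
Qed.

Definition alpha_lit2 := Z.shiftr alpha_lit 480.
Definition phi_lit2 := Z.shiftr phi_lit 480.

(** K0 q0 is about 2^704, and ln alpha and ln phi are needed to more bits than that: 205 terms with
    y about 0.296 for alpha leave a tail near 2^(-722). For ln gam, where y is about 0.497, accuracy
    well below 1 / q0 is enough. As q0 is about 18 K0, the term k (q a - p f) stays small against
    the certified distance 1 / 8. *)
Lemma reduction1_first : is_true (reduction1_ok 740 205 alpha_lit phi_lit p0 q0 K0 (2 ^ 737)).
Proof. by vm_cast_no_check (erefl true). Qed.
Lemma reduction1_second :
  is_true (reduction1_ok 260 72 alpha_lit2 phi_lit2 p1 q1 K1 (2 ^ 257)).
Proof. by vm_cast_no_check (erefl true). Qed.

Lemma bound_m_first k N m : (Z.of_nat k <= K0)%BZ ->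
  Rabs (ln gam - INR k * lalpha + INR N * lphi) <= 6 * exp (- (2 * INR m * lphi)) ->
  (m <= 262)%N.
Proof. by apply: reduction1_bound reduction1_first _; vm_compute. Qed.

Lemma bound_m_second k N m : (Z.of_nat k <= K1)%BZ ->
  Rabs (ln gam - INR k * lalpha + INR N * lphi) <= 6 * exp (- (2 * INR m * lphi)) ->
  (m <= 86)%N.
Proof. by apply: reduction1_bound reduction1_second _; vm_compute. Qed.

(** * Reduction of the form in ln (gam L_m), one m after the other *)

Definition phi_sqr_inv := 2 - phi.

Lemma lucas_factor m :
  INR (lucas m) = phi ^ m * (1 + (if odd m then -1 else 1) * phi_sqr_inv ^ m).
Proof.
rewrite lucas_binet Rmult_plus_distr_l Rmult_1_r; congr (_ + _).
have -> : phi ^ m * ((if odd m then -1 else 1) * phi_sqr_inv ^ m) =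
    (if odd m then -1 else 1) * (phi * phi_sqr_inv) ^ m.
  by rewrite Rpow_mult_distr; ring.
have -> : phi * phi_sqr_inv = - psi.
  by rewrite /psi /phi_sqr_inv; have := phi_quadratic; lra.
elim: m => [|m IHm] /=; first ring.
by rewrite IHm; case: (odd m) => /=; ring.
Qed.

(** For odd m the factor 1 - phi^(-2m) is below 1, whereas [ln_br_bracket] asks for arguments
    between 1 and 3; hence the inverse. *)
Definition corr (m : nat) : R :=
  if odd m then - ln (/ (1 - phi_sqr_inv ^ m)) else ln (1 + phi_sqr_inv ^ m).

Lemma phi_sqr_inv_pow m : (0 < m)%N -> 0 < phi_sqr_inv ^ m <= 0.3821.
Proof.
move=> m0; have ph := phi_bounds; rewrite /phi_sqr_inv; split; first by apply: pow_lt; lra.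
case: m m0 => // m _; rewrite -tech_pow_Rmult.
have h1 : 0 <= (2 - phi) ^ m by apply: pow_le; lra.
have h2 : (2 - phi) ^ m <= 1 ^ m by apply: pow_incr; lra.
by rewrite pow1 in h2; nra.
Qed.

(** The multiple m ln phi can be moved into the coefficient of ln phi, which is arbitrary in
    [reduction_sound]. The constant c is then ln gam + corr m, so only the small correction has to
    be enclosed anew for each m. *)
Lemma ln_gam_lucas m : (0 < m)%N ->
  ln (gam * INR (lucas m)) = ln gam + INR m * lphi + corr m.
Proof.
move=> m0; have [d0 d1] := phi_sqr_inv_pow m0; have gb := gam_bounds.
have fm := pow_lt _ m phi_gt0; rewrite /corr; case: (boolP (odd m)) => om.
  rewrite lucas_factor om (_ : 1 + -1 * phi_sqr_inv ^ m = 1 - phi_sqr_inv ^ m); last by ring.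
  rewrite !ln_mult ?ln_pow //; try exact: phi_gt0; try lra;
    try by apply: Rmult_lt_0_compat; lra.
  by rewrite ln_Rinv /lphi; [ring | lra].
rewrite lucas_factor (negbTE om) Rmult_1_l !ln_mult ?ln_pow //; try exact: phi_gt0; try lra;
  try by apply: Rmult_lt_0_compat; lra.
by rewrite /lphi; ring.
Qed.

Section Loop.
Variables (s F glo ghi alo ahi flo fhi p q K E : Z).
Hypothesis s_ge5 : (5 <= s)%BZ.
Let B := (2 ^ s)%BZ.

(** The argument of the artanh series is at most phi^(-2m-1) <= 2^(-m-1), so about 130 / (m + 1)
    terms reach 260 bits. *)
Definition corr_br (m : nat) (dlo dhi : Z) : Z * Z :=
  let n := (130 %/ m.+1).+2 in
  if odd m then
    let: (lo, hi) := ln_br s n (B * B / (B - dlo)) (B * B / (B - dhi) + 1)%BZ in (- hi, - lo)%BZ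
  else ln_br s n (B + dlo)%BZ (B + dhi)%BZ.

Fixpoint loop_ok (fuel m : nat) (dlo dhi : Z) : bool :=
  if fuel is fuel'.+1 then
    let: (clo, chi) := corr_br m dlo dhi in
    [&& (0 <=? dlo)%BZ, (dhi <? B)%BZ,
     reduction_ok alo ahi flo fhi (glo + clo) (ghi + chi) p q K E &
     loop_ok fuel' m.+1 (Z.shiftr (dlo * (B + B - (F + 1))) s)%BZ
       (Z.shiftr (dhi * (B + B - F)) s + 1)%BZ]
  else true.

Hypothesis ok_F : bracket B F (F + 1)%BZ phi.
Hypothesis F_ge0 : (0 <= B + B - (F + 1))%BZ.
Hypothesis ba : bracket B alo ahi lalpha.
Hypothesis bf : bracket B flo fhi lphi.
Hypothesis bg : bracket B glo ghi (ln gam).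

Lemma corr_bracket m dlo dhi : (0 < m)%N -> (0 <= dlo)%BZ -> (dhi < B)%BZ ->
  bracket B dlo dhi (phi_sqr_inv ^ m) ->
  bracket B (corr_br m dlo dhi).1 (corr_br m dlo dhi).2 (corr m).
Proof.
move=> m0 dlo0 dhiB [h1 h2]; have [d0 d1] := phi_sqr_inv_pow m0.
have B0 := B_gt0 s_ge5; rewrite -/B in B0.
rewrite /corr_br /corr; set n := (_ %/ _).+2; case: ifP => om /=; last first.
  by apply: ln_br_bracket => //; rewrite -/B ?plus_IZR; [lra | lia | lra].
have x_b : 1 <= / (1 - phi_sqr_inv ^ m) <= 3.
  split; [rewrite -{1}Rinv_1 | rewrite -(Rinv_inv 3)]; apply: Rinv_le_contravar; lra.
have dloB : (dlo < B)%BZ by apply: lt_IZR; nra.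
have E1 : IZR B * / (1 - phi_sqr_inv ^ m) = IZR B * IZR B / (IZR B * (1 - phi_sqr_inv ^ m)).
  by field; lra.
have dloBr := IZR_lt _ _ dloB; have dhiBr := IZR_lt _ _ dhiB.
have lo : IZR (B * B / (B - dlo))%BZ <= IZR B * / (1 - phi_sqr_inv ^ m).
  apply: Rle_trans (div_le _ _) _; first lia.
  rewrite E1 mult_IZR minus_IZR /Rdiv; apply: Rmult_le_compat_l; first nra.
  by apply: Rinv_le_contravar; [nra | lra].
have hi : IZR B * / (1 - phi_sqr_inv ^ m) <= IZR (B * B / (B - dhi) + 1)%BZ.
  rewrite plus_IZR; apply: Rle_trans (div_ge _ _); last lia.
  rewrite E1 mult_IZR minus_IZR /Rdiv; apply: Rmult_le_compat_l; first nra.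
  by apply: Rinv_le_contravar; [lra | lra].
have BX : (B <= B * B / (B - dlo))%BZ.
  have B0' : (0 < B)%BZ by apply: lt_IZR.
  have dB := Z.mul_nonneg_nonneg _ _ dlo0 (Z.lt_le_incl _ _ B0').
  by apply: Z.div_le_lower_bound; lia.
have := ln_br_bracket s_ge5 n x_b BX (conj lo hi); case: (ln_br _ _ _ _) => lo' hi' /=.
by rewrite /bracket !opp_IZR -/B; lra.
Qed.

Lemma loop_sound fuel m dlo dhi k N : (0 < m)%N -> is_true (loop_ok fuel m dlo dhi) ->
  bracket B dlo dhi (phi_sqr_inv ^ m) -> (Z.of_nat k <= K)%BZ ->
  forall j, (m <= j < m + fuel)%N ->
  IZR E <= IZR B * IZR q * Rabs (INR k * lalpha - INR N * lphi - (ln gam + corr j)).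
Proof.
have B0 := B_gt0 s_ge5; rewrite -/B in B0; have lf := lphi_bounds.
move=> m0 + + kK; elim: fuel m dlo dhi m0 => [|fuel IH] m dlo dhi m0.
  by move=> _ _ j; rewrite addn0 => /andP[/leq_ltn_trans h /h]; rewrite ltnn.
rewrite [loop_ok _ _ _ _]/=; case ec: (corr_br m dlo dhi) => [clo chi].
case/and4P => /Z.leb_le dlo0 /Z.ltb_lt dhiB red ok_rest br j.
have := corr_bracket m0 dlo0 dhiB br; rewrite ec /= => bc.
rewrite leq_eqVlt andb_orl => /orP[/andP[/eqP <- _]|/andP[lt_mj lt_j]].
  have bgc : bracket B (glo + clo) (ghi + chi) (ln gam + corr m).
    by move: bg bc; rewrite /bracket !plus_IZR; lra.
  have lf0 : 0 < lphi by lra.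
  have := reduction_sound (k := Z.of_nat k) (Z.of_nat N) B0 lf0 ba bf bgc red (conj (Zle_0_nat k) kK).
  by rewrite -!INR_IZR_INZ.
apply: (IH m.+1 _ _ _ ok_rest) => //; last by rewrite addSnnS lt_mj.
have [d0 d1] := phi_sqr_inv_pow m0; have [b1 b2] := br; have [f1 f2] := ok_F.
have ph := phi_bounds.
rewrite plus_IZR in f2.
have -> : phi_sqr_inv ^ m.+1 = phi_sqr_inv ^ m * phi_sqr_inv by rewrite /= Rmult_comm.
have psi0 : 0 <= phi_sqr_inv by rewrite /phi_sqr_inv; lra.
split; [apply: mul_shift_le | apply: mul_shift_ge] => //; try lra;
  rewrite ?minus_IZR ?plus_IZR -/B /phi_sqr_inv; lra.
Qed.
End Loop.

Definition reduction2_ok (s : Z) n A F p q K E M : bool :=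
  let: (alo, ahi) := lalpha_br s n A in let: (flo, fhi) := lalpha_br s n F in
  let: (glo, ghi) := lgam_br s n A in
  [&& approx_ok (2 ^ s)%BZ A F, (0 <=? 2 ^ s + 2 ^ s - (F + 1))%BZ &
  loop_ok s F glo ghi alo ahi flo fhi p q K E M 1
    (2 ^ s + 2 ^ s - (F + 1))%BZ (2 ^ s + 2 ^ s - F)%BZ].

Lemma reduction2_bound s n A F p q K E M T k m N : (5 <= s)%BZ ->
  is_true (reduction2_ok s n A F p q K E M) -> (0 <? q)%BZ ->
  is_true (3 * (2 ^ s * q) <? E * (fst (lucasZ T.+1) - 1))%BZ ->
  (Z.of_nat k <= K)%BZ -> (0 < m <= M)%N ->
  Rabs (ln (gam * INR (lucas m)) - INR k * lalpha + INR N * lphi) <= 3 * exp (- (INR N * lphi)) ->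
  (N <= T)%N.
Proof.
move=> s0 ok /Z.ltb_lt q0' /Z.ltb_lt lt_E kK /andP[m0 mM] le_lin.
rewrite leqNgt; apply/negP => lt_TN; move: ok; rewrite /reduction2_ok.
case ea: (lalpha_br s n A) => [alo ahi]; case ef: (lalpha_br s n F) => [flo fhi].
case eg: (lgam_br s n A) => [glo ghi] /and3P[ok /Z.leb_le F0 lok].
have ba := lalpha_bracket n s0 ok; have bf := lphi_bracket n s0 ok.
have bg := lgam_bracket n s0 ok; rewrite ea ef eg /= in ba bf bg.
have bF := phi_bracket s0 ok; have B0 := B_gt0 s0.
have q0 : 0 < IZR q by apply: IZR_lt.
have b1 : bracket (2 ^ s)%BZ (2 ^ s + 2 ^ s - (F + 1))%BZ (2 ^ s + 2 ^ s - F)%BZ (phi_sqr_inv ^ 1).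
  move: bF; rewrite /bracket !minus_IZR !plus_IZR /phi_sqr_inv pow_1; lra.
have m_in : (1 <= m < 1 + M)%N by rewrite m0 add1n ltnS.
have hE := loop_sound s0 bF F0 ba bf bg (k := k) (m := 1%N) (N + m) isT lok b1 kK m_in.
have E_eq : Rabs (INR k * lalpha - INR (N + m) * lphi - (ln gam + corr m)) =
  Rabs (ln (gam * INR (lucas m)) - INR k * lalpha + INR N * lphi).
  by rewrite ln_gam_lucas // INR_add -Rabs_Ropp; congr Rabs; ring.
rewrite E_eq in hE.
have Bq0 := Rmult_lt_0_compat _ _ B0 q0; have ph := phi_bounds.
rewrite exp_Ropp -phi_pow_exp in le_lin.
have f2 : phi ^ T.+1 <= phi ^ N by apply: Rle_pow; [lra | apply/ssrnat.leP].
have fl := phi_pow_ge T.+1; have fp := pow_lt _ N phi_gt0.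
have hE2 : IZR E * phi ^ N <= 3 * (IZR (2 ^ s)%BZ * IZR q).
  apply: Rle_trans (_ : IZR (2 ^ s)%BZ * IZR q * (3 * / phi ^ N) * phi ^ N <= _).
    apply: Rmult_le_compat_r; first lra.
    by apply: Rle_trans hE _; apply: Rmult_le_compat_l; lra.
  by apply: Req_le; field; lra.
have := IZR_lt _ _ lt_E; rewrite !mult_IZR minus_IZR => lt_Er.
have lM : 1 <= IZR (fst (lucasZ T.+1)) by rewrite -lucasZE; exact: lucas_ge1.
have E0 : 0 <= IZR E \/ IZR E < 0 by lra.
case: E0 => E0; last by nra.
have : IZR E * (IZR (fst (lucasZ T.+1)) - 1) <= IZR E * phi ^ N.
  by apply: Rmult_le_compat_l; lra.
by lra.
Qed.

(** One convergent has to serve all m up to 86, so some q c comes rather close to a multiple of f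
    and only the distance 1 / 128 is asked for. To leave room for it, q2 is about 3500 K1. *)
Lemma reduction2_check :
  is_true (reduction2_ok 260 72 alpha_lit2 phi_lit2 p2 q2 K1 (2 ^ 253) 86).
Proof. by vm_cast_no_check (erefl true). Qed.

Lemma bound_n k m n : (Z.of_nat k <= K1)%BZ -> (0 < m <= 86)%N ->
  Rabs (ln (gam * INR (lucas m)) - INR k * lalpha + INR n * lphi) <= 3 * exp (- (INR n * lphi)) ->
  (n <= 185)%N.
Proof. by apply: reduction2_bound reduction2_check _ _; vm_compute. Qed.

(** * Bounds for the indices *)

Lemma bracket_gt B lo hi x (a b : Z) : 0 < IZR B -> 0 < IZR b -> bracket B lo hi x ->
  is_true (a * B <? b * lo)%BZ -> IZR a < IZR b * x.
Proof.
move=> B0 b0 [h _] /Z.ltb_lt/IZR_lt; rewrite !mult_IZR => lt.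
apply: (Rmult_lt_reg_r (IZR B)) => //; apply: Rlt_le_trans lt _.
by have := Rmult_le_compat_l _ _ _ (Rlt_le _ _ b0) h; lra.
Qed.

Lemma bracket_lt B lo hi x (a b : Z) : 0 < IZR B -> 0 < IZR b -> bracket B lo hi x ->
  is_true (b * hi <? a * B)%BZ -> IZR b * x < IZR a.
Proof.
move=> B0 b0 [_ h] /Z.ltb_lt/IZR_lt; rewrite !mult_IZR => lt.
apply: (Rmult_lt_reg_r (IZR B)) => //; apply: Rle_lt_trans lt.
by have := Rmult_le_compat_l _ _ _ (Rlt_le _ _ b0) h; lra.
Qed.

Lemma log_bounds : [/\ 0.609 < lalpha < 0.61, 0.481 < lphi < 0.482 & 1.08 < ln gam < 1.1].
Proof.
have s0 : (5 <= 60)%BZ by [].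
pose A := Z.shiftr alpha_lit 680; pose F := Z.shiftr phi_lit 680.
have ok : is_true (approx_ok (2 ^ 60)%BZ A F) by vm_compute.
have B0 : 0 < IZR (2 ^ 60)%BZ by apply: B_gt0.
have k0 : 0 < IZR 1000 by lra.
have ba := lalpha_bracket 20 s0 ok; have bf := lphi_bracket 20 s0 ok.
have bg := lgam_bracket 20 s0 ok.
have a1 := bracket_gt (a := 609) B0 k0 ba isT; have a2 := bracket_lt (a := 610) B0 k0 ba isT.
have f1 := bracket_gt (a := 481) B0 k0 bf isT; have f2 := bracket_lt (a := 482) B0 k0 bf isT.
have g1 := bracket_gt (a := 1080) B0 k0 bg isT; have g2 := bracket_lt (a := 1100) B0 k0 bg isT.
by split; lra.
Qed.

Lemma nat_floor x : 0 <= x -> exists n, INR n <= x < INR n + 1.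
Proof.
move=> x0; have [h1 h2] := archimed x.
have up0 : (0 < up x)%BZ by apply: lt_IZR; lra.
exists (Z.to_nat (up x - 1)).
rewrite INR_IZR_INZ Z2Nat.id; last lia.
by rewrite minus_IZR; lra.
Qed.

(** The exponential lies above its tangent at v0, whose value and slope there are at least those of
    the line C v. *)
Lemma exp_dominates (c C v v0 : R) : 0 < v0 -> v0 <= v -> 0 <= c -> 0 <= C ->
  C <= exp (c * v0) * c -> C * v0 <= exp (c * v0) -> C * v <= exp (c * v).
Proof.
move=> v00 vv c0 C0 h1 h2.
have -> : c * v = c * v0 + c * (v - v0) by ring.
rewrite exp_plus; have := exp_ineq1_le (c * (v - v0)); have e0 := exp_pos (c * v0).
move: (exp (c * v0)) (exp (c * (v - v0))) e0 h1 h2 => e e' e0 h1 h2 h3.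
apply: Rle_trans (_ : e * (1 + c * (v - v0)) <= _); last by apply: Rmult_le_compat_l; lra.
have : 0 <= (e * c - C) * (v - v0) by apply: Rmult_le_pos; lra.
by lra.
Qed.

Lemma exists_L v : 60 <= v -> exists2 L, 9 * v <= INR L <= 9.1 * v & (100 <= L)%N.
Proof.
move=> v60; have [|n [h1 h2]] := @nat_floor (9 * v); first lra.
exists n.+1; first by rewrite S_INR; lra.
have i100 : INR 100 = 100 by rewrite INR_IZR_INZ.
by apply/INR_leq; rewrite i100 S_INR; lra.
Qed.

(* [three_logs_bound] is applied with L about 9 v and lx = 1.25 v. *)
Lemma log_size_ok (L P k : nat) (v x : R) : 60 <= v -> x = exp (v / 3) ->
  INR L <= 9.1 * v -> INR P <= x -> INR k <= 2 * (x * x * x) ->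
  100 * INR L * (INR k + 2 * INR P) <= exp (1.25 * v).
Proof.
move=> v60 xE L_le P_le k_le.
have e15 : 2.9e6 <= exp (/ 4 * 60).
  apply: Rle_trans (_ : 2.7 ^ 15 <= _); first by rewrite /=; lra.
  by apply: Rle_trans (exp_nat_ge 15) _; apply: exp_incr; rewrite INR_IZR_INZ /=; lra.
have h1 : 3640 * v <= exp (/ 4 * v) by apply: (exp_dominates (v0 := 60)); lra.
have x1 : 1 <= x by rewrite xE -exp_0; apply: exp_incr; lra.
have x3 : exp (1.25 * v) = exp (/ 4 * v) * (x * x * x).
  by rewrite xE -!exp_plus; congr exp; lra.
have xx : x <= x * x * x by nra.
have L0 := pos_INR L; have k0 := pos_INR k; have P0 := pos_INR P.
rewrite x3; apply: Rle_trans (_ : 100 * (9.1 * v) * (4 * (x * x * x)) <= _).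
  by apply: Rmult_le_compat; lra.
apply: Rle_trans (_ : 3640 * v * (x * x * x) <= _); first lra.
by apply: Rmult_le_compat_r; lra.
Qed.

(** P about n^(1/3) balances P^2 and n / P, while a bounded height makes P h negligible. The
    constant 1.54e6 exceeds 1520 * 82.81 * 12.01, where 82.81 = 9.1^2 comes from L and 12.01 from 9
    + 3. *)
Lemma fixed_height_bound (G : ord) (h k n : nat) (v x : R) :
  0 < ev G -> nrm G <= exp (INR h) -> Rabs (ln (ev G)) <= INR h -> INR h <= 300 ->
  (0 < n)%N -> (n <= 2 * k)%N -> (k <= 2 * n)%N -> v = ln (INR n) -> 70 <= v ->
  x = exp (v / 3) ->
  exp (- (1.54e6 * (v * v) * (x * x))) < Rabs (ln (ev G) - INR k * lalpha + INR n * lphi).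
Proof.
move=> g0 nG lG h300 n0 n2k k2n vE v70 xE.
have n0r : 0 < INR n by apply: (INR_ltn 0 n).2.
have x0 : 0 < x by rewrite xE; exact: exp_pos.
have nE : INR n = x * x * x.
  by rewrite xE -!exp_plus (_ : v / 3 + v / 3 + v / 3 = v) ?vE ?exp_ln //; field.
have x_big : 1e9 <= x.
  apply: Rle_trans (_ : 2.7 ^ 23 <= _); first by rewrite /=; lra.
  apply: Rle_trans (exp_nat_ge 23) _; rewrite xE; apply: exp_incr.
  by rewrite INR_IZR_INZ /=; lra.
have [|P [P_le P_gt]] := @nat_floor x; first lra.
have [|L [L_ge L_le] L100] := @exists_L v; first lra.
have k_le : INR k <= 2 * (x * x * x) by rewrite -nE; move/INR_leq: k2n; rewrite INR_mul.
have k_ge : x * x * x <= 2 * INR k by rewrite -nE; move/INR_leq: n2k; rewrite INR_mul.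
have nP : INR n / INR P <= 1.001 * (x * x).
  apply: (Rmult_le_reg_r (INR P)); first lra.
  rewrite /Rdiv Rmult_assoc Rinv_l ?Rmult_1_r ?nE; last lra.
  have : x <= 1.001 * INR P by lra.
  have : 0 <= x * x by nra.
  by nra.
have xx0 : 0 <= x * x by nra.
have P2 : INR P * INR P <= x * x by apply: Rmult_le_compat; lra.
have Ph : INR P * INR h <= 1e-6 * (x * x).
  apply: Rle_trans (_ : x * 300 <= _); first by apply: Rmult_le_compat; try lra; exact: pos_INR.
  by nra.
set M := 3 * INR P * INR h + 9 * (INR P * INR P) + 3 * (INR n / INR P).
have M_le : M <= 12.01 * (x * x) by rewrite /M; lra.
have M_ge : 0 <= M.
  rewrite /M; have := pos_INR h; have : 0 < INR n / INR P by apply: Rdiv_lt_0_compat; lra.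
  by move=> ? ?; have : 0 <= INR P * INR h by [apply: Rmult_le_pos; lra]; nra.
have vx : 6200 * v <= x.
  rewrite xE (_ : v / 3 = / 3 * v); last by field.
  have e20 : 4e8 <= exp (/ 3 * 60).
    apply: Rle_trans (_ : 2.7 ^ 20 <= _); first by rewrite /=; lra.
    by apply: Rle_trans (exp_nat_ge 20) _; apply: exp_incr; rewrite INR_IZR_INZ /=; lra.
  by apply: (exp_dominates (v0 := 60)); lra.
have LL : INR L * INR L <= 82.81 * (v * v).
  have -> : 82.81 * (v * v) = (9.1 * v) * (9.1 * v) by lra.
  by apply: Rmult_le_compat; lra.
apply: Rle_lt_trans (three_logs_bound (P := P) (L := L) (lx := 1.25 * v) g0 nG lG n0 n2k k2n _ L100 _ _ _ _).
- apply: exp_incr; apply: Ropp_le_contravar; rewrite -/M.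
  have : INR L * INR L * M <= 82.81 * (v * v) * (12.01 * (x * x)).
    by apply: Rmult_le_compat => //; nra.
  have : 0 <= v * v * (x * x) by apply: Rmult_le_pos; nra.
  by lra.
- by apply/INR_leq; rewrite [INR 2]/=; lra.
- lra.
- lra.
- by apply: (log_size_ok _ xE) => //; lra.
rewrite -/M; apply: Rle_trans (_ : 28 * (9.1 * v) * (12.01 * (x * x)) <= _).
  by apply: Rmult_le_compat; lra.
by nra.
Qed.

Lemma exp13_ge : 4e5 <= exp 13.
Proof.
apply: Rle_trans (_ : 2.7 ^ 13 <= _); first by rewrite /=; lra.
by apply: Rle_trans (exp_nat_ge 13) _; apply: exp_incr; rewrite INR_IZR_INZ /=; lra.
Qed.

(* With r^2 an upper bound for the height, P about sqrt n / r balances the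
   terms P h and n / P of [three_logs_bound]. *)
Lemma growing_height_bound (G : ord) (h k n : nat) (s v x : R) :
  0 < ev G -> nrm G <= exp (INR h) -> Rabs (ln (ev G)) <= INR h ->
  (0 < n)%N -> (n <= 2 * k)%N -> (k <= 2 * n)%N -> s = exp v -> 240 <= v ->
  x = exp (v / 3) -> INR n <= s <= 2 * INR n ->
  INR h <= (1400 * v * x) * (1400 * v * x) ->
  exp (- (1.07e9 * (v * v * v) * x * sqrt (INR n))) <
    Rabs (ln (ev G) - INR k * lalpha + INR n * lphi) /\
  3.7e9 * (v * v * v) * x <= sqrt (INR n).
Proof.
move=> g0 nG lG n0 n2k k2n sE v240 xE [ns sn] h_le.
have n0r : 0 < INR n by apply: (INR_ltn 0 n).2.
have x0 : 0 < x by rewrite xE; exact: exp_pos.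
have s3 : s = x * x * x by rewrite xE sE -!exp_plus; congr exp; field.
set w := sqrt (INR n); have w0 : 0 < w by apply: sqrt_lt_R0.
have ww : w * w = INR n by apply: sqrt_sqrt; lra.
pose y := exp (v / 6); have y0 : 0 < y by exact: exp_pos.
have yy : y * y = x by rewrite xE /y -exp_plus; congr exp; field.
have y_big : 5.3e9 * (v * v * v) <= y.
  have e18 : 1750 * v <= exp (/ 18 * v).
    have e40 : 5.3e5 <= exp (/ 18 * 240).
      have -> : / 18 * 240 = 13 + 1 / 3 by field.
      rewrite exp_plus; have := exp_ineq1_le (1 / 3); have := exp13_ge.
      by move: (exp 13) (exp (1 / 3)) => a b ha hb; nra.
    by apply: (exp_dominates (v0 := 240)); lra.
  have -> : y = exp (/ 18 * v) * exp (/ 18 * v) * exp (/ 18 * v).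
    by rewrite /y -!exp_plus; congr exp; field.
  have v0 : 0 <= 1750 * v by lra.
  apply: Rle_trans (_ : (1750 * v) * (1750 * v) * (1750 * v) <= _).
    have : 0 <= v * v * v by repeat apply: Rmult_le_pos; lra.
    by lra.
  have h1 : (1750 * v) * (1750 * v) <= exp (/ 18 * v) * exp (/ 18 * v) by apply: Rmult_le_compat.
  by apply: Rmult_le_compat => //; apply: Rmult_le_pos.
have vvv : 1 <= v * v * v by nra.
have w_ge : x * y <= 1.415 * w.
  apply: Rsqr_incr_0_var; last by lra.
  rewrite /Rsqr; have -> : x * y * (x * y) = s by rewrite s3 -yy; ring.
  have -> : 1.415 * w * (1.415 * w) = 2.002225 * (w * w) by lra.
  by rewrite ww; lra.
have vv0 : 1 <= v * v by nra.
have w_big : 3.7e9 * (v * v * v) * x <= w.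
  have : x * (5.3e9 * (v * v * v)) <= x * y by apply: Rmult_le_compat_l; lra.
  have : 0 <= v * v * v * x by apply: Rmult_le_pos; lra.
  by lra.
split=> //.
(* In the application r^2 = 1.96e6 v^2 x^2 has to exceed m + 4, where the form in ln gam yields m <=
   1.61e6 v^2 x^2. That form involves m + n, so v and x are computed from s rather than from n. *)
pose r := 1400 * v * x; have r0 : 0 < r by apply: Rmult_lt_0_compat; lra.
have rw : r * 1e6 <= w.
  have : v * x <= v * v * v * x by apply: Rmult_le_compat_r; nra.
  by rewrite /r; lra.
have wr0 : 0 < w / r by apply: Rdiv_lt_0_compat.
have wrE : w / r * r = w by field; lra.
have wr_big : 1e6 <= w / r by apply: (Rmult_le_reg_r r); lra.
have [|P [P_le P_gt]] := @nat_floor (w / r); first lra.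
have [|L [L_ge L_le] L100] := @exists_L v; first lra.
have wr_pos : 0 < w * r by apply: Rmult_lt_0_compat.
have nP : INR n / INR P <= 1.002 * (w * r).
  apply: (Rmult_le_reg_r (INR P)); first lra.
  rewrite /Rdiv Rmult_assoc Rinv_l ?Rmult_1_r; last lra.
  have h1 : w / r <= 1.002 * INR P by lra.
  have : w * r * (w / r) <= w * r * (1.002 * INR P) by apply: Rmult_le_compat_l; lra.
  have -> : w * r * (w / r) = INR n by rewrite -ww; field; lra.
  by lra.
have Ph : INR P * INR h <= w * r.
  have -> : w * r = w / r * (r * r) by field; lra.
  by apply: Rmult_le_compat => //; [lra | exact: pos_INR].
have y1 : 1 <= y by lra.
have xy : y <= x by rewrite -yy; nra.
have w_le : w <= x * x.
  apply: Rsqr_incr_0_var; last by nra.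
  rewrite /Rsqr ww; apply: Rle_trans ns _; rewrite s3.
  have : 0 <= x * x * x by repeat apply: Rmult_le_pos; lra.
  have : 1 <= x by lra.
  by nra.
have P2 : INR P * INR P <= 1e-3 * (w * r).
  apply: Rle_trans (_ : w / r * (w / r) <= _); first by apply: Rmult_le_compat; lra.
  apply: (Rmult_le_reg_r (r * r)); first nra.
  have -> : w / r * (w / r) * (r * r) = w * w by field; lra.
  have r3 : w <= 1e-3 * (r * r * r).
    apply: Rle_trans w_le _.
    have h1 : x <= 1e-3 * r by rewrite /r; nra.
    have h2 : x <= r by lra.
    have h3 : 1 <= r by lra.
    have h4 : x * x <= 1e-3 * r * r by apply: Rmult_le_compat; lra.
    have h5 : 1e-3 * r * r * 1 <= 1e-3 * r * r * r by apply: Rmult_le_compat_l; nra.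
    lra.
  have : w * w <= w * (1e-3 * (r * r * r)) by apply: Rmult_le_compat_l; lra.
  by lra.
set M := 3 * INR P * INR h + 9 * (INR P * INR P) + 3 * (INR n / INR P).
have M_le : M <= 8422 * (v * x * w).
  by have : w * r = 1400 * (v * x * w) by [rewrite /r; ring]; rewrite /M; lra.
have M_ge : 0 <= M.
  rewrite /M; have := pos_INR h; have : 0 < INR n / INR P by apply: Rdiv_lt_0_compat; lra.
  by move=> ? ?; have : 0 <= INR P * INR h by [apply: Rmult_le_pos; lra]; nra.
have LL : INR L * INR L <= 82.81 * (v * v).
  have -> : 82.81 * (v * v) = (9.1 * v) * (9.1 * v) by lra.
  by apply: Rmult_le_compat; lra.
have k_le : INR k <= 2 * (x * x * x).
  by move/INR_leq: k2n; rewrite INR_mul [INR 2]/= -s3; lra.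
have k_ge : INR n <= 2 * INR k by move/INR_leq: n2k; rewrite INR_mul.
have vxw0 : 0 < v * x * w by repeat apply: Rmult_lt_0_compat; lra.
apply: Rle_lt_trans (three_logs_bound (P := P) (L := L) (lx := 1.25 * v) g0 nG lG n0 n2k k2n _ L100 _ _ _ _).
- apply: exp_incr; apply: Ropp_le_contravar; rewrite -/M.
  have : INR L * INR L * M <= 82.81 * (v * v) * (8422 * (v * x * w)).
    by apply: Rmult_le_compat => //; nra.
  have : 0 <= v * v * (v * x * w) by apply: Rmult_le_pos; nra.
  by lra.
- by apply/INR_leq; rewrite [INR 2]/=; lra.
- lra.
- lra.
- apply: (log_size_ok _ xE) => //; try lra.
  apply: Rle_trans P_le _; apply: Rle_trans (_ : w / (1400 * v) / x <= _).
    by apply: Req_le; rewrite /r; field; lra.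
  apply: (Rmult_le_reg_r x) => //.
  have -> : w / (1400 * v) / x * x = w / (1400 * v) by field; lra.
  apply: Rle_trans w_le; apply: (Rmult_le_reg_r (1400 * v)); first lra.
  have -> : w / (1400 * v) * (1400 * v) = w by field; lra.
  by nra.
rewrite -/M; apply: Rle_trans (_ : 28 * (9.1 * v) * (8422 * (v * x * w)) <= _).
  by apply: Rmult_le_compat; lra.
have : 4.3e6 * (v * v * x) * w <= w * w.
  apply: Rmult_le_compat_r; first lra.
  have : v * v * x <= v * v * v * x by apply: Rmult_le_compat_r; nra.
  have : 0 <= v * v * x by apply: Rmult_le_pos; lra.
  by lra.
by rewrite ww; lra.
Qed.

Lemma corr_bounds m : (0 < m)%N -> -0.62 <= corr m <= 0.39.
Proof.
move=> m0; have [d0 d1] := phi_sqr_inv_pow m0; rewrite /corr.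
have ln_le1 z : 0 < z -> ln z <= z - 1.
  by move=> z0; have := exp_ineq1_le (ln z); rewrite exp_ln //; lra.
case: (odd m).
  have i1 : 1 <= / (1 - phi_sqr_inv ^ m) by rewrite -{1}Rinv_1; apply: Rinv_le_contravar; lra.
  have i2 : / (1 - phi_sqr_inv ^ m) <= / 0.6179 by apply: Rinv_le_contravar; lra.
  have := ln_le1 _ (Rlt_le_trans _ _ _ Rlt_0_1 i1); have := ln_le Rlt_0_1 i1.
  by rewrite ln_1; lra.
have h1 : 1 <= 1 + phi_sqr_inv ^ m by lra.
have := ln_le1 _ (Rlt_le_trans _ _ _ Rlt_0_1 h1); have := ln_le Rlt_0_1 h1.
by rewrite ln_1; lra.
Qed.

(** The linear form is at most 3 / 4 in absolute value, so k / (m + n) is close to ln phi / ln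
    alpha, about 0.79. *)
Lemma index_ratio k m n : (1 <= m)%N -> (3 <= n)%N ->
  tribonacci k = (lucas m * lucas n)%N ->
  0.788 * INR (m + n) - 0.7 <= INR k <= 0.792 * INR (m + n) + 4.
Proof.
move=> m1 n3 eqT; have := linear_form_lucas m1 n3 eqT.
rewrite ln_gam_lucas // exp_Ropp -phi_pow_exp INR_add.
have [la lf lg] := log_bounds; have cb := corr_bounds m1.
have f3 : 4 <= phi ^ n.
  apply: Rle_trans (_ : phi ^ 3 <= _); first by have := phi_bounds; rewrite /=; nra.
  by apply: Rle_pow; [have := phi_bounds; lra | apply/ssrnat.leP].
have : / phi ^ n <= / 4 by apply: Rinv_le_contravar; lra.
move=> i4; rewrite /Rabs; have m0 := pos_INR m; have n0 := pos_INR n; have k0 := pos_INR k.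
have h1 : 0.481 * (INR m + INR n) <= (INR m + INR n) * lphi <= 0.482 * (INR m + INR n) by nra.
have h2 : 0.609 * INR k <= INR k * lalpha <= 0.61 * INR k by nra.
by case: Rcase_abs; split; lra.
Qed.

Definition z_gam_lucas m := (z_gam * (lucas m)%:R)%R.

Lemma ev_gam_lucas m : ev (z_gam_lucas m) = gam * INR (lucas m).
Proof. by rewrite /z_gam_lucas ev_mul ev_gam rmorph_nat INRE. Qed.

Lemma nrm_z_gam : nrm z_gam <= exp 3.
Proof.
apply: Rle_trans (_ : 2.7 ^ 3 <= _); last first.
  by apply: Rle_trans (exp_nat_ge 3) _; apply: exp_incr; rewrite INR_IZR_INZ /=; lra.
by have := alpha_bounds; rewrite /nrm /ev /val6 /=; nra.
Qed.

Lemma nrm_gam_lucas m : nrm (z_gam_lucas m) <= exp (INR (4 + m)).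
Proof.
have -> : INR (4 + m) = 3 + (1 + INR m * 1) by rewrite INR_add /=; lra.
apply: nrm_mul_exp_le nrm_z_gam _.
apply: Rle_trans (elimT RleP (nrm_nat_le (lucas m))) _; rewrite -INRE.
apply: Rle_trans (lucas_le m) _; rewrite exp_plus; have e1 := exp1_ge.
apply: Rmult_le_compat; [lra | exact/pow_le/Rlt_le/phi_gt0 | lra |].
rewrite phi_pow_exp; apply: exp_incr; apply: Rmult_le_compat_l; first exact: pos_INR.
by have := lphi_bounds; lra.
Qed.

Lemma ln_abs_height (g : R) h : 1 <= g -> g <= exp h -> Rabs (ln g) <= h.
Proof.
move=> g1 gh; have := ln_le Rlt_0_1 g1; rewrite ln_1 => l0.
rewrite Rabs_pos_eq //; have := ln_le (Rlt_le_trans _ _ _ Rlt_0_1 g1) gh.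
by rewrite ln_exp.
Qed.

Lemma gam_lucas_ge1 m : 1 <= gam * INR (lucas m).
Proof. by have := gam_bounds; have := lucas_ge1 m; nra. Qed.

Lemma ln_gam_lucas_height m : Rabs (ln (ev (z_gam_lucas m))) <= INR (4 + m).
Proof.
apply: ln_abs_height; first by rewrite ev_gam_lucas; exact: gam_lucas_ge1.
apply: Rle_trans (Rle_abs _) _; apply: Rle_trans (ev_le_nrm _) _; exact: nrm_gam_lucas.
Qed.

Lemma exp_upper (a : nat) : exp (INR a) <= 2.7305 ^ a.
Proof.
rewrite -[INR a]Rmult_1_r -[X in X <= _](_ : exp 1 ^ a = _).
  by apply: pow_incr; split; [exact/Rlt_le/exp_pos | exact: exp1_le].
by rewrite RpowE expRX -GRing.mulr_natl -INRE.
Qed.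

Lemma exp_upper_Z (a : nat) (K : Z) :
  is_true (2 * 27305 ^ Z.of_nat a <=? K * 10000 ^ Z.of_nat a)%BZ -> 2 * exp (INR a) <= IZR K.
Proof.
move/Z.leb_le/IZR_le; rewrite !mult_IZR -!pow_IZR => h.
have t0 : 0 < 10000 ^ a by apply: pow_lt; lra.
apply: Rle_trans (Rmult_le_compat_l _ _ _ _ (exp_upper a)) _; first lra.
apply: (Rmult_le_reg_r (10000 ^ a)) => //; apply: Rle_trans h.
apply: Req_le; rewrite Rmult_assoc -Rpow_mult_distr; congr (_ * _ ^ _); lra.
Qed.

Section Bound.
Variables k m n : nat.
Hypotheses (m1 : (1 <= m)%N) (le_mn : (m <= n)%N) (n_big : (12 <= n)%N).
Hypothesis eqT : tribonacci k = (lucas m * lucas n)%N.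

Let n3 : (3 <= n)%N. Proof. exact: leq_trans n_big. Qed.
Let n0 : (0 < n)%N. Proof. exact: leq_trans n3. Qed.
Let nr : 12 <= INR n.
Proof. by have := (INR_leq 12 n).2 n_big; rewrite [INR 12]INR_IZR_INZ. Qed.
Let mr : 1 <= INR m. Proof. exact: (INR_leq 1 m).2. Qed.
Let mnr : INR m <= INR n. Proof. exact: (INR_leq m n).2. Qed.

(** As m <= n, [index_ratio] gives k <= 1.584 n + 4, which is at most 2 n for n >= 12. *)
Lemma ratios : [/\ (n <= 2 * k)%N, (k <= 2 * n)%N, (m + n <= 2 * k)%N & (k <= 2 * (m + n))%N].
Proof.
have := index_ratio m1 n3 eqT; rewrite INR_add => h.
by split; apply/INR_leq; rewrite ?INR_mul ?INR_add [INR 2]/=; lra.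
Qed.

(** The form in ln gam bounds m, and with it the height of gam L_m. The second form then gives 0.481
    n < 1.07e9 v^3 x sqrt n + 2, against sqrt n >= 3.7e9 v^3 x. *)
Lemma sum_lt_exp240 : INR (m + n) < exp 240.
Proof.
have [n2k k2n s2k k2s] := ratios; have [la lf lg] := log_bounds.
apply: Rnot_le_lt => s_ge.
pose v := ln (INR (m + n)); pose x := exp (v / 3).
have s0 : (0 < m + n)%N by rewrite addn_gt0 n0 orbT.
have s0r : 0 < INR (m + n) by apply: (INR_ltn 0 _).2.
have v240 : 240 <= v by rewrite -(ln_exp 240); apply: ln_le => //; exact: exp_pos.
have x0 : 0 < x by exact: exp_pos.
have x1 : 1 <= x by rewrite -exp_0; apply: exp_incr; lra.
have vx : 57600 <= v * v * (x * x).
  have : 57600 <= v * v by nra.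
  have : 1 <= x * x by nra.
  by nra.
(* This absorbs the factors 6 and 3 in front of the two upper bounds. *)
have e2 : 7.29 <= exp 2.
  apply: Rle_trans (_ : 2.7 ^ 2 <= _); first by rewrite /=; lra.
  by apply: Rle_trans (exp_nat_ge 2) _; exact: Rle_refl.
have m_le : INR m <= 1.61e6 * (v * v * (x * x)).
  have [m2|m_lt2] := leqP 2 m; last first.
    have -> : m = 1%N by apply/eqP; rewrite eqn_leq -ltnS m_lt2 m1.
    by rewrite [INR 1]/=; lra.
  have lin := linear_form_product m2 le_mn eqT.
  have g1 : 1 <= gam by have := gam_bounds; lra.
  have i3 : INR 3 = 3 by rewrite INR_IZR_INZ.
  have nG : nrm z_gam <= exp (INR 3) by rewrite i3; exact: nrm_z_gam.
  have lG : Rabs (ln (ev z_gam)) <= INR 3.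
    by rewrite ev_gam Rabs_pos_eq ?i3; lra.
  have gG : 0 < ev z_gam by rewrite ev_gam; lra.
  have h300 : INR 3 <= 300 by rewrite i3; lra.
  have v70 : 70 <= v by lra.
  have := fixed_height_bound gG nG lG h300 s0 s2k k2s (erefl v) v70 (erefl x).
  rewrite ev_gam => lo.
  have := Rlt_le_trans _ _ _ lo lin => lt.
  have : exp (- (1.54e6 * (v * v) * (x * x))) < exp (2 + - (2 * INR m * lphi)).
    apply: Rlt_le_trans lt _; rewrite exp_plus; apply: Rmult_le_compat_r; last lra.
    exact/Rlt_le/exp_pos.
  move/exp_lt_inv => lt2.
  have : 0.481 * INR m <= INR m * lphi by nra.
  by lra.
have h_le : INR (4 + m) <= (1400 * v * x) * (1400 * v * x).
  have -> : (1400 * v * x) * (1400 * v * x) = 1.96e6 * (v * v * (x * x)) by lra.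
  by rewrite INR_add [INR 4]INR_IZR_INZ /=; lra.
have g0 : 0 < ev (z_gam_lucas m) by rewrite ev_gam_lucas; have := gam_lucas_ge1 m; lra.
have sE : INR (m + n) = exp v by rewrite /v exp_ln.
have sn : INR n <= INR (m + n) <= 2 * INR n by rewrite INR_add; lra.
have [lo w_big] := growing_height_bound g0 (nrm_gam_lucas m) (ln_gam_lucas_height m) n0 n2k k2n
  sE v240 (erefl x) sn h_le.
rewrite ev_gam_lucas in lo.
have lt := Rlt_le_trans _ _ _ lo (linear_form_lucas m1 n3 eqT).
have : exp (- (1.07e9 * (v * v * v) * x * sqrt (INR n))) < exp (2 + - (INR n * lphi)).
  apply: Rlt_le_trans lt _; rewrite exp_plus; apply: Rmult_le_compat_r; last lra.
  exact/Rlt_le/exp_pos.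
move/exp_lt_inv; have nE : sqrt (INR n) * sqrt (INR n) = INR n by apply: sqrt_sqrt; lra.
have w0 := sqrt_pos (INR n).
have : 3.7e9 * (v * v * v) * x * sqrt (INR n) <= sqrt (INR n) * sqrt (INR n).
  by apply: Rmult_le_compat_r.
have : 0.481 * INR n <= INR n * lphi by nra.
by rewrite nE; move: (_ * x * sqrt (INR n)) => ? ? ? ?; nra.
Qed.

Lemma nat_le_IZR (K : Z) : INR k <= IZR K -> (Z.of_nat k <= K)%BZ.
Proof. by rewrite INR_IZR_INZ => /le_IZR. Qed.

Lemma m_le262 : (m <= 262)%N.
Proof.
have [m2|m_lt2] := leqP 2 m; last by apply: leq_trans (ltnW m_lt2) _.
apply: (bound_m_first (k := k) (N := m + n)); last exact: linear_form_product.
have [_ _ _ /INR_leq] := ratios; rewrite INR_mul [INR 2]/= => k2s.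
have := sum_lt_exp240; have := @exp_upper_Z 240 K0.
rewrite [INR 240]INR_IZR_INZ => /(_ isT) hK lt; apply: nat_le_IZR.
by change (IZR (Z.of_nat 240)) with 240 in hK; lra.
Qed.

(** With m <= 262 the height of gam L_m is at most 266, so [fixed_height_bound] now applies to the
    second form; from v = 72 on, 0.481 x exceeds 1.54e6 v^2 with room to spare. *)
Lemma n_lt_exp72 : INR n < exp 72.
Proof.
have [n2k k2n s2k k2s] := ratios; have [la lf lg] := log_bounds.
apply: Rnot_le_lt => n_ge.
pose v := ln (INR n); pose x := exp (v / 3).
have n0r : 0 < INR n by lra.
have v72 : 72 <= v by rewrite -(ln_exp 72); apply: ln_le => //; exact: exp_pos.
have v70 : 70 <= v by lra.
have h300 : INR (4 + m) <= 300.
  have := (INR_leq _ _).2 m_le262.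
  by rewrite INR_add [INR 4]INR_IZR_INZ [INR 262]INR_IZR_INZ /=; lra.
have g0 : 0 < ev (z_gam_lucas m) by rewrite ev_gam_lucas; have := gam_lucas_ge1 m; lra.
have := fixed_height_bound g0 (nrm_gam_lucas m) (ln_gam_lucas_height m) h300 n0 n2k k2n
  (erefl v) v70 (erefl x).
rewrite ev_gam_lucas => lo.
have lt := Rlt_le_trans _ _ _ lo (linear_form_lucas m1 n3 eqT).
have e2 : 7.29 <= exp 2.
  apply: Rle_trans (_ : 2.7 ^ 2 <= _); first by rewrite /=; lra.
  by apply: Rle_trans (exp_nat_ge 2) _; exact: Rle_refl.
have : exp (- (1.54e6 * (v * v) * (x * x))) < exp (2 + - (INR n * lphi)).
  apply: Rlt_le_trans lt _; rewrite exp_plus; apply: Rmult_le_compat_r; last lra.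
  exact/Rlt_le/exp_pos.
move/exp_lt_inv => lt2.
have x0 : 0 < x by exact: exp_pos.
have nE : INR n = x * x * x.
  by rewrite /x -!exp_plus (_ : v / 3 + v / 3 + v / 3 = v) ?exp_ln //; field.
have e12 : 1.5e5 <= exp (/ 6 * 72).
  apply: Rle_trans (_ : 2.7 ^ 12 <= _); first by rewrite /=; lra.
  by apply: Rle_trans (exp_nat_ge 12) _; apply: exp_incr; rewrite INR_IZR_INZ /=; lra.
have e6 : 1850 * v <= exp (/ 6 * v) by apply: (exp_dominates (v0 := 72)); lra.
have x_ge : 3.4e6 * (v * v) <= x.
  rewrite /x (_ : v / 3 = / 6 * v + / 6 * v) ?exp_plus; last by field.
  have : (1850 * v) * (1850 * v) <= exp (/ 6 * v) * exp (/ 6 * v) by apply: Rmult_le_compat; lra.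
  by have : 0 <= v * v by [nra]; lra.
have vv : 5184 <= v * v by nra.
have xx : 1 <= x * x by nra.
have : 3.4e6 * (v * v) * (x * x) <= x * (x * x) by apply: Rmult_le_compat_r; lra.
have : 5184 * 1 <= v * v * (x * x) by apply: Rmult_le_compat; lra.
have h4 : 0.481 * INR n <= INR n * lphi by nra.
rewrite nE in h4; rewrite nE in lt2; move: h4 lt2.
by move: (v * v) (x * x) xx vv => a b xx vv h4 lt2; lra.
Qed.

Lemma index_bound : (n <= 185)%N.
Proof.
have [_ /INR_leq k2n _ _] := ratios; rewrite INR_mul [INR 2]/= in k2n.
have kK1 : (Z.of_nat k <= K1)%BZ.
  have := n_lt_exp72; have := @exp_upper_Z 72 K1.
  rewrite [INR 72]INR_IZR_INZ => /(_ isT) hK lt; apply: nat_le_IZR.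
  by change (IZR (Z.of_nat 72)) with 72 in hK; lra.
have m86 : (m <= 86)%N.
  have [m2|m_lt2] := leqP 2 m; last by apply: leq_trans (ltnW m_lt2) _.
  by apply: (bound_m_second kK1 (N := m + n)); exact: linear_form_product.
by apply: (bound_n kK1 _ (linear_form_lucas m1 n3 eqT)); rewrite m1.
Qed.
End Bound.

(* The finitely many remaining cases *)
Local Close Scope R_scope.
Local Open Scope nat_scope.

Fixpoint tribZ (k : nat) : Z * Z * Z :=
  if k is k'.+1 then let: (x, y, z) := tribZ k' in (y, z, (x + y + z)%BZ)
  else (0, 1, 1)%BZ.

Lemma tribZE k : (tribZ k).1.1 = Z.of_nat (tribonacci k).
Proof.
suff: tribZ k = (Z.of_nat (tribonacci k), Z.of_nat (tribonacci k.+1),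
  Z.of_nat (tribonacci k.+2)) by move=> ->.
elim: k => [//|k IHk]; rewrite /tribZ -/tribZ IHk; congr (_, _, _).
by rewrite trib_rec -!plusE; lia.
Qed.

Lemma lucasZ_nat n : (lucasZ n).1 = Z.of_nat (lucas n).
Proof. by apply: eq_IZR; rewrite -lucasZE INR_IZR_INZ. Qed.

Lemma trib_mono i j : i <= j -> tribonacci i <= tribonacci j.
Proof.
move=> le_ij; rewrite -(subnKC le_ij); elim: (j - i) => [|d IHd]; first by rewrite addn0.
rewrite addnS; apply: leq_trans IHd _.
by case: (i + d) => [|[|[|e]]] //; rewrite [X in _ <= X]trib_rec -addnA leq_addr.
Qed.

Definition solutions := [:: (1, 1, 1); (2, 1, 1); (4, 1, 3); (5, 1, 4); (8, 3, 5)].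

Definition small_hits T m n p : bool :=
  all (fun t => if (t.2 =? p)%BZ then (t.1, m, n) \in solutions else true) T.

(** The test L_N^2 < T_(K+1) is what bounds k by K, since T is monotone and the first test gives L_m
    L_n <= L_N^2. The list L starts at index 1, so [take y.1 L] keeps exactly the m <= n. *)
Definition small_check (K N : nat) : bool :=
  let T := [seq (k, (tribZ k).1.1) | k <- iota 1 K] in
  let L := [seq (n, (lucasZ n).1) | n <- iota 1 N] in
  [&& all (fun y => (0 <=? y.2)%BZ && (y.2 <=? (lucasZ N).1)%BZ) L,
   ((lucasZ N).1 * (lucasZ N).1 <? (tribZ K.+1).1.1)%BZ &
   all (fun y => all (fun x => small_hits T x.1 y.1 (x.2 * y.2)%BZ) (take y.1 L)) L].

Lemma small_check_sound K N k m n : small_check K N ->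
  0 < k -> 0 < m -> 0 < n -> m <= n -> n <= N ->
  tribonacci k = lucas m * lucas n -> (k, m, n) \in solutions.
Proof.
move=> /and3P[/allP Lb /Z.ltb_lt lt_T /allP chk] k0 m0 n0 le_mn nN eqT.
have eqZ : (tribZ k).1.1 = ((lucasZ m).1 * (lucasZ n).1)%BZ.
  by rewrite tribZE !lucasZ_nat eqT Nat2Z.inj_mul.
have inL j : 0 < j -> j <= N -> (j, (lucasZ j).1) \in [seq (n, (lucasZ n).1) | n <- iota 1 N].
  by move=> j0 jN; apply: map_f; rewrite mem_iota j0 add1n ltnS.
have m_in := inL m m0 (leq_trans le_mn nN); have n_in := inL n n0 nN.
have kK : k <= K.
  rewrite leqNgt; apply/negP => /trib_mono/ssrnat.leP/Nat2Z.inj_le.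
  rewrite -!tribZE eqZ => le_T.
  have /andP[/Z.leb_le m_ge0 /Z.leb_le m_le] := Lb _ m_in.
  have /andP[/Z.leb_le n_ge0 /Z.leb_le n_le] := Lb _ n_in.
  have := Z.mul_le_mono_nonneg _ _ _ _ m_ge0 m_le n_ge0 n_le.
  by move=> le_L; have := Z.le_lt_trans _ _ _ (Z.le_trans _ _ _ le_T le_L) lt_T; apply: Z.lt_irrefl.
have k_in : (k, (tribZ k).1.1) \in [seq (k, (tribZ k).1.1) | k <- iota 1 K].
  by apply: map_f; rewrite mem_iota k0 add1n ltnS.
have m_take : (m, (lucasZ m).1) \in take n [seq (n, (lucasZ n).1) | n <- iota 1 N].
  by rewrite -map_take take_iota (minn_idPl nN) map_f // mem_iota m0 add1n ltnS.
have /allP/(_ _ m_take)/allP/(_ _ k_in) := chk _ n_in.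
by rewrite /= eqZ Z.eqb_refl.
Qed.

Lemma small_check_185 : small_check 300 185.
Proof. by vm_cast_no_check (erefl true). Qed.

Theorem theorem2p1 (k m n : nat) :
  [/\ 0 < k, 0 < m, 0 < n, m <= n & tribonacci k = lucas m * lucas n] <->
  (k, m, n) \in [:: (1, 1, 1); (2, 1, 1); (4, 1, 3); (5, 1, 4); (8, 3, 5)].
Proof.
split=> [[k0 m0 n0 le_mn eqT]|].
  apply: (small_check_sound small_check_185) => //; case: (leqP 12 n) => [n12|/ltnW/leq_trans -> //].
  exact: index_bound eqT.
by rewrite !inE => /or4P[||| /orP[]] /eqP[-> -> ->].
Qed.
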